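(* Let $t_1,t_2\in\mathbb{R}$ and let $\rho_{t_1,t_2}$ be the Borel probability measure on $\mathbb{R}^2$ $$\rho_{t_1,t_2}=\frac12\left(\mathcal{L}_{[t_1,t_1+1]}\times\delta_0+\delta_0\times\mathcal{L}_{[t_2,t_2+1]}\right).$$ Then $\rho_{t_1,t_2}$ is a spectral measure if and only if $t_1+t_2\in\mathbb{Z}\setminus\{-1\}$ or $t_1-t_2\in\mathbb{Z}\setminus\{0\}$.
   Context: $\mathcal{L}_{[a,b]}$ denotes Lebesgue measure on $\mathbb{R}$ restricted to $[a,b]$, and $\delta_0$ the Dirac measure at $0\in\mathbb{R}$. A Borel probability measure $\mu$ on $\mathbb{R}^n$ is a spectral measure if there is a countable set $\Lambda\subset\mathbb{R}^n$ such that $E(\Lambda)=\{e^{-2\pi i\lambda\cdot x}:\lambda\in\Lambda\}$ is an orthogonal basis of $L^2(\mu)$; such a $\Lambda$ is called a spectrum of $\mu$. *)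

(* Defs.v *)
From HB Require Import structures.
From mathcomp Require Import all_boot all_order all_algebra.
From mathcomp Require Import all_classical all_reals all_analysis.
From mathcomp Require Import complex.

Set Implicit Arguments.
Unset Strict Implicit.
Unset Printing Implicit Defensive.
Import Order.TTheory GRing.Theory Num.Theory.
Import numFieldNormedType.Exports.

Local Open Scope classical_set_scope.
Local Open Scope ring_scope.
Local Open Scope complex_scope.

Section ComplexL2.
Context d (T : measurableType d) (R : realType).
Variable mu : {measure set T -> \bar R}.
Implicit Types f g : T -> R[i].

Definition L2norm f : \bar R :=
  'N[mu]_2%:E[EFin \o (@ComplexField.Normc.normc R \o f)].

(* Elements of L^2(mu) are represented by square integrable functions; the
   identification of mu-a.e. equal functions is implicit, since everything
   below only sees them through [L2norm] and [L2dot]. *)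
Definition L2 f : Prop :=
  [/\ measurable_fun setT (fun x => complex.Re (f x)),
      measurable_fun setT (fun x => complex.Im (f x)) &
      (L2norm f < +oo)%E].

Definition L2dot f g : R[i] :=
  (\int[mu]_x complex.Re (f x * (g x)^*)) +i*
  (\int[mu]_x complex.Im (f x * (g x)^*)).

(* Orthogonal basis in the Hilbert space sense: nonzero, pairwise orthogonal
   vectors whose finite linear combinations are dense. *)
Definition L2_orthogonal_basis (I : choiceType) (A : set I)
    (e : I -> T -> R[i]) : Prop :=
  [/\ forall i, A i -> L2 (e i) /\ L2norm (e i) != 0%E,
      forall i j, A i -> A j -> i != j -> L2dot (e i) (e j) = 0 &
      forall f, L2 f -> forall eps : R, 0 < eps ->
        exists (s : seq I) (c : I -> R[i]),
          [set` s] `<=` A /\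
          (L2norm (fun x => f x - \sum_(i <- s) c i * e i x)%R < eps%:E)%E].

End ComplexL2.

Section SpectralMeasure.
Context (R : realType).

(* The Borel plane: R * R with the product of the Borel sigma-algebras. *)
Local Notation plane := (measurableTypeR R * measurableTypeR R)%type.

Definition dot2 (u v : R * R) : R := u.1 * v.1 + u.2 * v.2.

Definition cis (t : R) : R[i] := cos t +i* sin t.

Definition exponential (lambda : R * R) (x : plane) : R[i] :=
  cis (- (2 * pi * dot2 lambda x)).

Definition is_spectrum (mu : probability plane R) (Lambda : set (R * R)) :
    Prop :=
  countable Lambda /\ L2_orthogonal_basis mu Lambda exponential.

Definition spectral_measure (mu : probability plane R) : Prop :=
  exists Lambda : set (R * R), is_spectrum mu Lambda.

End SpectralMeasure.

Section LebesgueSegment.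
Context (R : realType) (a b : R).

Definition lebesgue_segment : set (measurableTypeR R) -> \bar R :=
  mrestr (@lebesgue_measure R) (measurable_itv `[a, b]).

HB.instance Definition _ := Measure.on lebesgue_segment.

Let lebesgue_segment_fin : fin_num_fun lebesgue_segment.
Proof.
apply: lty_fin_num_fun => /=; rewrite /lebesgue_segment /mrestr setTI.
by rewrite lebesgue_measure_itv; case: ifP => _ //=; rewrite -EFinB ltry.
Qed.

HB.instance Definition _ :=
  Measure_isFinite.Build _ _ _ lebesgue_segment lebesgue_segment_fin.

End LebesgueSegment.

Section PlusMeasure.
Context (R : realType) (t1 t2 : R).
Local Notation plane := (measurableTypeR R * measurableTypeR R)%type.
Local Notation delta0 := (@dirac _ (measurableTypeR R) 0 R).

Definition rho : set plane -> \bar R :=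
  mscale (2^-1)%:nng
    (measure_add (lebesgue_segment t1 (t1 + 1) \x delta0)%E
                 (delta0 \x lebesgue_segment t2 (t2 + 1))%E).

HB.instance Definition _ := Measure.on rho.

Let lebesgue_segmentT (t : R) : lebesgue_segment t (t + 1) setT = 1%E.
Proof.
rewrite /lebesgue_segment /mrestr setTI /= lebesgue_measure_itv /= lte_fin.
by rewrite ltrDl ltr01 -EFinB addrAC subrr add0r.
Qed.

Let rho_setT : rho setT = 1%E.
Proof.
transitivity ((2^-1)%:E * ((lebesgue_segment t1 (t1 + 1) \x delta0) setT +
                         (delta0 \x lebesgue_segment t2 (t2 + 1)) setT))%E.
  by congr (_ * _)%E; exact: measure_addE.
rewrite -setXTT !product_measure1E//= !lebesgue_segmentT !diracT !mule1.
by rewrite -EFinD -EFinM mulVf// pnatr_eq0.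
Qed.

HB.instance Definition _ := Measure_isProbability.Build _ _ _ rho rho_setT.

End PlusMeasure.

(* Main.v *)
(* Put a = t1 + 1/2, b = t2 + 1/2.  Orthogonality of two exponentials at
   difference (d1, d2) reads sinc d1 e(a d1) + sinc d2 e(b d2) = 0, so
   |sinc d1| = |sinc d2|, and a difference is integral in the first coordinate
   iff it is in the second.  Testing Parseval's identity on windows of length
   s <= 1 of either arm gives sum sinc (s (xi - l))^2 = 2 / s for both
   projections of the spectrum, while one class mod Z contributes at most 1.

   Necessity.  Dividing d2^2 sin^2 (pi d1) = d1^2 sin^2 (pi d2) by
   |l|^2 and letting l go to infinity along an ultrafilter yields relations
   between the residues mod 1 of the two coordinates; two such limits rule out
   infinitely many classes mod Z.  Hence some class has three points, which
   forces the whole spectrum onto a line; Parseval for both projections gives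
   slope c = +-1.  Then there are exactly two classes, each a full translate of
   Z along the line, and the phases give a - b c in Z \ {0}.

   Sufficiency.  If a = n + c b with n <> 0, then x = n + c y folds one arm onto
   the other, and {(u, c u) : u in Z or u in Z + 1/(2n)} is a spectrum: the two
   halves of it act on the even and odd parts under the folding, so that
   completeness reduces to density of trigonometric polynomials on a period. *)

(* Orthogonality ties the two coordinates of a difference only through [sinc], which determines
   neither, and by itself it allows very sparse sets. Completeness is what forces points to exist:
   the value 2 of the Parseval sum is the inverse of the weight 1/2 of an arm, it exceeds the bound
   1 for a class, and so a shortage of points is refuted by evaluating the sum at a well-chosen
   centre. Limits at infinity help because the far point drops out of the relation: what remains
   holds for all points of the spectrum at once and involves only their residues. Taking the limits
   along an ultrafilter makes all bounded quantities converge together. Squaring loses signs that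
   depend on the point. As long as infinitely many classes are available, each ambiguity is settled
   by keeping a sign that still occurs on infinitely many of them. *)
Require Import Defs.
From HB Require Import structures.
From mathcomp Require Import all_boot all_order all_algebra.
From mathcomp Require Import all_classical all_reals all_analysis.
From mathcomp Require Import measurable_realfun complex ring lra.

Set Implicit Arguments.
Unset Strict Implicit.
Unset Printing Implicit Defensive.
Import Order.TTheory GRing.Theory Num.Theory.
Import numFieldNormedType.Exports.

Local Open Scope classical_set_scope.
Local Open Scope ring_scope.

(** * The function sinc *)

Section Sinc.
Context {R : realType}.
Implicit Types (x y d : R) (n : int).

Lemma sin_pi_int x : x \is a Num.int -> sin (pi * x) = 0.
Proof.
move=> /intrP[n ->]; have h m : sin (pi * m%:R) = 0 :> R.
  elim: m => [|m IH]; first by rewrite mulr0 sin0.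
  by rewrite -natr1 mulrDr mulr1 sinDpi IH oppr0.
case: (intP n) => [|m|m]; first by rewrite mulr0 sin0.
  exact: h.
by rewrite mulrNz mulrN sinN h oppr0.
Qed.

Lemma sin_pi_eq0 x : sin (pi * x) = 0 -> x \is a Num.int.
Proof.
move=> s0; have := floor_le x; have := floorD1_gt x.
set m := Num.floor x => xm mx.
have [->|xNm] := eqVneq x m%:~R; first exact: intr_int.
have : 0 < sin (pi * (x - m%:~R)).
  have pi0 := @pi_gt0 R; apply: sin_gt0_pi; rewrite mulr_gt0//=.
    by rewrite gtr_pMr// ltrBlDr addrC -intrD1.
  by rewrite subr_gt0 lt_neqAle eq_sym xNm.
by rewrite mulrBr sinB s0 (@sin_pi_int m%:~R) ?intr_int// mul0r mulr0 subrr ltxx.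
Qed.

Lemma sin_2pi_int n : sin (2 * pi * n%:~R) = 0 :> R.
Proof.
rewrite (_ : 2 * pi * n%:~R = pi * (2 * n%:~R)); last by ring.
by rewrite sin_pi_int// rpredM ?intr_int// rpred_nat.
Qed.

Lemma cos_2pi_int n : cos (2 * pi * n%:~R) = 1 :> R.
Proof.
have := cos_mulr2n (pi * (n%:~R : R)); rewrite cos2sin2 sin_pi_int ?intr_int//.
rewrite expr0n subr0 (_ : (pi * n%:~R) *+ 2 = 2 * pi * n%:~R); last first.
  by rewrite -mulr_natl mulrA.
by move=> ->; ring.
Qed.

Lemma cos_2pi_eq1 x : cos (2 * pi * x) = 1 -> x \is a Num.int.
Proof.
move=> c1; apply: sin_pi_eq0; apply/eqP; rewrite -sqrf_eq0; apply/eqP.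
have := cos_mulr2n (pi * x).
rewrite (_ : (pi * x) *+ 2 = 2 * pi * x) ?c1; last by rewrite -mulr_natl mulrA.
have := cos2Dsin2 (pi * x); set s := sin _; set c := cos _ => e1 e2; lra.
Qed.

Definition sinc x := if x == 0 then 1 else sin (pi * x) / (pi * x).

Lemma sinc0 : sinc 0 = 1. Proof. by rewrite /sinc eqxx. Qed.

Lemma sincE x : sin (pi * x) = pi * x * sinc x.
Proof.
rewrite /sinc; case: eqP => [->|/eqP x0]; first by rewrite mulr0 mul0r sin0.
by rewrite mulrCA divff ?mulr1// mulf_neq0// gt_eqF// pi_gt0.
Qed.

Lemma sincN x : sinc (- x) = sinc x.
Proof. by rewrite /sinc oppr_eq0 mulrN sinN invrN mulrNN. Qed.

Lemma sinc_norm x : sinc `|x| = sinc x.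
Proof. by case: (ger0P x) => // _; rewrite sincN. Qed.

Lemma sinc_int x : x \is a Num.int -> x != 0 -> sinc x = 0.
Proof. by move=> xi x0; rewrite /sinc (negbTE x0) sin_pi_int// mul0r. Qed.

Lemma sinc_eq0 x : sinc x = 0 -> x \is a Num.int.
Proof. by move=> e; apply: sin_pi_eq0; rewrite sincE e mulr0. Qed.

(** The constant 2 is a lower bound of pi, which keeps the later estimates rational. *)
Lemma sinc_sqr_le x : (2 * x) ^+ 2 * sinc x ^+ 2 <= 1.
Proof.
have := @sin_max R (pi * x); have := @pi_ge2 R; rewrite sincE => p2 s1.
have : `|pi * x * sinc x| ^+ 2 <= 1 by rewrite expr_le1.
rewrite real_normK ?num_real// -exprMn -!mulrA; set z := x * _ => h.
apply: le_trans h; rewrite !exprMn ler_wpM2r//.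
  by rewrite -exprMn sqr_ge0.
by rewrite lerXn2r ?nnegrE ?pi_ge0.
Qed.

Lemma is_derive_sinpx x : is_derive x 1 (fun x => sin x - x * cos x) (x * sin x).
Proof.
have h : is_derive x 1 (fun x => sin x - x * cos x)
   (cos x - (x * - sin x + cos x * 1)).
  apply: is_deriveB; exact: is_deriveM.
by apply: is_derive_eq; rewrite mulr1 opprD mulrN opprK addrCA subrr addr0.
Qed.

(** The function sin x - x cos x vanishes at 0 and its derivative x sin x is nonnegative up to
    pi. *)
Lemma xcos_le_sin x : 0 <= x <= pi -> x * cos x <= sin x.
Proof.
move=> /andP[x0 xpi]; rewrite -subr_ge0.
have dv y : derivable (fun x : R => sin x - x * cos x) y 1.
  by have := is_derive_sinpx y => -[].
have h : {in `[0, pi] &, {homo (fun x : R => sin x - x * cos x) :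
    x y / x <= y}}.
  apply: ger0_derive1_le_cc => //.
  - move=> y; rewrite in_itv/= => /andP[y0 yp].
    rewrite derive1E (@derive_val _ _ _ _ _ _ _ (is_derive_sinpx y)).
    by rewrite mulr_ge0 ?ltW// sin_gt0_pi// y0 yp.
  - apply: continuous_subspaceT => y.
    by apply: differentiable_continuous; apply/derivable1_diffP.
have := h 0 x; rewrite !in_itv/= lexx x0 xpi pi_ge0 sin0 mul0r subrr.
by apply.
Qed.

Lemma sin_le_id x : 0 <= x -> sin x <= x.
Proof.
move=> x0; rewrite -subr_ge0.
have dv y : is_derive y 1 (fun x : R => x - sin x) (1 - cos y).
  exact: is_deriveB.
have dr y : derivable (fun x : R => x - sin x) y 1 by have := dv y => -[].
have h : {in `[0, x] &, {homo (fun x : R => x - sin x) : x y / x <= y}}.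
  apply: ger0_derive1_le_cc => //.
  - move=> y _; rewrite derive1E (@derive_val _ _ _ _ _ _ _ (dv y)).
    by rewrite subr_ge0 cos_le1.
  - apply: continuous_subspaceT => y.
    by apply: differentiable_continuous; apply/derivable1_diffP.
have := h 0 x; rewrite !in_itv/= !lexx x0/= sin0 subrr.
by apply.
Qed.

Lemma sinc_sqr_le1 x : sinc x ^+ 2 <= 1.
Proof.
have pi0 := @pi_gt0 R; rewrite -sinc_norm.
have [->|x0] := eqVneq x 0; first by rewrite normr0 sinc0 expr1n.
have xp : 0 < `|x| by rewrite normr_gt0.
suff : `|sinc `|x| | <= 1.
  by move=> h; rewrite -real_normK ?num_real// expr_le1.
rewrite /sinc gt_eqF// normf_div ler_pdivrMr ?normr_gt0 ?mulf_neq0 ?gt_eqF//.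
rewrite mul1r [leRHS]gtr0_norm ?mulr_gt0// ler_norml; apply/andP; split.
  have := @sin_geN1 R (pi * `|x|); have [h|h] := leP 1 (pi * `|x|).
    by apply: le_trans; rewrite lerN2.
  move=> _; apply: (@le_trans _ _ 0); first by rewrite oppr_le0 mulr_ge0// ltW.
  rewrite sin_ge0_pi// mulr_ge0 ?ltW//= (lt_le_trans h)//.
  by apply: le_trans (@pi_ge2 R); rewrite ler1n.
by rewrite sin_le_id// mulr_ge0 ?ltW.
Qed.

Lemma sinc_gt0 x : `|x| < 1 -> 0 < sinc x.
Proof.
rewrite -sinc_norm; have [->|x0 x1] := eqVneq x 0; first by rewrite normr0 sinc0.
have pi0 := @pi_gt0 R; have xp : 0 < `|x| by rewrite normr_gt0.
rewrite /sinc gt_eqF// divr_gt0 ?mulr_gt0// sin_gt0_pi// mulr_gt0//=.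
by rewrite gtr_pMr.
Qed.

Lemma sinc_half x : sinc x = sinc (x / 2) * cos (pi * (x / 2)).
Proof.
have [->|x0] := eqVneq x 0; first by rewrite mul0r sinc0 mulr0 cos0 mulr1.
have h : pi * x * sinc x = pi * x * (sinc (x / 2) * cos (pi * (x / 2))).
  rewrite -sincE {1}(_ : pi * x = (pi * (x / 2)) *+ 2); last first.
    by rewrite -mulr_natr; field.
  by rewrite sin_mulr2n sincE -mulr_natr; field.
by apply: mulfI h; rewrite mulf_neq0// gt_eqF// pi_gt0.
Qed.

(* [|sinc y| <= |cos (pi y / 2)|] and [cos (pi x) <= sinc x], and [cos]
   is monotone; the bound on [x] keeps [y] in the main lobe. *)
Lemma sinc_sqr_eq_small x y : `|x| <= 1 / 4 -> sinc x ^+ 2 = sinc y ^+ 2 ->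
  `|y| <= 2 * `|x|.
Proof.
wlog [x0 y0] : x y / 0 <= x /\ 0 <= y.
  move=> h; rewrite -(sinc_norm x) -(sinc_norm y) => hx e.
  by have := h `|x| `|y|; rewrite !normr_id; apply.
rewrite !ger0_norm// => x4 e.
have pi0 := @pi_gt0 R.
(* Nonnegativity of cos (2 pi x) means that cos (pi x) ^ 2 is at least 1/2, whereas y > 1 would give
   sinc y ^ 2 < 1/4. *)
have c2 : 0 <= cos (2 * pi * x).
  apply: cos_ge0_pihalf; apply/andP; split.
    apply: (@le_trans _ _ 0); first by rewrite oppr_le0 divr_ge0 ?ltW.
    by rewrite !mulr_ge0// ltW.
  nra.
have c2E := cos_mulr2n (pi * x).
rewrite (_ : (pi * x) *+ 2 = 2 * pi * x) in c2E; last first.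
  by rewrite -mulr_natl mulrA.
have ccx : cos (pi * x) ^+ 2 <= sinc x ^+ 2.
  have [->|xN0] := eqVneq x 0; first by rewrite mulr0 cos0 sinc0.
  have xp : 0 < x by rewrite lt_neqAle eq_sym xN0.
  have c0 : 0 <= cos (pi * x).
    apply: cos_ge0_pihalf; apply/andP; split.
      apply: (@le_trans _ _ 0); first by rewrite oppr_le0 divr_ge0 ?ltW.
      by rewrite !mulr_ge0// ltW.
    nra.
  have : pi * x * cos (pi * x) <= sin (pi * x).
    by apply: xcos_le_sin; rewrite mulr_ge0 ?ltW//=; nra.
  rewrite sincE ler_pM2l ?mulr_gt0// => h.
  by rewrite ler_sqr ?nnegrE// (le_trans c0).
have y1 : y <= 1.
  rewrite leNgt; apply/negP => y1.
  have := sinc_sqr_le y; rewrite -e exprMn; nra.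
have ccy : sinc y ^+ 2 <= cos (pi * (y / 2)) ^+ 2.
  by rewrite sinc_half exprMn ler_piMl ?sqr_ge0 ?sinc_sqr_le1.
have [//|xy] := leP y (2 * x).
have yp : cos (pi * (y / 2)) < cos (pi * x).
  rewrite ltr_cos ?in_itv//=.
  - by rewrite ltr_pM2l// ltr_pdivlMr// mulrC.
  - by apply/andP; split; [rewrite mulr_ge0// ltW|nra].
  - by apply/andP; split; [rewrite mulr_ge0 ?divr_ge0// ltW|nra].
have yc : 0 <= cos (pi * (y / 2)).
  apply: cos_ge0_pihalf; apply/andP; split; last by nra.
  by apply: (@le_trans _ _ 0); rewrite ?oppr_le0 ?divr_ge0 ?mulr_ge0 ?divr_ge0 ?pi_ge0.
have : cos (pi * (y / 2)) ^+ 2 < cos (pi * x) ^+ 2.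
  by rewrite ltr_sqr ?nnegrE// (le_trans yc)// ltW.
by move=> /(le_lt_trans ccy); rewrite -e => /lt_le_trans/(_ ccx); rewrite ltxx.
Qed.

End Sinc.


(** * Limits along ultrafilters *)

Section Ultrafilters.
Context {T : choiceType}.

(** Compactness of [-M, M] gives a cluster point, and an ultrafilter converges to its cluster
    points. *)
Lemma ultra_bounded_cvg {R : realType} (U : set_system T) (f : T -> R) (M : R) :
  UltraFilter U -> (forall x, `|f x| <= M) -> exists x : R, f @ U --> x.
Proof.
move=> UU fM; have fU : (f @ U) [set` `[- M, M]].
  by apply: (@filterE _ U) => x; rewrite /= in_itv/= -ler_norml.
have [p [_ clp]] := @segment_compact R (- M) M _ (fmap_proper_filter f _) fU.
exists p => A Ap; have [//|UA] := in_ultra_setVsetC (f @^-1` A) UU.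
by have [y []] := clp (~` A) A UA Ap.
Qed.

Definition infinite_in (P : set T) := forall G : seq T, exists x, P x /\ x \notin G.

(** An ultrafilter finer than this filter plays the role of a sequence of distinct points of [P]. *)
Definition cofinite_in (P : set T) : set_system T :=
  [set A | exists G : seq T, forall x, P x -> x \notin G -> A x].

Lemma cofinite_in_proper (P : set T) :
  infinite_in P -> ProperFilter (cofinite_in P).
Proof.
move=> Pinf; apply: Build_ProperFilter_ex => [A [G GA]|].
  by have [x [Px xG]] := Pinf G; exists x; exact: GA.
split.
- by exists [::].
- move=> A B [G GA] [H HB]; exists (G ++ H) => x Px.
  by rewrite mem_cat negb_or => /andP[xG xH]; split; [exact: GA|exact: HB].
- by move=> A B AB [G GA]; exists G => x Px xG; apply: AB; exact: GA.
Qed.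

Lemma nonprincipal_ultra (P : set T) : infinite_in P ->
  exists2 U : set_system T, UltraFilter U & cofinite_in P `<=` U.
Proof.
by move=> /cofinite_in_proper /ultraFilterLemma[U [UU PU]]; exists U.
Qed.

End Ultrafilters.

(** * Point sets with the orthogonality and Parseval relations *)

Section PlusCombinatorics.
Context {R : realType} (a b : R) (L : set (R * R)).
Implicit Types (l m k : R * R) (F G : seq (R * R)) (xi s : R).

(** The spectrum enters this section only through these relations. The infinite Parseval sum is
    encoded by its finite partial sums: Bessel bounds all of them, Parseval finds one within [e] of
    the total. *)
Hypothesis orth_cos : forall l m, L l -> L m -> l != m ->
  sinc (l.1 - m.1) * cos (2 * pi * (a * (l.1 - m.1))) +
  sinc (l.2 - m.2) * cos (2 * pi * (b * (l.2 - m.2))) = 0.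
Hypothesis orth_sin : forall l m, L l -> L m -> l != m ->
  sinc (l.1 - m.1) * sin (2 * pi * (a * (l.1 - m.1))) +
  sinc (l.2 - m.2) * sin (2 * pi * (b * (l.2 - m.2))) = 0.
Hypothesis bessel1 : forall s xi F, 0 < s <= 1 -> uniq F ->
  {in F, forall l, L l} -> \sum_(l <- F) sinc (s * (xi - l.1)) ^+ 2 <= 2 / s.
Hypothesis bessel2 : forall s xi F, 0 < s <= 1 -> uniq F ->
  {in F, forall l, L l} -> \sum_(l <- F) sinc (s * (xi - l.2)) ^+ 2 <= 2 / s.
Hypothesis parseval1 : forall (s xi e : R), 0 < s <= 1 -> 0 < e -> exists F,
  [/\ uniq F, {in F, forall l, L l} &
      2 / s - e <= \sum_(l <- F) sinc (s * (xi - l.1)) ^+ 2].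
Hypothesis parseval2 : forall (s xi e : R), 0 < s <= 1 -> 0 < e -> exists F,
  [/\ uniq F, {in F, forall l, L l} &
      2 / s - e <= \sum_(l <- F) sinc (s * (xi - l.2)) ^+ 2].
Hypothesis bessel_int : forall xi (ks : seq R), uniq ks ->
  {in ks &, forall x y, x - y \is a Num.int} ->
  \sum_(x <- ks) sinc (xi - x) ^+ 2 <= 1.

(** Move one term of each orthogonality relation to the other side and add the squares: the phases
    cancel. *)
Lemma sinc_sqr12 l m : L l -> L m ->
  sinc (l.1 - m.1) ^+ 2 = sinc (l.2 - m.2) ^+ 2.
Proof.
move=> Ll Lm; have [->|lm] := eqVneq l m; first by rewrite !subrr.
have := orth_cos Ll Lm lm; have := orth_sin Ll Lm lm.
have := cos2Dsin2 (2 * pi * (a * (l.1 - m.1))).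
have := cos2Dsin2 (2 * pi * (b * (l.2 - m.2))).
set s1 := sinc _; set s2 := sinc (_ - _).
set c1 := cos _; set c2 := cos _; set t1 := sin _; set t2 := sin _.
move=> e1 e2 /eqP; rewrite addr_eq0 => /eqP f1 /eqP.
rewrite addr_eq0 => /eqP f2.
rewrite -[LHS]mulr1 -[RHS]mulr1 -[X in _ * X = _]e2 -[X in _ = _ * X]e1.
by rewrite !mulrDr -!exprMn f1 f2 !sqrrN.
Qed.

Lemma sin_sqr_rel l m : L l -> L m ->
  (l.2 - m.2) ^+ 2 * sin (pi * (l.1 - m.1)) ^+ 2 =
  (l.1 - m.1) ^+ 2 * sin (pi * (l.2 - m.2)) ^+ 2.
Proof. by move=> Ll Lm; rewrite !sincE !exprMn (sinc_sqr12 Ll Lm); ring. Qed.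

(** [sinc] has absolute value 1 only at 0, which is the case x = 0 of [sinc_sqr_eq_small]. *)
Lemma fst_inj l m : L l -> L m -> l.1 = m.1 -> l = m.
Proof.
move=> Ll Lm e; have := sinc_sqr12 Ll Lm; rewrite e subrr.
move=> /sinc_sqr_eq_small; rewrite normr0 mulr0 divr_ge0// => /(_ isT).
rewrite normr_le0 subr_eq0 => /eqP.
by case: l m e {Ll Lm} => ? ? [? ?] /= -> ->.
Qed.

Lemma snd_inj l m : L l -> L m -> l.2 = m.2 -> l = m.
Proof.
move=> Ll Lm e; have := sinc_sqr12 Ll Lm; rewrite e subrr => /esym.
move=> /sinc_sqr_eq_small; rewrite normr0 mulr0 divr_ge0// => /(_ isT).
rewrite normr_le0 subr_eq0 => /eqP.
by case: l m e {Ll Lm} => ? ? [? ?] /= -> ->.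
Qed.

(** * Classes modulo Z and phases *)

Definition eqv l m := l.1 - m.1 \is a Num.int.

Lemma eqvxx l : eqv l l. Proof. by rewrite /eqv subrr. Qed.
Lemma eqvC l m : eqv l m = eqv m l.
Proof. by rewrite /eqv -opprB rpredN. Qed.
Lemma eqv_trans m l k : eqv l m -> eqv m k -> eqv l k.
Proof.
by move=> lm mk; rewrite /eqv -(subrKA m.1) rpredD.
Qed.

(** A nonzero difference is an integer exactly when its [sinc] vanishes, and the two values of
    [sinc] vanish together. *)
Lemma eqv2 l m : L l -> L m -> eqv l m = (l.2 - m.2 \is a Num.int).
Proof.
move=> Ll Lm; have [->|lm] := eqVneq l m; first by rewrite eqvxx subrr rpred0.
have d1 : l.1 - m.1 != 0.
  by rewrite subr_eq0; apply: contraNneq lm => e; apply/eqP/fst_inj.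
have d2 : l.2 - m.2 != 0.
  by rewrite subr_eq0; apply: contraNneq lm => e; apply/eqP/snd_inj.
have e := sinc_sqr12 Ll Lm; apply/idP/idP => h; apply: sinc_eq0.
  by apply/eqP; rewrite -sqrf_eq0 -e sinc_int// expr0n.
by apply/eqP; rewrite -sqrf_eq0 e sinc_int// expr0n.
Qed.

Lemma sinc_neqv l m : ~~ eqv l m -> sinc (l.1 - m.1) != 0.
Proof. by apply: contraNneq => /sinc_eq0. Qed.

(** The two [sinc] factors are equal and nonzero; cancelling them leaves two opposite unit
    vectors. *)
Lemma phase l m : L l -> L m -> ~~ eqv l m ->
  (l.1 - m.1) ^+ 2 = (l.2 - m.2) ^+ 2 ->
  cos (2 * pi * (a * (l.1 - m.1)) - 2 * pi * (b * (l.2 - m.2))) = -1.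
Proof.
move=> Ll Lm lm /eqP; rewrite eqf_sqr => h.
have lNm : l != m by apply: contraNneq lm => ->; rewrite eqvxx.
have e : sinc (l.2 - m.2) = sinc (l.1 - m.1).
  by case/orP: h => /eqP ->//; rewrite sincN.
have := orth_cos Ll Lm lNm; have := orth_sin Ll Lm lNm; rewrite e -!mulrDr.
have := sinc_neqv lm; rewrite cosB.
set c1 := cos _; set c2 := cos _; set t1 := sin _; set t2 := sin _.
move=> s0 /eqP; rewrite mulf_eq0 (negbTE s0)/= addr_eq0 => /eqP et.
move=> /eqP; rewrite mulf_eq0 (negbTE s0)/= addr_eq0 => /eqP ec.
have := cos2Dsin2 (2 * pi * (b * (l.2 - m.2))); rewrite -/c2 -/t2 et ec.
move=> h1; transitivity (- (c2 ^+ 2 + t2 ^+ 2)); [ring|by rewrite h1].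
Qed.

(* The phases [a d1 - b d2] are additive, and sums of two numbers in
   [1/2 + Z] are not in [1/2 + Z]. *)
Lemma no_three_sqr_eq l m k : L l -> L m -> L k ->
  ~~ eqv l m -> ~~ eqv m k -> ~~ eqv l k ->
  (l.1 - m.1) ^+ 2 = (l.2 - m.2) ^+ 2 -> (m.1 - k.1) ^+ 2 = (m.2 - k.2) ^+ 2 ->
  (l.1 - k.1) ^+ 2 = (l.2 - k.2) ^+ 2 -> False.
Proof.
move=> Ll Lm Lk lm mk lk e1 e2 e3.
have := phase Ll Lm lm e1; have := phase Lm Lk mk e2.
have := phase Ll Lk lk e3.
set A := _ - _; set B := _ - _; set C := _ - _.
have -> : A = C + B by rewrite /A /B /C; ring.
rewrite cosD => h1 h2 h3; have := cos2Dsin2 B; have := cos2Dsin2 C.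
rewrite h2 h3 in h1 *; rewrite !sqrrN expr1n => /eqP.
rewrite addrC -subr_eq0 addrK sqrf_eq0 => /eqP s0 _; move: h1.
rewrite s0 mul0r subr0 mulrNN mulr1 => h; lra.
Qed.

(** * Counting points with Parseval sums *)

Lemma sum_sinc_far F xi (N : R) : (size F)%:R + 1 <= N ->
  {in F, forall l, N <= `|xi - l.1|} ->
  \sum_(l <- F) sinc (xi - l.1) ^+ 2 <= 1 / 4.
Proof.
move=> FN h; have N1 : 1 <= N by rewrite (le_trans _ FN)// lerDr.
have : \sum_(l <- F) sinc (xi - l.1) ^+ 2 <= \sum_(l <- F) (4 * N ^+ 2)^-1.
  rewrite big_seq [leRHS]big_seq; apply: ler_sum => l /h lN.
  rewrite -[leRHS]mul1r ler_pdivlMr ?mulr_gt0 ?exprn_gt0 ?(lt_le_trans _ N1)//.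
  apply: le_trans (sinc_sqr_le (xi - l.1)); rewrite mulrC ler_wpM2r ?sqr_ge0//.
  rewrite exprMn -(real_normK (num_real (xi - l.1))).
  rewrite -natrX ler_wpM2l//; have := ler0n R 0; nra.
move=> /le_trans; apply; rewrite big_const_seq count_predT iter_addr_0.
rewrite -[X in X <= _]mulr_natl ler_pdivrMr; last first.
  by rewrite mulr_gt0// exprn_gt0// (lt_le_trans _ N1).
nra.
Qed.

Lemma sum_class_le1 l0 xi F : uniq F -> {in F, forall l, L l} ->
  {in F, forall l, eqv l l0} -> \sum_(l <- F) sinc (xi - l.1) ^+ 2 <= 1.
Proof.
move=> uF FL Fe.
have -> : \sum_(l <- F) sinc (xi - l.1) ^+ 2 =
          \sum_(x <- map fst F) sinc (xi - x) ^+ 2 by rewrite big_map.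
apply: bessel_int.
  rewrite map_inj_in_uniq// => l m /FL Ll /FL Lm; exact: fst_inj.
move=> _ _ /mapP[l lF ->] /mapP[m mF ->].
by apply: (@eqv_trans l0); [exact: Fe|rewrite eqvC; exact: Fe].
Qed.

(** Otherwise all points outside the class of [l0] lie in [G]. At a centre far from [G] the class
    contributes at most 1 and [G] at most 1/4, short of the 3/2 that Parseval guarantees. *)
Lemma neqv_infinite l0 G : exists l, [/\ L l, ~~ eqv l l0 & l \notin G].
Proof.
apply: contrapT => /forallNP h.
have hG l : L l -> ~~ eqv l l0 -> l \in G.
  by move=> Ll le; apply: contrapT => /negP lG; apply: (h l).
pose N : R := (size G)%:R + 1.
pose xi : R := \sum_(l <- G) `|l.1| + N.
have xiG : {in G, forall l, N <= `|xi - l.1|}.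
  move=> l lG; apply: le_trans (ler_norm _); rewrite /xi addrAC lerDr subr_ge0.
  rewrite (big_rem l)//= (le_trans (ler_norm _))// lerDl.
  by apply: sumr_ge0.
have [||F [uF FL]] := @parseval1 1 xi (1/2); [by rewrite ltr01 lexx|lra|].
apply/negP; rewrite -ltNge.
under eq_bigr do rewrite mul1r.
rewrite (bigID (fun l => eqv l l0))/= -big_filter -[X in _ + X]big_filter.
have h1 : \sum_(l <- [seq l <- F | eqv l l0]) sinc (xi - l.1) ^+ 2 <= 1.
  apply: (@sum_class_le1 l0); first exact: filter_uniq.
    by move=> l; rewrite mem_filter => /andP[_ /FL].
  by move=> l; rewrite mem_filter => /andP[].
have sub : {subset [seq l <- F | ~~ eqv l l0] <= G}.
  by move=> l; rewrite mem_filter => /andP[le /FL Ll]; exact: hG.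
have h2 : \sum_(l <- [seq l <- F | ~~ eqv l l0]) sinc (xi - l.1) ^+ 2 <= 1/4.
  apply: (@sum_sinc_far _ _ N); last by move=> l /sub; exact: xiG.
  by rewrite lerD2r ler_nat uniq_leq_size ?filter_uniq.
lra.
Qed.

(** A small d1 forces a small d2, and then both [sinc] and both cosines in [orth_cos] are positive.
    The choice of [D] keeps |a d1| and |b d2| below 1/4, where cos (2 pi .) is positive. *)
Lemma separated : exists d0 : R, [/\ 0 < d0, d0 <= 1 / 2 &
  forall l m, L l -> L m -> l != m -> d0 <= `|l.1 - m.1|].
Proof.
pose D : R := (16 * (`|a| + `|b| + 1))^-1.
have a0 := normr_ge0 a; have b0 := normr_ge0 b.
have D0 : 0 < D by rewrite invr_gt0 mulr_gt0// ltr_wpDl// addr_ge0.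
have DE : D * (16 * (`|a| + `|b| + 1)) = 1.
  by rewrite mulVf// gt_eqF// -invr_gt0.
have Da : 0 <= D * `|a| by rewrite mulr_ge0// ltW.
have Db : 0 <= D * `|b| by rewrite mulr_ge0// ltW.
have [D16 Da16 Db16] : [/\ 16 * D <= 1, 16 * (D * `|a|) <= 1 &
    16 * (D * `|b|) <= 1] by split; lra.
exists D; split => //; first lra.
move=> l m Ll Lm lm; rewrite leNgt; apply/negP => d1D.
have d1_ge0 := normr_ge0 (l.1 - m.1); have d2_ge0 := normr_ge0 (l.2 - m.2).
have d2D : `|l.2 - m.2| <= 2 * `|l.1 - m.1|.
  by apply: (sinc_sqr_eq_small _ (sinc_sqr12 Ll Lm)); lra.
have ad1 : `|a| * `|l.1 - m.1| <= D * `|a| by rewrite mulrC ler_wpM2r// ltW.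
have bd2 : `|b| * `|l.2 - m.2| <= 2 * (D * `|b|).
  by rewrite mulrC mulrA ler_wpM2r//; lra.
have cgt0 (c d : R) : 4 * (`|c| * `|d|) < 1 -> 0 < cos (2 * pi * (c * d)).
  move=> h; have pi0 := @pi_gt0 R.
  have : `|2 * pi * (c * d)| < pi / 2.
    rewrite normrM (normrM c) (_ : `|2 * pi| = 2 * pi).
      by move: (`|c| * `|d|) h => X h; nra.
    by rewrite gtr0_norm// mulr_gt0.
  by rewrite ltr_norml; exact: cos_gt0_pihalf.
have := orth_cos Ll Lm lm; apply/eqP; rewrite gt_eqF// addr_gt0// mulr_gt0//.
- by apply: sinc_gt0; lra.
- by apply: cgt0; lra.
- by apply: sinc_gt0; lra.
- by apply: cgt0; lra.
Qed.

(** The notion of smallness for the pigeonhole arguments: meeting only finitely many classes modulo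
    Z. *)
Definition covered (P : set (R * R)) := exists G, forall l, P l -> has (eqv l) G.

Lemma coveredU (P Q S : set (R * R)) : (forall l, P l -> Q l \/ S l) ->
  ~ covered P -> ~ covered Q \/ ~ covered S.
Proof.
move=> PQS nP; apply: contrapT => /not_orP[/contrapT[G GQ] /contrapT[H HS]].
apply: nP; exists (G ++ H) => l /PQS[/GQ|/HS] h; rewrite has_cat h ?orbT//.
Qed.

Lemma pick3 (P : set (R * R)) : ~ covered P -> exists l m k,
  [/\ P l, P m & P k] /\ [/\ ~~ eqv l m, ~~ eqv m k & ~~ eqv l k].
Proof.
move=> /forallNP nP.
have pick G : exists l, P l /\ ~~ has (eqv l) G.
  apply: contrapT => /forallNP h; apply: (nP G) => l Pl.
  by apply: contrapT => /negP lG; apply: (h l).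
have [l [Pl _]] := pick [::].
have [m [Pm]] := pick [:: l]; rewrite /= orbF => ml.
have [k [Pk]] := pick [:: l; m]; rewrite /= orbF negb_or => /andP[kl km].
by exists l, m, k; split; split=> //; rewrite eqvC.
Qed.

Lemma infL : (exists l, L l) -> infinite_in L.
Proof.
move=> [l0 _] G; have [l [Ll _ lG]] := neqv_infinite l0 G; by exists l.
Qed.

(** * Limits of the orthogonality relation at infinity *)

Lemma ultra_unbounded (U : set_system (R * R)) : UltraFilter U ->
  cofinite_in L `<=` U -> forall M : R, U [set l | M < `|l.1|].
Proof.
move=> UU LU M; have [d0 [d0p _ sep]] := separated.
have [//|UM] := in_ultra_setVsetC [set l : R * R | M < `|l.1|] UU.
(* Truncation makes the first coordinate bounded everywhere and leaves it unchanged on the set in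
   [U]. Convergence of [f] then puts two distinct points of [L] closer than [d0]. *)
exfalso; pose f l := Num.max (- M) (Num.min M l.1).
have M0 : 0 <= M.
  have [l /negP] := filter_ex UM; rewrite -leNgt; exact: le_trans.
have [x fx] : exists x : R, f @ U --> x.
  apply: (@ultra_bounded_cvg _ _ _ _ M) => l; rewrite /f ler_norml.
  by rewrite le_max lexx/= ge_max ge_min lexx /= andbT; lra.
have Ux : U [set l | `|x - f l| < d0 / 2].
  by have /cvgrPdist_lt /(_ (d0 / 2)) := fx; apply; rewrite divr_gt0.
have UL G : U [set l | L l /\ l \notin G] by apply: LU; exists G => l.
have fE l : ~ (M < `|l.1|) -> f l = l.1.
  move=> /negP; rewrite -leNgt ler_norml => /andP[h1 h2].
  by rewrite /f (min_r h2) (max_r h1).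
have [l [[lM lx] [Ll _]]] := filter_ex (filterI (filterI UM Ux) (UL [::])).
have [m [[mM mx] [Lm ml]]] := filter_ex (filterI (filterI UM Ux) (UL [:: l])).
have := sep m l Lm Ll; rewrite inE in ml => /(_ ml).
move: lx mx => /=; rewrite (fE l lM) (fE m mM) !ltr_norml => lx mx.
apply/negP; rewrite -ltNge ltr_norml; lra.
Qed.

(** Here [z] is either coordinate. The shift changes the square by O(|z| + 1), and since only the
    first coordinate is known to be unbounded, the bound on |z| |l.1| is what yields decay like 1 /
    |l.1|. *)
Lemma cvg_sqr_shift (U : set_system (R * R)) (z : R * R -> R) (c : R) :
  UltraFilter U -> (forall M : R, U [set l | M < `|l.1|]) ->
  (forall l, `|z l| * `|l.1| <= l.1 ^+ 2 + l.2 ^+ 2) ->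
  ((z l - c) ^+ 2 - z l ^+ 2) / (l.1 ^+ 2 + l.2 ^+ 2) @[l --> U] --> (0 : R).
Proof.
move=> UU Uoo zN; apply/cvgrPdist_lt => e e0.
pose K : R := c ^+ 2 + 2 * `|c|.
have K0 : 0 <= K by rewrite addr_ge0// ?sqr_ge0// mulr_ge0.
apply: filterS2 (Uoo 1) (Uoo (K / e)) => l /= l1; rewrite ltr_pdivrMr// => lK.
have l0 : 0 < `|l.1| by apply: lt_trans l1.
set N := l.1 ^+ 2 + l.2 ^+ 2; have lN : `|l.1| <= N.
  rewrite /N -(real_normK (num_real l.1)); have := sqr_ge0 l.2; nra.
have N0 : 0 < N by apply: lt_le_trans lN.
rewrite sub0r normrN normrM normfV (gtr0_norm N0) ltr_pdivrMr//.
rewrite -(ltr_pM2r l0); apply: (@le_lt_trans _ _ (K * N)); last first.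
  by rewrite mulrAC ltr_pM2r// mulrC.
have -> : (z l - c) ^+ 2 - z l ^+ 2 = c ^+ 2 - 2 * (c * z l) by ring.
apply: (@le_trans _ _ ((c ^+ 2 + 2 * (`|c| * `|z l|)) * `|l.1|)).
  rewrite ler_pM2r// (le_trans (ler_normB _ _))//.
  by rewrite normrX real_normK ?num_real// !normrM (@gtr0_norm R 2).
rewrite /K [leLHS]mulrDl [leRHS]mulrDl; apply: lerD; first by rewrite ler_wpM2l ?sqr_ge0.
by rewrite -!mulrA; apply: ler_wpM2l => //; apply: ler_wpM2l => //; exact: zN.
Qed.

(** Each pair (C, S) is (cos pi x, sin pi x) for a limit residue x, so the squared factors are sin
    (pi (x - m)), and [tau] is the limit of l.1 ^ 2 / |l| ^ 2. The relation is the limit of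
    [sin_sqr_rel] divided by |l| ^ 2. *)
Lemma ultra_limit_rel (U : set_system (R * R)) : UltraFilter U ->
  cofinite_in L `<=` U -> exists (C1 S1 C2 S2 tau : R),
  [/\ sin (pi * l.1) @[l --> U] --> S1, cos (pi * l.1) @[l --> U] --> C1,
      C1 ^+ 2 + S1 ^+ 2 = 1, C2 ^+ 2 + S2 ^+ 2 = 1 &
      forall m, L m ->
        (1 - tau) * (S1 * cos (pi * m.1) - C1 * sin (pi * m.1)) ^+ 2 =
        tau * (S2 * cos (pi * m.2) - C2 * sin (pi * m.2)) ^+ 2].
Proof.
move=> UU LU; have Uoo := ultra_unbounded UU LU.
have [C1 cC1] := @ultra_bounded_cvg _ _ U (fun l : R * R => cos (pi * l.1)) 1
  UU (fun _ => @cos_max _ _).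
have [S1 cS1] := @ultra_bounded_cvg _ _ U (fun l : R * R => sin (pi * l.1)) 1
  UU (fun _ => @sin_max _ _).
have [C2 cC2] := @ultra_bounded_cvg _ _ U (fun l : R * R => cos (pi * l.2)) 1
  UU (fun _ => @cos_max _ _).
have [S2 cS2] := @ultra_bounded_cvg _ _ U (fun l : R * R => sin (pi * l.2)) 1
  UU (fun _ => @sin_max _ _).
have N0 (l : R * R) : 0 <= l.1 ^+ 2 + l.2 ^+ 2 by rewrite addr_ge0// sqr_ge0.
have [tau ctau] : exists tau : R,
    l.1 ^+ 2 / (l.1 ^+ 2 + l.2 ^+ 2) @[l --> U] --> tau.
  apply: (@ultra_bounded_cvg _ _ _ _ 1) => l.
  rewrite ger0_norm ?divr_ge0 ?sqr_ge0//.
  have [->|N1] := eqVneq (l.1 ^+ 2 + l.2 ^+ 2) 0; first by rewrite invr0 mulr0.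
  by rewrite ler_pdivrMr ?lt_neqAle 1?eq_sym ?N1 ?N0// mul1r lerDl sqr_ge0.
have ctau' : l.2 ^+ 2 / (l.1 ^+ 2 + l.2 ^+ 2) @[l --> U] --> 1 - tau.
  have : 1 - l.1 ^+ 2 / (l.1 ^+ 2 + l.2 ^+ 2) @[l --> U] --> 1 - tau.
    by apply: cvgB => //; exact: cvg_cst.
  apply: cvg_trans; apply: near_eq_cvg; apply: filterS (Uoo 0) => l /= l0.
  have h : l.1 ^+ 2 + l.2 ^+ 2 != 0.
    rewrite gt_eqF// ltr_wpDr ?sqr_ge0// -(real_normK (num_real l.1)).
    by rewrite exprn_gt0.
  by field.
exists C1, S1, C2, S2, tau; split => //.
- have : cos (pi * l.1) ^+ 2 + sin (pi * l.1) ^+ 2 @[l --> U] --> C1 ^+ 2 + S1 ^+ 2.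
    by apply: cvgD; rewrite -[_ ^+ 2]/(_ * _); apply: cvgM.
  under eq_fun do rewrite cos2Dsin2.
  by move=> h; apply: (cvg_unique (@norm_hausdorff _ _) h); exact: cvg_cst.
- have : cos (pi * l.2) ^+ 2 + sin (pi * l.2) ^+ 2 @[l --> U] --> C2 ^+ 2 + S2 ^+ 2.
    by apply: cvgD; rewrite -[_ ^+ 2]/(_ * _); apply: cvgM.
  under eq_fun do rewrite cos2Dsin2.
  by move=> h; apply: (cvg_unique (@norm_hausdorff _ _) h); exact: cvg_cst.
move=> m Lm.
have c1 : (l.1 - m.1) ^+ 2 / (l.1 ^+ 2 + l.2 ^+ 2) @[l --> U] --> tau.
  rewrite -[tau]addr0.
  have E (l : R * R) : (l.1 - m.1) ^+ 2 / (l.1 ^+ 2 + l.2 ^+ 2) =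
      l.1 ^+ 2 / (l.1 ^+ 2 + l.2 ^+ 2) +
      ((l.1 - m.1) ^+ 2 - l.1 ^+ 2) / (l.1 ^+ 2 + l.2 ^+ 2).
    by ring.
  under eq_fun do rewrite E.
  apply: cvgD => //; apply: cvg_sqr_shift => // l.
  by rewrite -expr2 real_normK ?num_real// lerDl sqr_ge0.
have c2 : (l.2 - m.2) ^+ 2 / (l.1 ^+ 2 + l.2 ^+ 2) @[l --> U] --> 1 - tau.
  rewrite -[1 - tau]addr0.
  have E (l : R * R) : (l.2 - m.2) ^+ 2 / (l.1 ^+ 2 + l.2 ^+ 2) =
      l.2 ^+ 2 / (l.1 ^+ 2 + l.2 ^+ 2) +
      ((l.2 - m.2) ^+ 2 - l.2 ^+ 2) / (l.1 ^+ 2 + l.2 ^+ 2).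
    by ring.
  under eq_fun do rewrite E.
  apply: cvgD => //; apply: cvg_sqr_shift => // l.
  rewrite -(real_normK (num_real l.1)) -(real_normK (num_real l.2)).
  have := sqr_ge0 (`|l.1| - `|l.2|); have := normr_ge0 l.1; nra.
have s1 : (sin (pi * (l.1 - m.1))) ^+ 2 @[l --> U] -->
    (S1 * cos (pi * m.1) - C1 * sin (pi * m.1)) ^+ 2.
  under eq_fun do rewrite mulrBr sinB.
  by apply: cvgM; apply: cvgB; apply: cvgMl.
have s2 : (sin (pi * (l.2 - m.2))) ^+ 2 @[l --> U] -->
    (S2 * cos (pi * m.2) - C2 * sin (pi * m.2)) ^+ 2.
  under eq_fun do rewrite mulrBr sinB.
  by apply: cvgM; apply: cvgB; apply: cvgMl.
have h1 := cvgM c2 s1; have h2 := cvgM c1 s2.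
apply: (cvg_unique (@norm_hausdorff _ _) (h1 _)); suff :
    (fun l : R * R => (l.2 - m.2) ^+ 2 / (l.1 ^+ 2 + l.2 ^+ 2) *
      sin (pi * (l.1 - m.1)) ^+ 2) @ U -->
    tau * (S2 * cos (pi * m.2) - C2 * sin (pi * m.2)) ^+ 2 by [].
apply: cvg_trans (h2 _); apply: near_eq_cvg; apply: LU; exists [::] => l Ll _ /=.
by rewrite mulrAC -sin_sqr_rel// mulrAC.
Qed.

(* If the first coordinates clustered at a single point modulo 1, a far point
   of [L] would, by separation, have no other point of [L] at which [sinc] is
   not small, contradicting the value 2 of Parseval's sum. *)
Lemma spread_mod1 (C S : R) : (exists l, L l) -> C ^+ 2 + S ^+ 2 = 1 ->
  exists2 e : R, 0 < e & infinite_in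
    [set l | L l /\ e < `|S * cos (pi * l.1) - C * sin (pi * l.1)|].
Proof.
move=> Lne CS; have [d0 [d0p d0h sep]] := separated.
(* For |d| >= d0 one has |d + 1/2| <= w |d|; [e] is chosen so that (e w) ^ 2 = 1/64, which leads to
   the factor 1/12 below. *)
pose w : R := 1 + (2 * d0)^-1; have w1 : 1 < w.
  by rewrite ltrDl invr_gt0 mulr_gt0.
have w0 : 0 < w by apply: lt_trans w1.
pose e : R := (8 * w)^-1; have e0 : 0 < e by rewrite invr_gt0 mulr_gt0.
have ew : e * w = 1 / 8 by rewrite /e; field; rewrite gt_eqF.
exists e => //; apply: contrapT => /existsNP[G /forallNP hG].
have {}hG l : L l -> l \notin G ->
    `|S * cos (pi * l.1) - C * sin (pi * l.1)| <= e.
  move=> Ll lG; rewrite leNgt; apply/negP => h; exact: (hG l).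
have [U UU LU] := nonprincipal_ultra (infL Lne).
have UL : U [set l | L l /\ l \notin G] by apply: LU; exists G.
pose N : R := (size G)%:R + 1.
have Ufar := ultra_unbounded UU LU (\sum_(k <- G) `|k.1| + N).
have [l [[Ll lG] /= lfar]] := filter_ex (filterI UL Ufar).
have far : {in G, forall k, N <= `|l.1 - k.1|}.
  move=> k kG; apply: (le_trans _ (lerB_dist _ _)).
  rewrite lerBrDr; apply: ltW; apply: le_lt_trans lfar.
  by rewrite addrC lerD2r (big_rem k)//= lerDl sumr_ge0.
have pi0 := @pi_gt0 R.
(* Both points are near one residue, so their difference d has a small sine; a shift by 1/2 turns
   the sine into a cosine of square at least 3/4. *)
have near k : L k -> k \notin G -> k != l ->
    sinc (l.1 - k.1) ^+ 2 <= sinc (l.1 + 1 / 2 - k.1) ^+ 2 / 12.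
  move=> Lk kG kl; have hk := hG _ Lk kG; have hl := hG _ Ll lG.
  have dd := sep l k Ll Lk; rewrite eq_sym in kl; have {dd}d0l := dd kl.
  have -> : l.1 + 1 / 2 - k.1 = (l.1 - k.1) + 1 / 2 by ring.
  have sd : sin (pi * (l.1 - k.1)) ^+ 2 <= 4 * e ^+ 2.
    have -> : sin (pi * (l.1 - k.1)) =
        (S * cos (pi * k.1) - C * sin (pi * k.1)) *
        (C * cos (pi * l.1) + S * sin (pi * l.1)) -
        (C * cos (pi * k.1) + S * sin (pi * k.1)) *
        (S * cos (pi * l.1) - C * sin (pi * l.1)).
      rewrite mulrBr sinB -[LHS]mul1r -CS; ring.
    have un m : (S * cos (pi * m.1) - C * sin (pi * m.1)) ^+ 2 +
        (C * cos (pi * m.1) + S * sin (pi * m.1)) ^+ 2 = 1 :> R.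
      have := cos2Dsin2 (pi * m.1); set c := cos _; set s := sin _ => cs.
      transitivity ((C ^+ 2 + S ^+ 2) * (c ^+ 2 + s ^+ 2)); first by ring.
      by rewrite CS cs mulr1.
    have sqr_le x : `|x| <= e -> x ^+ 2 <= e ^+ 2.
      by move=> xe; rewrite -(real_normK (num_real x)) lerXn2r ?nnegrE ?(ltW e0).
    have mul_le p q : p ^+ 2 <= e ^+ 2 -> q ^+ 2 <= 1 -> (p * q) ^+ 2 <= e ^+ 2.
      by move=> pe q1; rewrite exprMn (le_trans _ pe)// ler_piMr ?sqr_ge0.
    have := un k; have := un l; move: (sqr_le _ hk) (sqr_le _ hl).
    set sk := S * _ - _; set sl := S * _ - _; set cl := C * _ + _.
    set ck := C * _ + _ => qk ql ul uk.
    have h1 : (sk * cl) ^+ 2 <= e ^+ 2.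
      by apply: mul_le => //; have := sqr_ge0 sl; lra.
    have h2 : (ck * sl) ^+ 2 <= e ^+ 2.
      by rewrite (mulrC ck); apply: mul_le => //; have := sqr_ge0 sk; lra.
    have := sqr_ge0 (sk * cl + ck * sl).
    move: (sk * cl) (ck * sl) h1 h2 => p q; nra.
  set d := l.1 - k.1 in d0l sd *.
  have e8 : e <= 1 / 8 by rewrite -ew ler_peMr ?ltW.
  have cd : 3 / 4 <= cos (pi * d) ^+ 2 by rewrite cos2sin2; nra.
  have d2 : 0 < pi ^+ 2 * d ^+ 2.
    apply: mulr_gt0; first by rewrite exprn_gt0.
    by rewrite -(real_normK (num_real d)) exprn_gt0// (lt_le_trans d0p).
  rewrite -(ler_pM2l d2) -!exprMn -sincE.
  apply: (le_trans sd).
  have cE : cos (pi * d) = pi * (d + 1 / 2) * sinc (d + 1 / 2).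
    rewrite -sincE (_ : pi * (d + 1 / 2) = pi * d + pi / 2); last by ring.
    by rewrite sinDpihalf.
  have dw : (d + 1 / 2) ^+ 2 <= d ^+ 2 * w ^+ 2.
    have h : `|d + 1 / 2| <= `|d| * w.
      apply: (le_trans (ler_normD _ _)); rewrite /w mulrDr mulr1 lerD2l.
      rewrite ger0_norm ?divr_ge0// ler_pdivlMr ?mulr_gt0//.
      by rewrite mulrA mul1r mulVf ?mul1r.
    rewrite -exprMn -(real_normK (num_real (d + _))).
    rewrite -(real_normK (num_real (d * w))) normrM (gtr0_norm w0).
    by rewrite lerXn2r ?nnegrE ?mulr_ge0 ?(ltW w0).
  move: cd; rewrite cE !exprMn => cd.
  have h : 3 / 4 <= pi ^+ 2 * (d ^+ 2 * w ^+ 2) * sinc (d + 1 / 2) ^+ 2.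
    apply: (le_trans cd); rewrite ler_wpM2r ?sqr_ge0//.
    by apply: ler_wpM2l => //; rewrite sqr_ge0.
  have := ler_wpM2l (sqr_ge0 e) h.
  have -> : e ^+ 2 * (pi ^+ 2 * (d ^+ 2 * w ^+ 2) * sinc (d + 1 / 2) ^+ 2) =
    (e * w) ^+ 2 * (pi ^+ 2 * d ^+ 2 * sinc (d + 1 / 2) ^+ 2) by ring.
  rewrite ew; lra.
(* At the centre l.1 the sum is at most 1/4 from [G], 1 from l itself and 2/12 from the rest, by
   Bessel at the centre l.1 + 1/2. This is below 2 - 1/4. *)
have [||F [uF FL]] := @parseval1 1 l.1 (1/4); [by rewrite ltr01 lexx|lra|].
apply/negP; rewrite -ltNge; under eq_bigr do rewrite mul1r.
rewrite (bigID (fun k => k \in G))/= -big_filter.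
have h1 : \sum_(k <- [seq k <- F | k \in G]) sinc (l.1 - k.1) ^+ 2 <= 1 / 4.
  have sub : {subset [seq k <- F | k \in G] <= G}.
    by move=> k; rewrite mem_filter => /andP[].
  apply: (@sum_sinc_far _ _ N); last by move=> k /sub; exact: far.
  by rewrite lerD2r ler_nat uniq_leq_size ?filter_uniq.
have h2 : \sum_(k <- F | k \notin G) sinc (l.1 - k.1) ^+ 2 <=
    \sum_(k <- F) ((k == l)%:R + sinc (l.1 + 1 / 2 - k.1) ^+ 2 / 12).
  rewrite big_mkcond/= big_seq [leRHS]big_seq; apply: ler_sum => k /FL Lk.
  have p1 : 0 <= sinc (l.1 + 1 / 2 - k.1) ^+ 2 / 12 by rewrite divr_ge0 ?sqr_ge0.
  case: ifPn => kG; last by rewrite addr_ge0.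
  have [kl|kl] := eqVneq k l; last by rewrite add0r near.
  by rewrite kl in p1 *; rewrite subrr sinc0 expr1n lerDl.
move: h2; rewrite big_split/= -mulr_suml.
have h3 : \sum_(k <- F) (k == l)%:R <= 1 :> R.
  rewrite -natr_sum -[leRHS]/(1%:R) ler_nat (_ : (\sum_(k <- F) _)%N = count_mem l F).
    by rewrite count_uniq_mem// leq_b1.
  by rewrite -sum1_count [RHS]big_mkcond; apply: eq_bigr => k _ /=; case: (k == l).
have h4 : \sum_(k <- F) sinc (l.1 + 1 / 2 - k.1) ^+ 2 <= 2.
  have := @bessel1 1 (l.1 + 1 / 2) F; rewrite ltr01 lexx => /(_ isT uF FL).
  by under eq_bigr do rewrite mul1r; rewrite divr1.
lra.
Qed.

(** * Finiteness of the number of classes *)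

Lemma binary_form_eq0 (al be ga t1 l1 t2 l2 t3 l3 : R) :
  al * t1 ^+ 2 + be * (t1 * l1) + ga * l1 ^+ 2 = 0 ->
  al * t2 ^+ 2 + be * (t2 * l2) + ga * l2 ^+ 2 = 0 ->
  al * t3 ^+ 2 + be * (t3 * l3) + ga * l3 ^+ 2 = 0 ->
  t1 * l2 - t2 * l1 != 0 -> t1 * l3 - t3 * l1 != 0 -> t2 * l3 - t3 * l2 != 0 ->
  [/\ al = 0, be = 0 & ga = 0].
Proof.
have key (x y z : R) : x != 0 -> x * y = z -> z = 0 -> y = 0.
  by move=> x0 <- /eqP; rewrite mulf_eq0 (negbTE x0) => /eqP.
move=> e1 e2 e3 d12 d13 d23.
(* Eliminating between two zeros and dividing by their determinant gives the relations between zeros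
   and coefficients of the form. *)
have p2 (x y u v : R) : al * x ^+ 2 + be * (x * y) + ga * y ^+ 2 = 0 ->
    al * u ^+ 2 + be * (u * v) + ga * v ^+ 2 = 0 -> x * v - u * y != 0 ->
    al * (x * v + u * y) + be * (y * v) = 0 /\
    ga * (x * v + u * y) + be * (x * u) = 0.
  move=> exy euv d0; split.
    apply: (key _ _ ((al * x ^+ 2 + be * (x * y) + ga * y ^+ 2) * v ^+ 2 -
      (al * u ^+ 2 + be * (u * v) + ga * v ^+ 2) * y ^+ 2) d0); first by ring.
    by rewrite exy euv !mul0r subrr.
  apply: (key _ _ ((al * u ^+ 2 + be * (u * v) + ga * v ^+ 2) * x ^+ 2 -
    (al * x ^+ 2 + be * (x * y) + ga * y ^+ 2) * u ^+ 2) d0); first by ring.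
  by rewrite exy euv !mul0r subrr.
have [a12 g12] := p2 _ _ _ _ e1 e2 d12.
have [a13 g13] := p2 _ _ _ _ e1 e3 d13.
have [a23 g23] := p2 _ _ _ _ e2 e3 d23.
have al0 : al = 0.
  have h1 : al * l1 = 0.
    apply: (key _ _ ((al * (t1 * l2 + t2 * l1) + be * (l1 * l2)) * l3 -
      (al * (t1 * l3 + t3 * l1) + be * (l1 * l3)) * l2) d23); first by ring.
    by rewrite a12 a13 !mul0r subrr.
  have h2 : al * l2 = 0.
    apply: (key _ _ ((al * (t1 * l2 + t2 * l1) + be * (l1 * l2)) * l3 -
      (al * (t2 * l3 + t3 * l2) + be * (l2 * l3)) * l1) d13); first by ring.
    by rewrite a12 a23 !mul0r subrr.
  apply: (key _ _ (t1 * (al * l2) - t2 * (al * l1)) d12); first by ring.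
  by rewrite h1 h2 !mulr0 subrr.
have ga0 : ga = 0.
  have h1 : ga * t1 = 0.
    apply: (key _ _ ((ga * (t1 * l3 + t3 * l1) + be * (t1 * t3)) * t2 -
      (ga * (t1 * l2 + t2 * l1) + be * (t1 * t2)) * t3) d23); first by ring.
    by rewrite g12 g13 !mul0r subrr.
  have h2 : ga * t2 = 0.
    apply: (key _ _ ((ga * (t2 * l3 + t3 * l2) + be * (t2 * t3)) * t1 -
      (ga * (t1 * l2 + t2 * l1) + be * (t1 * t2)) * t3) d13); first by ring.
    by rewrite g12 g23 !mul0r subrr.
  apply: (key _ _ ((ga * t1) * l2 - (ga * t2) * l1) d12); first by ring.
  by rewrite h1 h2 !mul0r subrr.
split => //; apply/eqP; apply: contraT => be0.
move: a12 a13 a23 g12 g13 g23; rewrite al0 ga0 !mul0r !add0r.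
have b0 x : be * x = 0 -> x = 0 by move=> h; exact: (key _ _ _ be0 h).
move=> /b0 l12 /b0 l13 /b0 l23 /b0 t12 /b0 t13 /b0 t23.
have /eqP := t12; rewrite mulf_eq0 => /orP[/eqP t0|/eqP t0].
  have : t2 * l1 != 0 by move: d12; rewrite t0 mul0r sub0r oppr_eq0.
  rewrite mulf_eq0 negb_or => /andP[t2N l1N]; case/eqP: d23.
  by rewrite (key _ _ _ l1N l13 erefl) (key _ _ _ t2N t23 erefl) mulr0 mul0r subrr.
have : t1 * l2 != 0 by move: d12; rewrite t0 mul0r subr0.
rewrite mulf_eq0 negb_or => /andP[t1N l2N]; case/eqP: d13.
by rewrite (key _ _ _ l2N l23 erefl) (key _ _ _ t1N t13 erefl) mulr0 mul0r subrr.
Qed.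

Lemma pick_neqv (P : set (R * R)) : ~ covered P ->
  exists l m, [/\ P l, P m & ~~ eqv l m].
Proof. by move=> /pick3[l [m [k [[Pl Pm _] [lm _ _]]]]]; exists l, m. Qed.

(** With (c, s) = (cos z, sin z) this expands the sine of (z - y) - (z - x). *)
Lemma sub_rot (x y c s : R) : c ^+ 2 + s ^+ 2 = 1 ->
  (s * cos y - c * sin y) * (c * cos x + s * sin x) -
  (s * cos x - c * sin x) * (c * cos y + s * sin y) = sin (x - y).
Proof. by move=> cs; rewrite sinB -[RHS]mul1r -cs; ring. Qed.

Lemma neqv_sin l m : ~~ eqv l m -> sin (pi * (l.1 - m.1)) != 0.
Proof. by apply: contraNneq => /sin_pi_eq0. Qed.

Lemma neqv_sin2 l m : L l -> L m -> ~~ eqv l m ->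
  sin (pi * (l.2 - m.2)) != 0.
Proof. by move=> Ll Lm; rewrite eqv2//; apply: contraNneq => /sin_pi_eq0. Qed.

(** By [sub_rot], two inequivalent points cannot both have s = 0, nor both t = 0. Hence 1 - tau is
    nonzero and tau / (1 - tau) is nonnegative; r is its square root. *)
Lemma limit_rel_ratio (C1 S1 C2 S2 tau : R) : ~ covered L ->
  C1 ^+ 2 + S1 ^+ 2 = 1 -> C2 ^+ 2 + S2 ^+ 2 = 1 ->
  (forall m, L m ->
    (1 - tau) * (S1 * cos (pi * m.1) - C1 * sin (pi * m.1)) ^+ 2 =
    tau * (S2 * cos (pi * m.2) - C2 * sin (pi * m.2)) ^+ 2) ->
  exists r : R, forall m, L m ->
    (S1 * cos (pi * m.1) - C1 * sin (pi * m.1)) ^+ 2 =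
    (r * (S2 * cos (pi * m.2) - C2 * sin (pi * m.2))) ^+ 2.
Proof.
move=> nL u1 u2 rel; have [l [m [Ll Lm lm]]] := pick_neqv nL.
pose s (m : R * R) := S1 * cos (pi * m.1) - C1 * sin (pi * m.1).
pose t (m : R * R) := S2 * cos (pi * m.2) - C2 * sin (pi * m.2).
have {}rel k : L k -> (1 - tau) * s k ^+ 2 = tau * t k ^+ 2 by exact: rel.
have sN0 : ~ (s l = 0 /\ s m = 0).
  move=> [sl sm]; have := neqv_sin lm; rewrite mulrBr -(sub_rot _ _ u1).
  by rewrite -/(s l) -/(s m) sl sm !mul0r subrr eqxx.
have tN0 : ~ (t l = 0 /\ t m = 0).
  move=> [tl tm]; have := neqv_sin2 Ll Lm lm; rewrite mulrBr -(sub_rot _ _ u2).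
  by rewrite -/(t l) -/(t m) tl tm !mul0r subrr eqxx.
have tau1 : 1 - tau != 0.
  apply/eqP => tau1; apply: tN0.
  have h k : L k -> t k = 0.
    move=> /rel; rewrite tau1 mul0r.
    have -> : tau = 1 by lra.
    by rewrite mul1r => /esym/eqP; rewrite sqrf_eq0 => /eqP.
  by split; exact: h.
pose ka := tau / (1 - tau).
have h k : L k -> s k ^+ 2 = ka * t k ^+ 2.
  by move=> /rel e; apply: (mulfI tau1); rewrite e /ka; field.
have ka0 : 0 <= ka.
  rewrite leNgt; apply/negP => kan; apply: sN0.
  have s0 k : L k -> s k = 0.
    move=> /h sE; apply/eqP; rewrite -sqrf_eq0 eq_le sqr_ge0 andbT sE.
    by rewrite mulr_le0_ge0 ?sqr_ge0// ltW.
  by split; exact: s0.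
exists (Num.sqrt ka) => k Lk; rewrite -/(s k) -/(t k) h// exprMn sqr_sqrtr//.
Qed.

(** The sign may vary with the point, but one of the two signs must occur on infinitely many
    classes. *)
Lemma covered_sign (P : set (R * R)) (f g : R * R -> R) : ~ covered P ->
  (forall l, P l -> f l ^+ 2 = g l ^+ 2) ->
  exists e : R, e ^+ 2 = 1 /\ ~ covered [set l | P l /\ f l = e * g l].
Proof.
move=> nP fg.
have : forall l, P l ->
    [set l | P l /\ f l = 1 * g l] l \/ [set l | P l /\ f l = -1 * g l] l.
  move=> l Pl; have /eqP := fg l Pl.
  rewrite eqf_sqr => /orP[]/eqP e; [left|right]; split => //.
    by rewrite mul1r.
  by rewrite mulN1r.
move=> /coveredU/(_ nP)[h|h]; first by exists 1; rewrite expr1n.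
by exists (-1); rewrite sqrrN expr1n.
Qed.

Lemma cos_norm1 (c s y : R) : c ^+ 2 + s ^+ 2 = 1 ->
  (s * cos y - c * sin y) ^+ 2 + (c * cos y + s * sin y) ^+ 2 = 1.
Proof.
move=> cs; transitivity ((c ^+ 2 + s ^+ 2) * (cos y ^+ 2 + sin y ^+ 2)).
  by ring.
by rewrite cs cos2Dsin2 mulr1.
Qed.

(* Two limit points with distinct first coordinates give two linear relations
   between [(sin, cos)] vectors, hence a binary quadratic form with three
   zeros; its vanishing says that the limit ratio is 1. *)
Lemma covered_L : covered L.
Proof.
apply: contrapT => nL; have [l0 [_ [Ll0 _ _]]] := pick_neqv nL.
have Lne : exists l, L l by exists l0.
have [U UU LU] := nonprincipal_ultra (infL Lne).
have [C1 [S1 [C2 [S2 [tau [_ _ u1 u2 rel]]]]]] := ultra_limit_rel UU LU.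
have [e e0 infP] := spread_mod1 Lne u1.
have [V VV PV] := nonprincipal_ultra infP.
have LV : cofinite_in L `<=` V.
  by move=> A [G GA]; apply: PV; exists G => l [Ll _]; exact: GA.
have [D1 [T1 [D2 [T2 [tau' [cT1 cD1 v1 v2 rel']]]]]] := ultra_limit_rel VV LV.
(* [V] lives on points whose sine relative to the first limit exceeds [e] in absolute value, so the
   two limit residues differ. *)
have W0 : S1 * D1 - C1 * T1 != 0.
  have : S1 * cos (pi * l.1) - C1 * sin (pi * l.1) @[l --> V] -->
      S1 * D1 - C1 * T1.
    by apply: cvgB; apply: cvgMr.
  move=> /cvg_norm cW; rewrite -normr_gt0; apply: (lt_le_trans e0).
  rewrite leNgt; apply/negP => /(cvgr_lt _ cW) hW.
  have VP : V [set l | L l /\ e < `|S1 * cos (pi * l.1) - C1 * sin (pi * l.1)|].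
    by apply: PV; exists [::].
  have [l [/= h1 [_]]] := filter_ex (filterI hW VP).
  by rewrite ltNge (ltW h1).
have [r rE] := limit_rel_ratio nL u1 u2 rel.
have [r' rE'] := limit_rel_ratio nL v1 v2 rel'.
have [g [g1 nP]] := covered_sign nL rE.
have [g' [g1' nP']] := @covered_sign _
  (fun m => T1 * cos (pi * m.1) - D1 * sin (pi * m.1))
  (fun m => r' * (T2 * cos (pi * m.2) - D2 * sin (pi * m.2)))
  nP (fun l Pl => rE' l Pl.1).
(* Angle addition expresses the sines relative to the second limit through sines and cosines
   relative to the first. *)
have sinW y : T1 * cos y - D1 * sin y =
    (S1 * cos y - C1 * sin y) * (C1 * D1 + S1 * T1) -
    (C1 * cos y + S1 * sin y) * (S1 * D1 - C1 * T1).
  by rewrite -[LHS]mul1r -u1; ring.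
have sinW2 y : T2 * cos y - D2 * sin y =
    (S2 * cos y - C2 * sin y) * (C2 * D2 + S2 * T2) -
    (C2 * cos y + S2 * sin y) * (S2 * D2 - C2 * T2).
  by rewrite -[LHS]mul1r -u2; ring.
pose s (m : R * R) := S1 * cos (pi * m.1) - C1 * sin (pi * m.1).
pose t (m : R * R) := S2 * cos (pi * m.2) - C2 * sin (pi * m.2).
pose k (m : R * R) := C1 * cos (pi * m.1) + S1 * sin (pi * m.1).
pose j (m : R * R) := C2 * cos (pi * m.2) + S2 * sin (pi * m.2).
have sk m : s m ^+ 2 + k m ^+ 2 = 1 by exact: cos_norm1.
have tj m : t m ^+ 2 + j m ^+ 2 = 1 by exact: cos_norm1.
have sksk m n : s n * k m - s m * k n = sin (pi * (m.1 - n.1)).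
  by rewrite mulrBr -(sub_rot _ _ u1).
have tjtj m n : t n * j m - t m * j n = sin (pi * (m.2 - n.2)).
  by rewrite mulrBr -(sub_rot _ _ u2).
(* Where both signs are fixed, k = al t + be j, so s ^ 2 + k ^ 2 = t ^ 2 + j ^ 2 is a quadratic form
   in (t, j) with three nonproportional zeros. Its last coefficient gives be ^ 2 = 1, the middle one
   al = 0, the first one r ^ 2 = 1. *)
have r1 : r ^+ 2 = 1.
  have [l [m [n [[[[Ll sl] sl'] [[Lm sm] sm'] [[Ln sn] sn']] [lm mn ln]]]]] :=
    pick3 nP'.
  pose W := S1 * D1 - C1 * T1.
  pose al := (g * r * (C1 * D1 + S1 * T1) - g' * r' * (C2 * D2 + S2 * T2)) / W.
  pose be := g' * r' * (S2 * D2 - C2 * T2) / W.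
  have kE (x : R * R) : s x = g * (r * t x) ->
      T1 * cos (pi * x.1) - D1 * sin (pi * x.1) =
      g' * (r' * (T2 * cos (pi * x.2) - D2 * sin (pi * x.2))) ->
      (r ^+ 2 + al ^+ 2 - 1) * t x ^+ 2 + 2 * al * be * (t x * j x) +
      (be ^+ 2 - 1) * j x ^+ 2 = 0.
    rewrite sinW sinW2 -/(s x) -/(t x) -/(k x) -/(j x) -/W => sx e1.
    have kx : k x = al * t x + be * j x.
      apply: (mulIf W0); rewrite -/W.
      have -> : k x * W = s x * (C1 * D1 + S1 * T1) -
        g' * (r' * (t x * (C2 * D2 + S2 * T2) - j x * (S2 * D2 - C2 * T2))).
        by rewrite -e1; ring.
      by rewrite sx /al /be; field.
    have := sk x; have := tj x; rewrite kx sx => t1 e2.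
    have {}e2 : r ^+ 2 * t x ^+ 2 + (al * t x + be * j x) ^+ 2 = 1.
      by rewrite -e2 !exprMn g1 mul1r.
    transitivity (r ^+ 2 * t x ^+ 2 + (al * t x + be * j x) ^+ 2 -
      (t x ^+ 2 + j x ^+ 2)); first by ring.
    by rewrite e2 t1 subrr.
  have d (x y : R * R) : L x -> L y -> ~~ eqv x y -> t x * j y - t y * j x != 0.
    by move=> Lx Ly; rewrite eqvC tjtj; exact: neqv_sin2.
  have [h1 h2 h3] := binary_form_eq0 (kE _ sl sl') (kE _ sm sm') (kE _ sn sn')
    (d _ _ Ll Lm lm) (d _ _ Ll Ln ln) (d _ _ Lm Ln mn).
  have be0 : be != 0 by apply: contra_eqN h3 => /eqP ->; rewrite expr0n sub0r oppr_eq0 oner_eq0.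
  move: h2 => /eqP; rewrite mulf_eq0 (negbTE be0) orbF mulf_eq0 pnatr_eq0 /=.
  by move=> /eqP al0; move: h1; rewrite al0 expr0n addr0 => /subr0_eq.
have st (m : R * R) : L m -> s m ^+ 2 = t m ^+ 2 by move=> /rE; rewrite exprMn r1 mul1r.
(* The squared sine of the difference of x and y has the cross term 2 (s k)(x) (s k)(y). A common
   sign [h] matches it with the one of t j; the other terms match since s ^ 2 = t ^ 2 and k ^ 2 = j
   ^ 2. *)
have [h [h1 nQ]] : exists h : R, h ^+ 2 = 1 /\
    ~ covered [set l | L l /\ s l * k l = h * (t l * j l)].
  apply: covered_sign => // l Ll; rewrite !exprMn st//; congr (_ * _).
  by have := sk l; have := tj l; rewrite st//; lra.
have [l [m [n [[[Ll el] [Lm em] [Ln en]] [lm mn ln]]]]] := pick3 nQ.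
have sqE (x y : R * R) : L x -> L y -> s x * k x = h * (t x * j x) ->
    s y * k y = h * (t y * j y) -> ~~ eqv x y ->
    (x.1 - y.1) ^+ 2 = (x.2 - y.2) ^+ 2.
  move=> Lx Ly ex ey xy; have := sin_sqr_rel Lx Ly.
  have -> : sin (pi * (x.1 - y.1)) ^+ 2 = sin (pi * (x.2 - y.2)) ^+ 2.
    rewrite -sksk -tjtj.
    have kj (z : R * R) : L z -> k z ^+ 2 = j z ^+ 2.
      by move=> Lz; have := sk z; have := tj z; rewrite st//; lra.
    transitivity (s y ^+ 2 * k x ^+ 2 + s x ^+ 2 * k y ^+ 2 -
      2 * (s x * k x) * (s y * k y)); first by ring.
    rewrite ex ey !st// !kj//.
    transitivity (t y ^+ 2 * j x ^+ 2 + t x ^+ 2 * j y ^+ 2 -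
      h ^+ 2 * (2 * (t x * j x) * (t y * j y))); first by ring.
    by rewrite h1; ring.
  by move=> /mulIf -> //; rewrite sqrf_eq0 neqv_sin2.
exact: (no_three_sqr_eq Ll Lm Ln lm mn ln (sqE _ _ Ll Lm el em lm)
  (sqE _ _ Lm Ln em en mn) (sqE _ _ Ll Ln el en ln)).
Qed.

(** * Collinearity of the spectrum *)

Lemma big_class : (exists l, L l) -> exists l m k,
  [/\ L l, L m & L k] /\ [/\ l != m, l != k, m != k, eqv m l & eqv k l].
Proof.
move=> Lne; apply: contrapT => noclass.
have small g : exists H : seq (R * R), forall l, L l -> eqv l g -> l \in H.
  have [[l [Ll lg]]|none] := pselect (exists l, L l /\ eqv l g); last first.
    by exists [::] => l Ll lg; exfalso; apply: none; exists l.
  have [[m [Lm mg lm]]|none] := pselect (exists m, [/\ L m, eqv m g & l != m]);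
      last first.
    exists [:: l] => k Lk kg; rewrite inE; apply: contrapT => /negP kl.
    by apply: none; exists k; split => //; rewrite eq_sym.
  exists [:: l; m] => k Lk kg; rewrite !inE.
  have [//|kl] := eqVneq k l; have [//|km] := eqVneq k m.
  exfalso; apply: noclass; exists l, m, k; split; split => //.
  - by rewrite eq_sym.
  - by rewrite eq_sym.
  - by apply: eqv_trans mg _; rewrite eqvC.
  - by apply: eqv_trans kg _; rewrite eqvC.
(* Finitely many classes with at most two points each would make [L] finite. *)
have [G GL] := covered_L.
have [H HG] : exists H : seq (R * R), forall l, L l -> has (eqv l) G -> l \in H.
  elim: G {GL} => [|g G [H HG]]; first by exists [::].
  have [H' Hg] := small g; exists (H' ++ H) => l Ll /=.
  by rewrite mem_cat => /orP[/Hg->//|/HG ->//]; rewrite ?orbT.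
by have [l [Ll]] := infL Lne H; rewrite HG// GL.
Qed.

Lemma sin_sqr_int_shift (x y : R) : x - y \is a Num.int ->
  sin (pi * x) ^+ 2 = sin (pi * y) ^+ 2.
Proof.
move=> xy; rewrite -(subrK y x) mulrDr sinD sin_pi_int// mul0r add0r.
by rewrite exprMn cos2sin2 (sin_pi_int xy) expr0n subr0 mul1r.
Qed.

(** sin ^ 2 (pi .) has period 1, so it is constant on x - m as m runs through the class, and
    [sin_sqr_rel] fixes the ratio of the differences up to sign: the class lies on two lines through
    x. *)
Lemma class_slope l x : L l -> L x -> ~~ eqv x l ->
  exists2 c : R, c != 0 & forall m, L m -> eqv m l ->
    (x.2 - m.2 = c * (x.1 - m.1)) \/ (x.2 - m.2 = - c * (x.1 - m.1)).
Proof.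
move=> Ll Lx xl.
have s1 := neqv_sin xl; have s2 := neqv_sin2 Lx Ll xl.
exists (sin (pi * (x.2 - l.2)) / sin (pi * (x.1 - l.1))).
  by rewrite mulf_neq0// invr_eq0.
move=> m Lm ml; set c := _ / _.
suff /eqP : (x.2 - m.2) ^+ 2 = (c * (x.1 - m.1)) ^+ 2.
  by rewrite eqf_sqr mulNr => /orP[]/eqP ->; [left|right].
rewrite /c exprMn expr_div_n; have := sin_sqr_rel Lx Lm.
have sh (u v w : R) : v - w \is a Num.int ->
    sin (pi * (u - v)) ^+ 2 = sin (pi * (u - w)) ^+ 2.
  move=> vw; apply: sin_sqr_int_shift.
  have -> : u - v - (u - w) = - (v - w) by ring.
  by rewrite rpredN.
have ml2 : m.2 - l.2 \is a Num.int by rewrite -eqv2.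
rewrite (sh x.1 _ _ ml) (sh x.2 _ _ ml2).
by move=> h; apply: (mulIf (expf_neq0 2 s1)); rewrite h; field.
Qed.

Lemma fst_neq l m : L l -> L m -> l != m -> l.1 - m.1 != 0.
Proof.
by move=> Ll Lm; apply: contra_neq => /subr0_eq; exact: fst_inj.
Qed.

Definition slope l m := (l.2 - m.2) / (l.1 - m.1).

Lemma slopeE l m (c : R) : L l -> L m -> l != m -> l.2 - m.2 = c * (l.1 - m.1) ->
  slope l m = c.
Proof. by move=> Ll Lm lm e; rewrite /slope e mulfK// fst_neq. Qed.

(* The intersection of the line through [l], [m] with the line through [k] of
   opposite slope. *)
Definition cross l m k : R * R :=
  let c := slope l m in
  let x := (k.2 - l.2 + c * (k.1 + l.1)) / (2 * c) in (x, l.2 + c * (x - l.1)).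

Lemma crossE l m k x (c : R) : L l -> L m -> l != m -> c != 0 ->
  x.2 - l.2 = c * (x.1 - l.1) -> x.2 - m.2 = c * (x.1 - m.1) ->
  x.2 - k.2 = - c * (x.1 - k.1) -> x = cross l m k.
Proof.
move=> Ll Lm lm c0 xl xm xk.
have e : slope l m = c.
  apply: slopeE => //; have := congr2 (fun u v => u - v) xm xl.
  by rewrite opprB addrC -addrA addKr -mulrBr => h; lra.
rewrite /cross e; case: x xl xm xk => x1 x2 /= xl xm xk.
have -> : (k.2 - l.2 + c * (k.1 + l.1)) / (2 * c) = x1.
  have -> : k.2 - l.2 = 2 * c * x1 - c * (k.1 + l.1) by lra.
  by field.
by rewrite -xl addrC subrK.
Qed.

(** From a point x outside the class, each of l, m, k lies on one of two lines of opposite slopes.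
    Mixed signs would make x one of three crossing points, which the choice of x avoids. *)
Lemma collinear_class l m k : L l -> L m -> L k -> l != m -> l != k -> m != k ->
  eqv m l -> eqv k l -> exists2 c : R, c != 0 &
    m.2 - l.2 = c * (m.1 - l.1) /\ k.2 - l.2 = c * (k.1 - l.1).
Proof.
move=> Ll Lm Lk lm lk mk ml kl.
have [x [Lx xl]] := neqv_infinite l [:: cross l m k; cross l k m; cross m k l].
rewrite !inE !negb_or => /and3P[x1 x2 x3].
have [c c0 xc] := class_slope Ll Lx xl.
have line (d : R) : d != 0 -> x.2 - l.2 = d * (x.1 - l.1) ->
  x.2 - m.2 = d * (x.1 - m.1) -> x.2 - k.2 = d * (x.1 - k.1) ->
  exists2 c : R, c != 0 &
    m.2 - l.2 = c * (m.1 - l.1) /\ k.2 - l.2 = c * (k.1 - l.1).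
  by move=> d0 e1 e2 e3; exists d => //; split; lra.
have nc0 : - c != 0 by rewrite oppr_eq0.
have := xc _ Ll (eqvxx l); have := xc _ Lm ml; have := xc _ Lk kl.
move=> [ek|ek] [em|em] [el|el].
- exact: (line c).
- by case/eqP: x3; apply: (crossE _ _ mk c0 em ek el).
- by case/eqP: x2; apply: (crossE _ _ lk c0 el ek em).
- by case/eqP: x1; apply: (crossE _ _ lm nc0 el em); rewrite ?opprK.
- by case/eqP: x1; apply: (crossE _ _ lm c0 el em ek).
- by case/eqP: x2; apply: (crossE _ _ lk nc0 el ek); rewrite ?opprK.
- by case/eqP: x3; apply: (crossE _ _ mk nc0 em ek); rewrite ?opprK.
- exact: (line (- c)).
Qed.

(** A class of three points beats the sign ambiguity: from any x outside it, two of the three are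
    seen along the same slope, and these two span the common line. *)
Lemma on_line : (exists l, L l) -> exists l (c : R), [/\ L l, c != 0 &
  forall x, L x -> x.2 - l.2 = c * (x.1 - l.1)].
Proof.
move=> Lne.
have [l [m [k [[Ll Lm Lk] [lm lk mk ml kl]]]]] := big_class Lne.
have [c c0 [mc kc]] := collinear_class Ll Lm Lk lm lk mk ml kl.
exists l, c; split => // x Lx.
have dlm : m.1 - l.1 != 0 by apply: fst_neq => //; rewrite eq_sym.
have dlk : k.1 - l.1 != 0 by apply: fst_neq => //; rewrite eq_sym.
have dmk : k.1 - m.1 != 0 by apply: fst_neq => //; rewrite eq_sym.
have [xl|xl] := boolP (eqv x l).
  have [->|xNl] := eqVneq x l; first by rewrite !subrr mulr0.
  have [->|xNm] := eqVneq x m; first exact: mc.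
  rewrite eq_sym in xNl; rewrite eq_sym in xNm.
  have [c' _ [mc' ->]] := collinear_class Ll Lm Lx lm xNl xNm ml xl.
  by congr (_ * _); apply: (mulIf dlm); rewrite -mc -mc'.
have [d d0 xd] := class_slope Ll Lx xl.
have := xd _ Ll (eqvxx l); have := xd _ Lm ml; have := xd _ Lk kl.
have cd (y : R) (u v : R * R) : u.1 - v.1 != 0 ->
    u.2 - v.2 = c * (u.1 - v.1) -> x.2 - u.2 = y * (x.1 - u.1) ->
    x.2 - v.2 = y * (x.1 - v.1) -> y = c.
  by move=> uv0 uv xu xv; apply: (mulIf uv0); lra.
have kmc : k.2 - m.2 = c * (k.1 - m.1) by lra.
move=> [ek|ek] [em|em] [el|el].
- by rewrite -(cd _ _ _ dlm mc em el).
- by have := cd _ _ _ dmk kmc ek em => e; rewrite e in ek; lra.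
- by rewrite -(cd _ _ _ dlk kc ek el).
- by rewrite -(cd _ _ _ dlm mc em el).
- by rewrite -(cd _ _ _ dlm mc em el).
- by rewrite -(cd _ _ _ dlk kc ek el).
- by have := cd _ _ _ dmk kmc ek em => e; rewrite e in ek; lra.
- by rewrite -(cd _ _ _ dlm mc em el).
Qed.

(** * Slope and phases of the line *)

Lemma slope_sqr1 l (c : R) : c != 0 ->
  (forall x, L x -> x.2 - l.2 = c * (x.1 - l.1)) -> c ^+ 2 = 1.
Proof.
move=> c0 line.
have lineN x : L x -> l.2 - x.2 = c * (l.1 - x.1) by move=> /line; lra.
have nc0 : 0 < `|c| by rewrite normr_gt0.
suff c1 : `|c| = 1 by rewrite -(real_normK (num_real c)) c1 expr1n.
have sc x (d : R) : `|d| = `|x| -> sinc d = sinc x.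
  by move=> dx; rewrite -sinc_norm dx sinc_norm.
(* For |c| < 1 the second-coordinate sum with s = 1 equals the first-coordinate sum with s = |c|,
   whose total 2 / |c| exceeds 2. For |c| > 1 the coordinates exchange roles. *)
apply: contrapT => /eqP; rewrite neq_lt => /orP[] c1.
  have e0 : 0 < `|c|^-1 - 1 by rewrite subr_gt0 invf_gt1.
  have c01 : 0 < `|c| <= 1 by rewrite nc0 ltW.
  have [F [uF FL]] := @parseval1 `|c| l.1 (`|c|^-1 - 1) c01 e0.
  have := @bessel2 1 l.2 F; rewrite ltr01 lexx => /(_ isT uF FL).
  have -> : \sum_(k <- F) sinc (1 * (l.2 - k.2)) ^+ 2 =
            \sum_(k <- F) sinc (`|c| * (l.1 - k.1)) ^+ 2.
    rewrite big_seq [RHS]big_seq; apply: eq_bigr => k /FL /lineN ->.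
    by congr (_ ^+ 2); apply: sc; rewrite mul1r !normrM normr_id.
  by move: e0; move: (_^-1) => e; lra.
have c01 : 0 < `|c|^-1 <= 1 by rewrite invr_gt0 nc0/= invf_le1// ltW.
have e0 : 0 < `|c| - 1 by rewrite subr_gt0.
have [F [uF FL]] := @parseval2 `|c|^-1 l.2 (`|c| - 1) c01 e0.
have := @bessel1 1 l.1 F; rewrite ltr01 lexx => /(_ isT uF FL).
have -> : \sum_(k <- F) sinc (1 * (l.1 - k.1)) ^+ 2 =
          \sum_(k <- F) sinc (`|c|^-1 * (l.2 - k.2)) ^+ 2.
  rewrite big_seq [RHS]big_seq; apply: eq_bigr => k /FL /lineN ->.
  by congr (_ ^+ 2); apply: sc; rewrite mul1r !normrM normfV normr_id mulKf// normr_eq0.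
by rewrite invrK; lra.
Qed.

Lemma spectrum_offset : exists c : R,
  [/\ c ^+ 2 = 1, a - b * c \is a Num.int & a - b * c != 0].
Proof.
have Lne : exists l, L l.
  have [||[|l F] [uF FL]] := @parseval1 1 0 1; [by rewrite ltr01 lexx|lra| |].
    by rewrite big_nil; lra.
  by exists l; apply: FL; rewrite inE eqxx.
have [l [c [Ll c0 line]]] := on_line Lne.
have c1 := slope_sqr1 c0 line; exists c.
have sqE x y : L x -> L y -> (x.1 - y.1) ^+ 2 = (x.2 - y.2) ^+ 2.
  move=> /line xl /line yl.
  have -> : x.2 - y.2 = c * (x.1 - y.1) by lra.
  by rewrite exprMn c1 mul1r.
have [m [Lm ml _]] := neqv_infinite l [::].
have two x : L x -> eqv x l \/ eqv x m.
  move=> Lx; apply/orP; apply: contraT; rewrite negb_or => /andP[xl xm].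
  by have := no_three_sqr_eq Lx Lm Ll xm ml xl (sqE _ _ Lx Lm) (sqE _ _ Lm Ll)
    (sqE _ _ Lx Ll).
(* At the centre m.1 + 1 all other points of the class of m contribute 0, so without such a k only
   the class of l would remain, with at most 1. *)
have [k [Lk k1]] : exists k, L k /\ k.1 = m.1 + 1.
  apply: contrapT => nk.
  have [||F [uF FL]] := @parseval1 1 (m.1 + 1) (1/2); [by rewrite ltr01 lexx|lra|].
  apply/negP; rewrite -ltNge; under eq_bigr do rewrite mul1r.
  rewrite (bigID (fun k => eqv k l))/= -big_filter [X in _ + X]big1_seq ?addr0.
    apply: (@le_lt_trans _ _ 1); last lra.
    apply: (@sum_class_le1 l); first exact: filter_uniq.
      by move=> x; rewrite mem_filter => /andP[_ /FL].
    by move=> x; rewrite mem_filter => /andP[].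
  move=> x /andP[xl /FL Lx].
  have xm : eqv x m by case: (two x Lx) => // h; rewrite h in xl.
  rewrite sinc_int ?expr0n//.
    by rewrite addrAC rpredD ?rpred1// -/(eqv m x) eqvC.
  by apply/eqP => /subr0_eq e; apply: nk; exists x.
have km : eqv k m by rewrite /eqv k1 addrAC subrr add0r rpred1.
have kl : ~~ eqv k l.
  by apply: contra ml => kl; apply: eqv_trans kl; rewrite eqvC.
have ph x : L x -> ~~ eqv x l -> cos (2 * pi * (a - b * c) * (x.1 - l.1)) = -1.
  move=> Lx xl; have := phase Lx Ll xl (sqE _ _ Lx Ll); rewrite (line x Lx) => <-.
  by congr cos; ring.
(* The phases of m and k relative to l both lie in 1/2 + Z and differ by a - b c, which is therefore
   an integer; a - b c = 0 would make the phases 0. *)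
have pm := ph _ Lm ml; have pk := ph _ Lk kl; split => //.
  apply: cos_2pi_eq1; rewrite k1 in pk.
  have -> : 2 * pi * (a - b * c) = 2 * pi * (a - b * c) * (m.1 + 1 - l.1) -
    2 * pi * (a - b * c) * (m.1 - l.1) by ring.
  rewrite cosB pk pm; set A := _ * (_ - _).
  have := cos2Dsin2 A; have := cos2Dsin2 (2 * pi * (a - b * c) * (m.1 - l.1)).
  rewrite pk pm sqrrN expr1n => /eqP.
  rewrite addrC -subr_eq0 addrK sqrf_eq0 => /eqP ->.
  by rewrite mulr0 addr0 mulrNN mulr1.
apply/eqP => e; move: pm; rewrite e mulr0 mul0r cos0 => h; lra.
Qed.

End PlusCombinatorics.

(** * Bessel and Parseval inequalities *)

Section BoundedInner.
Local Open Scope complex_scope.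
Context d (T : measurableType d) (R : realType).
Implicit Types (u v : T -> R) (f g e : T -> R[i]) (c : R[i]).

(** All functions to be tested are bounded, and on a finite measure this class is integrable and
    closed under products, so inner products expand freely. *)
Definition bounded_mfun u :=
  measurable_fun setT u /\ exists M : R, forall x, `|u x| <= M.

Lemma bmfun_cst (r : R) : bounded_mfun (fun=> r).
Proof. by split; [exact: measurable_cst|exists `|r|]. Qed.

Lemma bmfunD u v : bounded_mfun u -> bounded_mfun v ->
  bounded_mfun (fun x => u x + v x).
Proof.
move=> [mu [M uM]] [mv [N vN]]; split; first exact: measurable_funD.
by exists (M + N) => x; rewrite (le_trans (ler_normD _ _))// lerD.
Qed.

Lemma bmfunM u v : bounded_mfun u -> bounded_mfun v ->
  bounded_mfun (fun x => u x * v x).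
Proof.
move=> [mu [M uM]] [mv [N vN]]; split; first exact: measurable_funM.
by exists (M * N) => x; rewrite normrM ler_pM.
Qed.

Lemma bmfunN u : bounded_mfun u -> bounded_mfun (fun x => - u x).
Proof.
move=> [mu [M uM]]; split; first exact: measurableT_comp.
by exists M => x; rewrite normrN.
Qed.

Lemma bmfunB u v : bounded_mfun u -> bounded_mfun v ->
  bounded_mfun (fun x => u x - v x).
Proof. by move=> hu hv; apply: bmfunD => //; exact: bmfunN. Qed.

Definition bounded_cmfun f :=
  bounded_mfun (fun x => complex.Re (f x)) /\
  bounded_mfun (fun x => complex.Im (f x)).

Lemma ReM c c' : complex.Re (c * c') =
  complex.Re c * complex.Re c' - complex.Im c * complex.Im c'.
Proof. by case: c => a b; case: c' => a' b'. Qed.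

Lemma ImM c c' : complex.Im (c * c') =
  complex.Re c * complex.Im c' + complex.Im c * complex.Re c'.
Proof. by case: c => a b; case: c' => a' b'. Qed.

Lemma ReD c c' : complex.Re (c + c') = complex.Re c + complex.Re c'.
Proof. by case: c => a b; case: c' => a' b'. Qed.

Lemma ImD c c' : complex.Im (c + c') = complex.Im c + complex.Im c'.
Proof. by case: c => a b; case: c' => a' b'. Qed.

Lemma ReN c : complex.Re (- c) = - complex.Re c.
Proof. by case: c. Qed.

Lemma ImN c : complex.Im (- c) = - complex.Im c.
Proof. by case: c. Qed.

Lemma ReJ c : complex.Re c^* = complex.Re c. Proof. by case: c. Qed.

Lemma ImJ c : complex.Im c^* = - complex.Im c. Proof. by case: c. Qed.

Definition ReImE := (ReM, ImM, ReD, ImD, ReN, ImN, ReJ, ImJ).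

Lemma complex_eqP c c' : complex.Re c = complex.Re c' ->
  complex.Im c = complex.Im c' -> c = c'.
Proof. by case: c => a b; case: c' => a' b' /= -> ->. Qed.

Definition nsq (c : R[i]) : R := complex.Re c ^+ 2 + complex.Im c ^+ 2.

Lemma nsq_ge0 c : 0 <= nsq c. Proof. by rewrite addr_ge0// sqr_ge0. Qed.

Lemma ReMJ c : complex.Re (c * c^*) = nsq c.
Proof. by rewrite ReM ReJ ImJ mulrN opprK -!expr2. Qed.

Lemma bcmfun_cst c : bounded_cmfun (fun=> c).
Proof. by split; exact: bmfun_cst. Qed.

Lemma bcmfunD f g : bounded_cmfun f -> bounded_cmfun g ->
  bounded_cmfun (fun x => f x + g x).
Proof.
move=> [f1 f2] [g1 g2]; split.
  by under eq_fun do rewrite ReD; exact: bmfunD.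
by under eq_fun do rewrite ImD; exact: bmfunD.
Qed.

Lemma bcmfunM f g : bounded_cmfun f -> bounded_cmfun g ->
  bounded_cmfun (fun x => f x * g x).
Proof.
move=> [f1 f2] [g1 g2]; split.
  by under eq_fun do rewrite ReM; apply: bmfunB; exact: bmfunM.
by under eq_fun do rewrite ImM; apply: bmfunD; exact: bmfunM.
Qed.

Lemma bcmfunJ f : bounded_cmfun f -> bounded_cmfun (fun x => (f x)^*).
Proof.
move=> [f1 f2]; split; first by under eq_fun do rewrite ReJ.
by under eq_fun do rewrite ImJ; exact: bmfunN.
Qed.

Lemma bcmfunN f : bounded_cmfun f -> bounded_cmfun (fun x => - f x).
Proof.
move=> [f1 f2]; split; first by under eq_fun do rewrite ReN; exact: bmfunN.
by under eq_fun do rewrite ImN; exact: bmfunN.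
Qed.

Lemma bcmfunB f g : bounded_cmfun f -> bounded_cmfun g ->
  bounded_cmfun (fun x => f x - g x).
Proof. by move=> hf hg; apply: bcmfunD => //; exact: bcmfunN. Qed.

Lemma bcmfun_sum (I : Type) (s : seq I) (F : I -> T -> R[i]) :
  (forall i, bounded_cmfun (F i)) ->
  bounded_cmfun (fun x => \sum_(i <- s) F i x).
Proof.
move=> hF; elim: s => [|i s IH].
  by under eq_fun do rewrite big_nil; exact: bcmfun_cst.
by under eq_fun do rewrite big_cons; exact: bcmfunD.
Qed.

Context (mu : {finite_measure set T -> \bar R}).
Local Notation "'[ f , g ]" := (L2dot mu f g) (format "''[' f ,  g ]").

Lemma bmfun_integrable u : bounded_mfun u -> mu.-integrable setT (EFin \o u).
Proof.
move=> [mu_ [M uM]]; apply: measurable_bounded_integrable => //.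
  by rewrite ltey_eq fin_num_measure.
exists M; split; first exact: num_real.
by move=> y My x _; exact: (le_trans (uM x) (ltW My)).
Qed.

Lemma L2dotDl f g e : bounded_cmfun f -> bounded_cmfun g -> bounded_cmfun e ->
  '[(fun x => f x + g x), e] = '[f, e] + '[g, e].
Proof.
move=> hf hg he; have he' := bcmfunJ he.
have [h1 h2] := bcmfunM hf he'; have [h3 h4] := bcmfunM hg he'.
apply: complex_eqP; rewrite !ReImE/=.
  under eq_Rintegral do rewrite mulrDl ReD.
  by rewrite RintegralD//; exact: bmfun_integrable.
under eq_Rintegral do rewrite mulrDl ImD.
by rewrite RintegralD//; exact: bmfun_integrable.
Qed.

Lemma L2dotZl c f e : bounded_cmfun f -> bounded_cmfun e ->
  '[(fun x => c * f x), e] = c * '[f, e].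
Proof.
move=> hf he; have [h1 h2] := bcmfunM hf (bcmfunJ he).
have i1 := bmfun_integrable h1; have i2 := bmfun_integrable h2.
have hc (r : R) u : bounded_mfun u -> mu.-integrable setT (EFin \o (fun x => r * u x)).
  by move=> hu; apply: bmfun_integrable; apply: bmfunM => //; exact: bmfun_cst.
apply: complex_eqP; rewrite ?(ReM, ImM)/=.
  under eq_Rintegral do rewrite -mulrA ReM.
  by rewrite RintegralB ?RintegralZl//; apply: hc.
under eq_Rintegral do rewrite -mulrA ImM.
by rewrite RintegralD ?RintegralZl//; apply: hc.
Qed.

Lemma L2dotC f g : bounded_cmfun f -> bounded_cmfun g -> '[g, f] = '[f, g]^*.
Proof.
move=> hf hg; have [h1 h2] := bcmfunM hf (bcmfunJ hg).
apply: complex_eqP; rewrite !(ReJ, ImJ)/=.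
  by apply: eq_Rintegral => x _; rewrite !(ReM, ImM, ReJ, ImJ); ring.
rewrite -mulN1r -RintegralZl//; last exact: bmfun_integrable.
by apply: eq_Rintegral => x _; rewrite !(ReM, ImM, ReJ, ImJ); ring.
Qed.

Lemma L2dot_sub f g e c : bounded_cmfun f -> bounded_cmfun g ->
  bounded_cmfun e -> '[(fun x => f x - c * g x), e] = '[f, e] - c * '[g, e].
Proof.
move=> hf hg he; rewrite -mulNr -L2dotZl// -L2dotDl//.
  by congr L2dot; apply/funext => x; rewrite mulNr.
by apply: bcmfunM => //; exact: bcmfun_cst.
Qed.

Section Orthonormal.
Context (I : choiceType) (e : I -> T -> R[i]) (A : set I).
Hypothesis he : forall i, bounded_cmfun (e i).
Hypothesis e1 : forall i, A i -> '[e i, e i] = 1.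
Hypothesis e0 : forall i j, A i -> A j -> i != j -> '[e i, e j] = 0.

(** Subtracting c j e j from f leaves the coefficients at the other indices unchanged. Taking c to
    be the coefficients of f gives Bessel; the c supplied by density gives Parseval. *)
Lemma L2dot_defect (s : seq I) (c : I -> R[i]) f : uniq s ->
  {in s, forall i, A i} -> bounded_cmfun f ->
  '[(fun x => f x - \sum_(i <- s) c i * e i x),
    (fun x => f x - \sum_(i <- s) c i * e i x)] =
  '[f, f] - \sum_(i <- s) '[f, e i] * '[f, e i]^* +
  \sum_(i <- s) (c i - '[f, e i]) * (c i - '[f, e i])^*.
Proof.
elim: s f => [|j s IH] f /=.
  move=> _ _ hf; rewrite !big_nil subr0 addr0; congr L2dot; apply/funext => x.
    by rewrite big_nil subr0.
  by rewrite big_nil subr0.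
move=> /andP[js us] sA hf.
have Aj : A j by apply: sA; rewrite inE eqxx.
pose g x := f x - c j * e j x.
have hce : bounded_cmfun (fun x => c j * e j x).
  by apply: bcmfunM => //; exact: bcmfun_cst.
have hg : bounded_cmfun g by exact: bcmfunB.
have -> : (fun x => f x - \sum_(i <- j :: s) c i * e i x) =
          (fun x => g x - \sum_(i <- s) c i * e i x).
  by apply/funext => x; rewrite big_cons opprD addrA.
rewrite IH//; last by move=> i si; apply: sA; rewrite inE si orbT.
have ge i : i \in s -> '[g, e i] = '[f, e i].
  move=> si; rewrite L2dot_sub// e0 ?mulr0 ?subr0//.
    by apply: sA; rewrite inE si orbT.
  by apply: contraNneq js => ->.
have -> : '[g, g] = '[f, f] - '[f, e j] * '[f, e j]^* +
    (c j - '[f, e j]) * (c j - '[f, e j])^*.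
  rewrite L2dot_sub// (L2dotC hg hf) (L2dotC hg (he j)) !L2dot_sub// e1//.
  rewrite (L2dotC hf (he j)).
  have := L2dotC hf hf; move: '[f, f] '[f, e j] (c j) => F z y FJ.
  by rewrite !(rmorphB, rmorphM, rmorph1)/= -FJ conjcK; ring.
rewrite !big_cons.
have -> : \sum_(i <- s) '[g, e i] * '[g, e i]^* =
          \sum_(i <- s) '[f, e i] * '[f, e i]^*.
  by rewrite big_seq [RHS]big_seq; apply: eq_bigr => i /ge ->.
have -> : \sum_(i <- s) (c i - '[g, e i]) * (c i - '[g, e i])^* =
          \sum_(i <- s) (c i - '[f, e i]) * (c i - '[f, e i])^*.
  by rewrite big_seq [RHS]big_seq; apply: eq_bigr => i /ge ->.
ring.
Qed.

Lemma Re_sum (s : seq I) (F : I -> R[i]) :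
  complex.Re (\sum_(i <- s) F i) = \sum_(i <- s) complex.Re (F i).
Proof. by elim: s => [|i s IH]; rewrite ?big_nil// !big_cons ReD IH. Qed.

Lemma Re_L2dot_ge0 f : 0 <= complex.Re '[f, f].
Proof. by apply: Rintegral_ge0 => x _; rewrite ReMJ nsq_ge0. Qed.

Lemma bessel_ineq (s : seq I) f : uniq s -> {in s, forall i, A i} ->
  bounded_cmfun f ->
  \sum_(i <- s) nsq '[f, e i] <= complex.Re '[f, f].
Proof.
move=> us sA hf.
have := L2dot_defect (fun i => '[f, e i]) us sA hf.
rewrite [X in _ + X]big1 ?addr0; last by move=> i _; rewrite subrr mul0r.
move=> /(congr1 (@complex.Re R)); rewrite ReD ReN Re_sum.
under eq_bigr do rewrite ReMJ.
by move=> h; rewrite -subr_ge0 -h Re_L2dot_ge0.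
Qed.

End Orthonormal.

End BoundedInner.

(** * The L2 norm in terms of the squared modulus *)

Section L2normFacts.
Local Open Scope complex_scope.
Context d (T : measurableType d) (R : realType) (mu : {measure set T -> \bar R}).
Implicit Types (f : T -> R[i]).

Lemma normc_sqr (c : R[i]) : ComplexField.Normc.normc c ^+ 2 = nsq c.
Proof.
by case: c => x y; rewrite /nsq /= sqr_sqrtr// addr_ge0// sqr_ge0.
Qed.

Lemma normc_ge0 (c : R[i]) : 0 <= ComplexField.Normc.normc c.
Proof. by case: c => x y; exact: sqrtr_ge0. Qed.

Lemma L2norm_sqr f : poweR (L2norm mu f) 2 = (\int[mu]_x (nsq (f x))%:E)%E.
Proof.
rewrite /L2norm poweR_Lnorm//; apply: eq_integral => x _ /=.
by rewrite ger0_norm ?normc_ge0// powR_mulrn ?normc_ge0// normc_sqr.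
Qed.

Lemma poweR2_lt (x : \bar R) (r : R) : (0 <= x)%E -> 0 < r ->
  (x < r%:E)%E <-> (poweR x 2 < (r ^+ 2)%:E)%E.
Proof.
case: x => [x||]//= x0 r0; last by rewrite pnatr_eq0/= !ltNge !leey.
rewrite lee_fin in x0; rewrite !lte_fin powR_mulrn// ltr_sqr ?nnegrE//.
exact: ltW.
Qed.

Lemma L2norm_lt f (r : R) : 0 < r ->
  (L2norm mu f < r%:E)%E <-> (\int[mu]_x (nsq (f x))%:E < (r ^+ 2)%:E)%E.
Proof. by move=> r0; rewrite -L2norm_sqr; apply: poweR2_lt => //; exact: Lnorm_ge0. Qed.

Lemma L2norm_lty f :
  (L2norm mu f < +oo)%E <-> (\int[mu]_x (nsq (f x))%:E < +oo)%E.
Proof.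
by rewrite -L2norm_sqr; split => [|/lty_poweRy]; [exact: poweR_lty|apply].
Qed.

End L2normFacts.

(** * Parseval's inequality from density *)

Section ParsevalDensity.
Local Open Scope complex_scope.
Context d (T : measurableType d) (R : realType).
Context (mu : {finite_measure set T -> \bar R}).
Context (I : choiceType) (e : I -> T -> R[i]) (A : set I).
Hypothesis he : forall i, bounded_cmfun (e i).
Hypothesis e1 : forall i, A i -> L2dot mu (e i) (e i) = 1.
Hypothesis e0 : forall i j, A i -> A j -> i != j -> L2dot mu (e i) (e j) = 0.

Lemma integral_nsq f : bounded_cmfun f ->
  (\int[mu]_x (nsq (f x))%:E)%E = (complex.Re (L2dot mu f f))%:E.
Proof.
move=> hf; rewrite /L2dot/= /Rintegral.
under [in RHS]eq_integral do rewrite ReMJ.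
rewrite fineK//; apply: integrable_fin_num => //.
under eq_fun do rewrite -ReMJ.
by apply: bmfun_integrable; have [] := bcmfunM hf (bcmfunJ hf).
Qed.

Lemma bcmfun_L2 f : bounded_cmfun f -> L2 mu f.
Proof.
move=> hf; split; [by case: hf => -[]|by case: hf => _ []|].
by apply/L2norm_lty; rewrite integral_nsq// ltry.
Qed.

Lemma parseval_ineq f (eps : R) : 0 < eps -> bounded_cmfun f ->
  (forall eps : R, 0 < eps -> exists (s : seq I) (c : I -> R[i]),
    [set` s] `<=` A /\
    (L2norm mu (fun x => f x - \sum_(i <- s) c i * e i x)%R < eps%:E)%E) ->
  exists s, [/\ uniq s, {in s, forall i, A i} &
    complex.Re (L2dot mu f f) - eps <= \sum_(i <- s) nsq (L2dot mu f (e i))].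
Proof.
move=> eps0 hf dense.
have sq0 : 0 < Num.sqrt eps by rewrite sqrtr_gt0.
have [s [c [sA]]] := dense _ sq0.
(* The list given by density may repeat indices; the multiplicities move into the coefficients so
   that orthogonality applies. *)
pose c' i := c i *+ count_mem i s.
have -> : (fun x => f x - \sum_(i <- s) c i * e i x) =
          (fun x => f x - \sum_(i <- undup s) c' i * e i x).
  apply/funext => x; congr (_ - _); rewrite -big_undup_iterop_count/=.
  by apply: eq_bigr => i _; rewrite /c' mulrnAl Monoid.iteropE -GRing.iter_addr_0.
rewrite L2norm_lt// sqr_sqrtr ?ltW//.
have hg : bounded_cmfun (fun x => f x - \sum_(i <- undup s) c' i * e i x).
  apply: bcmfunB => //; apply: bcmfun_sum => i.
  by apply: bcmfunM => //; exact: bcmfun_cst.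
rewrite integral_nsq// lte_fin => hlt.
have us := undup_uniq s.
have uA : {in undup s, forall i, A i} by move=> i; rewrite mem_undup; exact: sA.
exists (undup s); split => //; move: hlt.
rewrite (L2dot_defect he e1 e0 c' us uA hf) !(ReD, ReN) !Re_sum.
under eq_bigr do rewrite ReMJ.
under [X in _ + X < _]eq_bigr do rewrite ReMJ.
have : 0 <= \sum_(i <- undup s) nsq (c' i - L2dot mu f (e i)).
  by apply: sumr_ge0 => i _; exact: nsq_ge0.
move: (\sum_(i <- _) _) (\sum_(i <- _) _) => x y x0; rewrite addrAC.
lra.
Qed.

End ParsevalDensity.

(** * Integrals over the two arms *)

Section SegmentIntegral.
Context (R : realType).
Local Notation mu := (@lebesgue_measure R).
Local Notation plane := (measurableTypeR R * measurableTypeR R)%type.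

Lemma integral_segment (a b : R) (f : R -> \bar R) : measurable_fun setT f ->
  (\int[lebesgue_segment a b]_x f x = \int[mu]_(x in `[a, b]) f x)%E.
Proof.
move=> mf; have mD : measurable (`[a, b]%classic : set R) by exact: measurable_itv.
rewrite -(setUv (`[a, b]%classic : set R)) integral_setU//; last 3 first.
- exact: measurableC.
- by apply: measurable_funS mf.
- by apply/disj_set2P; rewrite setICr.
rewrite (_ : (\int[lebesgue_segment a b]_(x in ~` `[a, b]%classic) f x = 0)%E).
  rewrite adde0; apply: eq_measure_integral => A mA AD.
  by rewrite -[in RHS](setIidl AD).
apply: null_set_integral; [exact: measurableC|exact: measurable_funS mf|].
have : mu (~` `[a, b]%classic `&` `[a, b]%classic) = 0%E by rewrite setICl measure0.
by [].
Qed.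

Lemma integral_rho_ge0 (t1 t2 : R) (h : plane -> \bar R) :
  measurable_fun setT h -> (forall x, 0 <= h x)%E ->
  (\int[rho t1 t2]_x h x = (2^-1)%:E *
    (\int[lebesgue_segment t1 (t1 + 1)]_x h (x, 0%R) +
     \int[lebesgue_segment t2 (t2 + 1)]_y h (0%R, y)))%E.
Proof.
move=> mh h0.
transitivity (\int[mscale ((2^-1)%:nng)%R
  (measure_add (lebesgue_segment t1 (t1 + 1) \x @dirac _ (measurableTypeR R) 0%R R)%E
   (@dirac _ (measurableTypeR R) 0%R R \x lebesgue_segment t2 (t2 + 1))%E)]_x h x)%E.
  by [].
rewrite ge0_integral_mscale//; congr (_ * _)%E.
rewrite ge0_integral_measure_add//; congr (_ + _)%E.
  rewrite fubini_tonelli1//; apply: eq_integral => x _.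
  rewrite /fubini_F integral_dirac//; first by rewrite diracT mul1e.
  by apply: measurableT_comp.
rewrite fubini_tonelli1// /fubini_F integral_dirac//; first by rewrite diracT mul1e.
exact: measurable_fun_fubini_tonelli_F.
Qed.

Lemma lebesgue_segmentT (t : R) : lebesgue_segment t (t + 1) setT = 1%E.
Proof.
rewrite /lebesgue_segment /mrestr setTI /= lebesgue_measure_itv /= lte_fin.
by rewrite ltrDl ltr01 -EFinB addrAC subrr add0r.
Qed.

Lemma bmfun_comp d d' (S : measurableType d) (S' : measurableType d')
    (phi : S -> S') (u : S' -> R) :
  measurable_fun setT phi -> bounded_mfun u -> bounded_mfun (u \o phi).
Proof.
move=> mphi [mu_ [M uM]]; split; first exact: measurableT_comp.
by exists M => x; exact: uM.
Qed.

Lemma bmfun_fst (h : plane -> R) : bounded_mfun h ->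
  bounded_mfun (fun x : measurableTypeR R => h (x, 0)).
Proof. by move=> hh; apply: (bmfun_comp _ hh); exact: pair2_measurable. Qed.

Lemma bmfun_snd (h : plane -> R) : bounded_mfun h ->
  bounded_mfun (fun y : measurableTypeR R => h (0, y)).
Proof. by move=> hh; apply: (bmfun_comp _ hh); exact: pair1_measurable. Qed.

(** Adding a bound [M] of |h| reduces to the nonnegative case; all three measures have mass 1, so
    [M] cancels. *)
Lemma Rintegral_rho (t1 t2 : R) (h : plane -> R) : bounded_mfun h ->
  \int[rho t1 t2]_x h x = 2^-1 *
    (\int[lebesgue_segment t1 (t1 + 1)]_x h (x, 0) +
     \int[lebesgue_segment t2 (t2 + 1)]_y h (0, y)).
Proof.
move=> hh; have [mh [M hM]] := hh.
have key d (S : measurableType d) (m : {finite_measure set S -> \bar R})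
    (u : S -> R) : m setT = 1%E -> bounded_mfun u ->
    \int[m]_x (u x + M) = \int[m]_x u x + M.
  move=> m1 hu; have iu := bmfun_integrable m hu.
  have iM := bmfun_integrable m (@bmfun_cst _ S R M).
  by rewrite RintegralD// Rintegral_cst//= m1 mulr1.
have h1 := bmfun_fst hh; have h2 := bmfun_snd hh.
suff : \int[rho t1 t2]_x (h x + M) = 2^-1 *
    (\int[lebesgue_segment t1 (t1 + 1)]_x (h (x, 0) + M) +
     \int[lebesgue_segment t2 (t2 + 1)]_y (h (0, y) + M)).
  rewrite (key _ _ (rho t1 t2) _ (probability_setT _) hh).
  rewrite (key _ _ (lebesgue_segment t1 _) _ (lebesgue_segmentT t1) h1).
  rewrite (key _ _ (lebesgue_segment t2 _) _ (lebesgue_segmentT t2) h2).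
  by move=> e; lra.
have hM' : bounded_mfun (fun x => h x + M) by apply: bmfunD => //; exact: bmfun_cst.
have f1 : (\int[lebesgue_segment t1 (t1 + 1)]_x (h (x, 0%R) + M)%:E)%E \is a fin_num.
  by apply: integrable_fin_num => //; exact: (bmfun_integrable _ (bmfun_fst hM')).
have f2 : (\int[lebesgue_segment t2 (t2 + 1)]_y (h (0%R, y) + M)%:E)%E \is a fin_num.
  by apply: integrable_fin_num => //; exact: (bmfun_integrable _ (bmfun_snd hM')).
have mhM : measurable_fun setT (fun x => (h x + M)%:E).
  by apply/measurable_EFinP; case: hM'.
have hM0 x : (0 <= (h x + M)%:E)%E.
  by rewrite lee_fin -lerBlDr sub0r; have := hM x; rewrite ler_norml => /andP[].
have := integral_rho_ge0 t1 t2 mhM hM0 => /(congr1 fine).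
rewrite fineM; [|by []|by rewrite fin_numD f1 f2].
by rewrite (fineD f1 f2) => E; exact: E.
Qed.

(** * Fourier integrals over an interval *)

Lemma is_derive_sin_lin (c x : R) :
  is_derive x 1 (fun x => sin (c * x)) (c * cos (c * x)).
Proof.
have h : is_derive x 1 (fun x => c * x) c.
  by apply: is_derive_eq; rewrite -[c *: 1]/(c * 1) mulr1.
have := @is_derive1_comp R (@sin R) (fun x => c * x) x _ _ (is_derive_sin _) h.
by rewrite mulrC.
Qed.

Lemma is_derive_cos_lin (c x : R) :
  is_derive x 1 (fun x => cos (c * x)) (- (c * sin (c * x))).
Proof.
have h : is_derive x 1 (fun x => c * x) c.
  by apply: is_derive_eq; rewrite -[c *: 1]/(c * 1) mulr1.
have := @is_derive1_comp R (@cos R) (fun x => c * x) x _ _ (is_derive_cos _) h.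
by rewrite mulNr mulrC.
Qed.

Lemma FTC_everywhere (F f : R -> R) (a b : R) : a < b ->
  continuous f -> (forall x : R, is_derive x 1 F (f x)) ->
  (\int[mu]_(x in `[a, b]) (f x)%:E = (F b - F a)%:E)%E.
Proof.
move=> ab cf dF; have dr (x : R) : derivable F x 1 by have := dF x => -[].
have cF (x : R) : {for x, continuous F}.
  by apply: differentiable_continuous; apply/derivable1_diffP.
rewrite (@continuous_FTC2 _ f F _ _ ab)//; first exact: continuous_subspaceT.
- split => //; [exact: cvg_at_right_filter (cF a)|
                exact: cvg_at_left_filter (cF b)].
- by move=> x _; rewrite derive1E (@derive_val _ _ _ _ _ _ _ (dF x)).
Qed.

Lemma continuous_cos_lin (c : R) : continuous (fun x => cos (c * x)).
Proof.
move=> x; apply: (@continuous_comp R R R (fun x => c * x) cos).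
  by apply: cvgMr.
exact: continuous_cos.
Qed.

Lemma continuous_sin_lin (c : R) : continuous (fun x => sin (c * x)).
Proof.
move=> x; apply: (@continuous_comp R R R (fun x => c * x) sin).
  by apply: cvgMr.
exact: continuous_sin.
Qed.

(** Writing the endpoints as midpoint plus or minus s / 2 turns the increment of the primitive into
    [sinc] times the value at the midpoint. The primitive divides by d, hence the separate case d =
    0. *)
Lemma integral_cos_itv (t s d : R) : 0 < s ->
  (\int[mu]_(x in `[t, (t + s)%R]) (cos (2 * pi * d * x))%:E =
   (s * sinc (s * d) * cos (2 * pi * d * (t + s / 2)))%:E)%E.
Proof.
move=> s0; have pi0 := @pi_gt0 R; have ts : t < t + s by rewrite ltrDl.
have [->|d0] := eqVneq d 0.
  rewrite !mulr0 sinc0 mul0r cos0 !mulr1.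
  under eq_integral do rewrite mul0r cos0.
  rewrite integral_cst//= lebesgue_measure_itv/= lte_fin ts mul1e -EFinB.
  by rewrite addrAC subrr add0r.
have pd : 2 * pi * d != 0 by rewrite !mulf_neq0// gt_eqF.
have dF (x : R) : is_derive x 1 (fun x => (2 * pi * d)^-1 * sin (2 * pi * d * x))
    (cos (2 * pi * d * x)).
  have h := is_derive_sin_lin (2 * pi * d) x.
  apply: is_derive_eq; rewrite /GRing.scale/= ?mulr0 ?addr0 ?mulKf//.
rewrite (FTC_everywhere ts (@continuous_cos_lin _) dF).
congr EFin; rewrite -mulrBr; apply: (mulfI pd); rewrite mulVKf//.
have -> : 2 * pi * d * (t + s) = 2 * pi * d * (t + s / 2) + pi * (s * d) by field.
have -> : 2 * pi * d * t = 2 * pi * d * (t + s / 2) - pi * (s * d) by field.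
by rewrite sinD sinB sincE; ring.
Qed.

Lemma integral_sin_itv (t s d : R) : 0 < s ->
  (\int[mu]_(x in `[t, (t + s)%R]) (sin (2 * pi * d * x))%:E =
   (s * sinc (s * d) * sin (2 * pi * d * (t + s / 2)))%:E)%E.
Proof.
move=> s0; have pi0 := @pi_gt0 R; have ts : t < t + s by rewrite ltrDl.
have [->|d0] := eqVneq d 0.
  rewrite !mulr0 mul0r sin0 mulr0.
  by under eq_integral do rewrite mul0r sin0; rewrite integral0.
have pd : 2 * pi * d != 0 by rewrite !mulf_neq0// gt_eqF.
have dF (x : R) : is_derive x 1 (fun x => - (2 * pi * d)^-1 * cos (2 * pi * d * x))
    (sin (2 * pi * d * x)).
  have h := is_derive_cos_lin (2 * pi * d) x.
  apply: is_derive_eq; rewrite /GRing.scale/= ?mulr0 ?addr0 ?mulrNN ?mulKf//.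
rewrite (FTC_everywhere ts (@continuous_sin_lin _) dF).
congr EFin; rewrite -mulrBr mulNr -mulrN opprB; apply: (mulfI pd).
rewrite mulVKf//.
have -> : 2 * pi * d * (t + s) = 2 * pi * d * (t + s / 2) + pi * (s * d) by field.
have -> : 2 * pi * d * t = 2 * pi * d * (t + s / 2) - pi * (s * d) by field.
by rewrite cosB cosD sincE; ring.
Qed.

Lemma measurable_cos_lin (c : R) : measurable_fun setT (fun x : R => cos (c * x)).
Proof. by apply: continuous_measurable_fun; exact: continuous_cos_lin. Qed.

Lemma measurable_sin_lin (c : R) : measurable_fun setT (fun x : R => sin (c * x)).
Proof. by apply: continuous_measurable_fun; exact: continuous_sin_lin. Qed.

(* A point is removed from the interval so that the function on the plane
   supported on one arm vanishes identically on the other one. *)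
Definition pitv (t s : R) : set R := `[t, t + s]%classic `\ 0.

Lemma measurable_pitv (t s : R) : measurable (pitv t s).
Proof. by apply: measurableD; [exact: measurable_itv|exact: measurable_set1]. Qed.

Lemma Rintegral_segment_indic (t s c : R) (g : R -> R) : 0 < s <= 1 ->
  measurable_fun setT g ->
  (\int[mu]_(x in `[t, (t + s)%R]) (g x)%:E = c%:E)%E ->
  \int[lebesgue_segment t (t + 1)]_x (\1_(pitv t s) x * g x) = c.
Proof.
move=> /andP[s0 s1] mg e; rewrite /Rintegral integral_segment; last first.
  apply/measurable_EFinP; apply: measurable_funM => //.
  by apply: measurable_indic; exact: measurable_pitv.
suff -> : (\int[mu]_(x in `[t, (t + 1)%R]) (\1_(pitv t s) x * g x)%:E = c%:E)%E.
  by [].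
rewrite -e.
transitivity (\int[mu]_(x in `[t, (t + 1)%R])
   (((fun x => (g x)%:E) \_ (pitv t s)) x))%E.
  apply: eq_integral => x _; rewrite patchE indicE.
  by case: ifPn => _; rewrite ?mul1r ?mul0r.
rewrite -integral_mkcondr (_ : _ `&` _ = `[t, (t + s)%R]%classic `\ 0).
  rewrite integral_setD1//; first exact: measurable_pitv.
  apply/measurable_EFinP; exact: measurable_funS mg.
apply/setIidr => x [/=]; rewrite !in_itv/= => /andP[-> h] _.
by rewrite (le_trans h)// lerD2l.
Qed.

Lemma Rintegral_segment_cos (t d : R) :
  \int[lebesgue_segment t (t + 1)]_x cos (2 * pi * d * x) =
  sinc d * cos (2 * pi * d * (t + 2^-1)).
Proof.
rewrite /Rintegral integral_segment; last first.
  by apply/measurable_EFinP; exact: measurable_cos_lin.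
by rewrite integral_cos_itv//= !mul1r.
Qed.

Lemma Rintegral_segment_sin (t d : R) :
  \int[lebesgue_segment t (t + 1)]_x sin (2 * pi * d * x) =
  sinc d * sin (2 * pi * d * (t + 2^-1)).
Proof.
rewrite /Rintegral integral_segment; last first.
  by apply/measurable_EFinP; exact: measurable_sin_lin.
by rewrite integral_sin_itv//= !mul1r.
Qed.

Local Open Scope complex_scope.

Lemma cisB (x y : R) : cis x * (cis y)^* = cis (x - y).
Proof.
by rewrite /cis; apply: complex_eqP; rewrite ?(ReM, ImM)/= ?sinB ?cosB; ring.
Qed.

Lemma bcmfun_cis d (T : measurableType d) (u : T -> R) :
  measurable_fun setT u -> bounded_cmfun (fun x => cis (u x)).
Proof.
move=> mu; split; split.
- by apply: measurableT_comp => //; apply: continuous_measurable_fun; exact: continuous_cos.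
- by exists 1 => x; exact: cos_max.
- by apply: measurableT_comp => //; apply: continuous_measurable_fun; exact: continuous_sin.
- by exists 1 => x; exact: sin_max.
Qed.

Lemma bcmfun_indic d (T : measurableType d) (D : set T) :
  measurable D -> bounded_cmfun (fun x => (\1_D x)%:C : R[i]).
Proof.
move=> mD; split; last exact: bmfun_cst.
split; first exact: measurable_indic.
by exists 1 => x; rewrite indicE ger0_norm ?ler0n// lern1 leq_b1.
Qed.

Lemma bcmfun_exponential (l : R * R) : bounded_cmfun (@exponential R l).
Proof.
apply: bcmfun_cis; apply: measurableT_comp => //.
by apply: measurable_funM => //; apply: measurable_funD; apply: measurable_funM.
Qed.

Lemma exponential_fst (l : R * R) (x : R) :
  exponential l (x, 0) = cis (- (2 * pi * l.1 * x)).
Proof. by rewrite /exponential /dot2/= mulr0 addr0 mulrA. Qed.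

Lemma exponential_snd (l : R * R) (y : R) :
  exponential l (0, y) = cis (- (2 * pi * l.2 * y)).
Proof. by rewrite /exponential /dot2/= mulr0 add0r mulrA. Qed.

Lemma L2dot_rho (t1 t2 : R) (f g : plane -> R[i]) :
  bounded_cmfun f -> bounded_cmfun g ->
  L2dot (rho t1 t2) f g = (2^-1)%:C *
   (L2dot (lebesgue_segment t1 (t1 + 1)) (fun x => f (x, 0)) (fun x => g (x, 0)) +
    L2dot (lebesgue_segment t2 (t2 + 1)) (fun y => f (0, y)) (fun y => g (0, y))).
Proof.
move=> hf hg; have [h1 h2] := bcmfunM hf (bcmfunJ hg).
apply: complex_eqP; rewrite ?(ReM, ImM, ReD, ImD)/= mul0r ?subr0 ?addr0.
  exact: Rintegral_rho.
exact: Rintegral_rho.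
Qed.

(* [arm t s d] is the integral of [cis (- 2 pi d x)] over [[t, t + s]]. *)
Definition arm (t s d : R) : R[i] :=
  (s * sinc (s * d) * cos (2 * pi * d * (t + s / 2))) +i*
  (- (s * sinc (s * d) * sin (2 * pi * d * (t + s / 2)))).

Lemma nsq_arm (t s d : R) : nsq (arm t s d) = s ^+ 2 * sinc (s * d) ^+ 2.
Proof.
rewrite /nsq/= sqrrN !exprMn -mulrDr cos2Dsin2 mulr1//.
Qed.

Lemma arm0 (t s : R) : arm t s 0 = s%:C.
Proof.
by rewrite /arm !mulr0 sinc0 !mul0r cos0 sin0 mulr0 !mulr1 oppr0.
Qed.

Lemma L2dot_segment_cis (t x y : R) :
  L2dot (lebesgue_segment t (t + 1)) (fun z => cis (- (2 * pi * x * z)))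
    (fun z => cis (- (2 * pi * y * z))) = arm t 1 (x - y).
Proof.
have E z : - (2 * pi * x * z) - - (2 * pi * y * z) = - (2 * pi * (x - y) * z).
  by ring.
rewrite /L2dot /arm !mul1r; congr (_ +i* _).
  rewrite -Rintegral_segment_cos; apply: eq_Rintegral => z _.
  by rewrite cisB E /cis/= cosN.
rewrite -Rintegral_segment_sin -mulN1r -RintegralZl//.
  by apply: eq_Rintegral => z _; rewrite cisB E /cis/= sinN mulN1r.
apply: bmfun_integrable; split; first exact: measurable_sin_lin.
by exists 1 => z; exact: sin_max.
Qed.

Lemma L2dot_segment_indic (t s x y : R) : 0 < s <= 1 ->
  L2dot (lebesgue_segment t (t + 1))
    (fun z => (\1_(pitv t s) z)%:C * cis (- (2 * pi * x * z)))
    (fun z => cis (- (2 * pi * y * z))) = arm t s (x - y).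
Proof.
move=> s01; have s0 : 0 < s by case/andP: s01.
have E z : - (2 * pi * x * z) - - (2 * pi * y * z) = - (2 * pi * (x - y) * z).
  by ring.
rewrite /L2dot /arm; congr (_ +i* _).
  rewrite -(Rintegral_segment_indic s01 (measurable_cos_lin _)
    (integral_cos_itv _ _ s0)).
  apply: eq_Rintegral => z _.
  by rewrite -mulrA cisB E /cis ReM/= mul0r subr0 cosN.
rewrite -(Rintegral_segment_indic s01 (measurable_sin_lin _)
    (integral_sin_itv _ _ s0)) -mulN1r -RintegralZl//.
  apply: eq_Rintegral => z _.
  by rewrite -mulrA cisB E /cis ImM/= mul0r addr0 sinN mulN1r mulrN.
apply: bmfun_integrable; apply: bmfunM.
  by have [] := bcmfun_indic (measurable_pitv t s).
split; first exact: measurable_sin_lin.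
by exists 1 => z; exact: sin_max.
Qed.

Lemma L2dot_segment_indic2 (t s x : R) : 0 < s <= 1 ->
  L2dot (lebesgue_segment t (t + 1))
    (fun z => (\1_(pitv t s) z)%:C * cis (- (2 * pi * x * z)))
    (fun z => (\1_(pitv t s) z)%:C * cis (- (2 * pi * x * z))) = s%:C.
Proof.
move=> s01; rewrite -(arm0 t) -(subrr x) -L2dot_segment_indic//.
congr (_ +i* _); apply: eq_Rintegral => z _;
  rewrite !(ReM, ImM, ReJ, ImJ)/= indicE; case: (_ \in _); rewrite ?mul1r ?mul0r;
  ring.
Qed.

Lemma L2dot_zero d (T : measurableType d) (m : {measure set T -> \bar R})
    (f g : T -> R[i]) : (forall x, f x = 0) -> L2dot m f g = 0.
Proof.
move=> f0; apply: complex_eqP => /=; rewrite /Rintegral;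
  under eq_integral do rewrite f0 mul0r/=; by rewrite integral0.
Qed.

End SegmentIntegral.

(** * Necessity *)

Section Necessity.
Local Open Scope complex_scope.
Context (R : realType).
Local Notation plane := (measurableTypeR R * measurableTypeR R)%type.

(** Exponentials with integral frequency differences are orthonormal on [0, 1], and the coefficients
    of the exponential of frequency xi have modulus |sinc|. *)
Lemma bessel_int_translates (xi : R) (ks : seq R) : uniq ks ->
  {in ks &, forall x y, x - y \is a Num.int} ->
  \sum_(x <- ks) sinc (xi - x) ^+ 2 <= 1.
Proof.
move=> uks kint.
pose e (x : R) (z : measurableTypeR R) : R[i] := cis (- (2 * pi * x * z)).
have he x : bounded_cmfun (e x).
  have -> : e x = (fun z => cis ((- (2 * pi * x)) * z)).
    by apply/funext => z; rewrite /e mulNr.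
  by apply: bcmfun_cis; exact: mulrl_measurable.
have := @bessel_ineq _ _ _ (lebesgue_segment 0 (0 + 1)) _ e [set` ks] he _ _ ks
  (e xi) uks (fun _ h => h) (he xi).
rewrite !L2dot_segment_cis subrr arm0/= => h.
rewrite (le_trans _ (h _ _))//.
- apply: ler_sum => x _; rewrite L2dot_segment_cis nsq_arm.
  by rewrite expr1n !mul1r.
- by move=> x _; rewrite L2dot_segment_cis subrr arm0.
- move=> x y kx ky xy; rewrite L2dot_segment_cis /arm mul1r sinc_int.
  + by rewrite !mul0r oppr0.
  + by rewrite mul1r; exact: kint.
  + by rewrite mul1r subr_eq0.
Qed.

Section Spectrum.
Context (t1 t2 : R) (L : set (R * R)).
Hypothesis spL : is_spectrum (rho t1 t2) L.

Lemma L2dot_exponential (l m : R * R) :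
  L2dot (rho t1 t2) (exponential l) (exponential m) =
  (2^-1)%:C * (arm t1 1 (l.1 - m.1) + arm t2 1 (l.2 - m.2)).
Proof.
rewrite L2dot_rho; try exact: bcmfun_exponential.
rewrite -!L2dot_segment_cis.
by under [X in L2dot _ X _ + _]eq_fun do rewrite exponential_fst;
   under [X in L2dot _ _ X + _]eq_fun do rewrite exponential_fst;
   under [X in _ + L2dot _ X _]eq_fun do rewrite exponential_snd;
   under [X in _ + L2dot _ _ X]eq_fun do rewrite exponential_snd.
Qed.

Lemma exponential_normed (l : R * R) :
  L2dot (rho t1 t2) (exponential l) (exponential l) = 1.
Proof.
rewrite L2dot_exponential !subrr !arm0; apply: complex_eqP => /=; first by field.
by rewrite !(mulr0, mul0r, addr0).
Qed.

Lemma spectrum_orth (l m : R * R) : L l -> L m -> l != m ->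
  L2dot (rho t1 t2) (exponential l) (exponential m) = 0.
Proof. by have [_ [_ + _]] := spL; exact. Qed.

Lemma spectrum_orth_arm (l m : R * R) : L l -> L m -> l != m ->
  arm t1 1 (l.1 - m.1) + arm t2 1 (l.2 - m.2) = 0.
Proof.
move=> Ll Lm lm; have := spectrum_orth Ll Lm lm; rewrite L2dot_exponential.
move=> /eqP; rewrite mulf_eq0 => /orP[|/eqP//].
by rewrite eq_complex/= invr_eq0 pnatr_eq0.
Qed.

(** The function behind [bessel1] and [parseval1]: up to phase, its coefficients are (s / 2) sinc (s
    (x - l.1)). *)
Definition test1 (s x : R) (p : plane) : R[i] :=
  (\1_(pitv t1 s) p.1)%:C * exponential (x, 0) p.

Definition test2 (s x : R) (p : plane) : R[i] :=
  (\1_(pitv t2 s) p.2)%:C * exponential (0, x) p.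

Lemma bcmfun_test1 s x : bounded_cmfun (test1 s x).
Proof.
apply: bcmfunM; last exact: bcmfun_exponential.
have [[h1 [M hM]] _] := bcmfun_indic R (measurable_pitv t1 s).
split; last exact: bmfun_cst.
split; last by exists M => p; exact: hM.
exact: (measurableT_comp h1).
Qed.

Lemma bcmfun_test2 s x : bounded_cmfun (test2 s x).
Proof.
apply: bcmfunM; last exact: bcmfun_exponential.
have [[h1 [M hM]] _] := bcmfun_indic R (measurable_pitv t2 s).
split; last exact: bmfun_cst.
split; last by exists M => p; exact: hM.
exact: (measurableT_comp h1).
Qed.

Lemma pitv0 (t s : R) : (\1_(pitv t s) (0 : R))%:C = 0 :> R[i].
Proof. by rewrite indicE memNset// => -[_]; apply. Qed.

Lemma L2dot_test1 (s x : R) (l : R * R) : 0 < s <= 1 ->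
  L2dot (rho t1 t2) (test1 s x) (exponential l) = (2^-1)%:C * arm t1 s (x - l.1).
Proof.
move=> s01; rewrite L2dot_rho; [|exact: bcmfun_test1|exact: bcmfun_exponential].
rewrite [X in _ + X]L2dot_zero ?addr0; last first.
  by move=> y; rewrite /test1/= pitv0 mul0r.
rewrite -L2dot_segment_indic//.
by under [X in L2dot _ X _]eq_fun do rewrite /test1 exponential_fst;
   under [X in L2dot _ _ X]eq_fun do rewrite exponential_fst.
Qed.

Lemma L2dot_test2 (s x : R) (l : R * R) : 0 < s <= 1 ->
  L2dot (rho t1 t2) (test2 s x) (exponential l) = (2^-1)%:C * arm t2 s (x - l.2).
Proof.
move=> s01; rewrite L2dot_rho; [|exact: bcmfun_test2|exact: bcmfun_exponential].
rewrite [X in X + _]L2dot_zero ?add0r; last first.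
  by move=> y; rewrite /test2/= pitv0 mul0r.
rewrite -L2dot_segment_indic//.
by under [X in L2dot _ X _]eq_fun do rewrite /test2 exponential_snd;
   under [X in L2dot _ _ X]eq_fun do rewrite exponential_snd.
Qed.

Lemma Re_L2dot_test1 (s x : R) : 0 < s <= 1 ->
  complex.Re (L2dot (rho t1 t2) (test1 s x) (test1 s x)) = s / 2.
Proof.
move=> s01; rewrite L2dot_rho; try exact: bcmfun_test1.
rewrite [X in _ + X]L2dot_zero ?addr0; last first.
  by move=> y; rewrite /test1/= pitv0 mul0r.
rewrite (_ : L2dot _ _ _ = s%:C); first by rewrite /= mul0r subr0 mulrC.
rewrite -(L2dot_segment_indic2 t1 x s01); congr L2dot;
  by apply/funext => z; rewrite /test1 exponential_fst.
Qed.

Lemma Re_L2dot_test2 (s x : R) : 0 < s <= 1 ->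
  complex.Re (L2dot (rho t1 t2) (test2 s x) (test2 s x)) = s / 2.
Proof.
move=> s01; rewrite L2dot_rho; try exact: bcmfun_test2.
rewrite [X in X + _]L2dot_zero ?add0r; last first.
  by move=> y; rewrite /test2/= pitv0 mul0r.
rewrite (_ : L2dot _ _ _ = s%:C); first by rewrite /= mul0r subr0 mulrC.
rewrite -(L2dot_segment_indic2 t2 x s01); congr L2dot;
  by apply/funext => z; rewrite /test2 exponential_snd.
Qed.

Lemma nsq_half (c : R[i]) : nsq ((2^-1)%:C * c) = nsq c / 4.
Proof. by rewrite /nsq ReM ImM/= !mul0r subr0 addr0; field. Qed.

Lemma bessel_scale (s S : R) : 0 < s -> s ^+ 2 / 4 * S <= s / 2 -> S <= 2 / s.
Proof.
move=> s0 h; rewrite ler_pdivlMr// -(ler_pM2l (_ : 0 < s / 4)); last first.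
  by rewrite divr_gt0.
apply: le_trans (_ : s / 2 <= _); last lra.
by apply: le_trans h; rewrite le_eqVlt; apply/orP; left; apply/eqP; field.
Qed.

(** Abstract [f] and [pr] serve both arms. Squared coefficients are s ^ 2 / 4 times sinc ^ 2 and the
    squared norm is s / 2, hence the bound 2 / s. *)
Lemma spectrum_bessel (f : R -> R -> plane -> R[i]) (pr : R * R -> R) (t : R)
    (s xi : R) (F : seq (R * R)) :
  (forall s x, bounded_cmfun (f s x)) ->
  (forall s x l, 0 < s <= 1 -> L2dot (rho t1 t2) (f s x) (exponential l) =
     (2^-1)%:C * arm t s (x - pr l)) ->
  (forall s x, 0 < s <= 1 ->
    complex.Re (L2dot (rho t1 t2) (f s x) (f s x)) = s / 2) ->
  0 < s <= 1 -> uniq F -> {in F, forall l, L l} ->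
  \sum_(l <- F) sinc (s * (xi - pr l)) ^+ 2 <= 2 / s.
Proof.
move=> hf fe ff s01 uF FL; have s0 : 0 < s by case/andP: s01.
have := bessel_ineq (mu := rho t1 t2) (@bcmfun_exponential R)
  (fun l _ => exponential_normed l) spectrum_orth uF FL (hf s xi).
rewrite ff// => h; apply: bessel_scale => //; rewrite mulr_sumr.
apply: le_trans h; rewrite le_eqVlt; apply/orP; left; apply/eqP.
by apply: eq_bigr => l _; rewrite fe// nsq_half nsq_arm mulrAC.
Qed.

Lemma spectrum_parseval (f : R -> R -> plane -> R[i]) (pr : R * R -> R) (t : R)
    (s xi e : R) :
  (forall s x, bounded_cmfun (f s x)) ->
  (forall s x l, 0 < s <= 1 -> L2dot (rho t1 t2) (f s x) (exponential l) =
     (2^-1)%:C * arm t s (x - pr l)) ->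
  (forall s x, 0 < s <= 1 ->
    complex.Re (L2dot (rho t1 t2) (f s x) (f s x)) = s / 2) ->
  0 < s <= 1 -> 0 < e -> exists F,
  [/\ uniq F, {in F, forall l, L l} &
      2 / s - e <= \sum_(l <- F) sinc (s * (xi - pr l)) ^+ 2].
Proof.
move=> hf fe ff s01 e0; have s0 : 0 < s by case/andP: s01.
have e0' : 0 < s ^+ 2 / 4 * e by rewrite mulr_gt0// divr_gt0// exprn_gt0.
have [_ [_ _ dense]] := spL.
have fL2 : L2 (rho t1 t2) (f s xi) by exact: (bcmfun_L2 (rho t1 t2) (hf s xi)).
have [F [uF FL h]] := parseval_ineq (mu := rho t1 t2) (@bcmfun_exponential R)
  (fun l _ => exponential_normed l) spectrum_orth e0' (hf s xi) (dense _ fL2).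
exists F; split => //; move: h; rewrite ff//.
rewrite (_ : \sum_(l <- F) nsq _ =
    s ^+ 2 / 4 * \sum_(l <- F) sinc (s * (xi - pr l)) ^+ 2); last first.
  rewrite mulr_sumr; apply: eq_bigr => l _.
  by rewrite fe// nsq_half nsq_arm mulrAC.
move: (\sum_(l <- F) _) => S h.
have s4 : 0 < s ^+ 2 / 4 by rewrite divr_gt0// exprn_gt0.
rewrite -(ler_pM2l s4) (le_trans _ h)// le_eqVlt; apply/orP; left; apply/eqP.
by field; rewrite gt_eqF.
Qed.

Lemma spectral_offset : exists c : R, [/\ c ^+ 2 = 1,
  t1 + 2^-1 - (t2 + 2^-1) * c \is a Num.int &
  t1 + 2^-1 - (t2 + 2^-1) * c != 0].
Proof.
have armE t d : arm t 1 d =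
    (sinc d * cos (2 * pi * ((t + 2^-1) * d))) +i*
    (- (sinc d * sin (2 * pi * ((t + 2^-1) * d)))).
  by rewrite /arm !mul1r -!mulrA (mulrC d).
apply: (@spectrum_offset R (t1 + 2^-1) (t2 + 2^-1) L).
- move=> l m Ll Lm lm; have := spectrum_orth_arm Ll Lm lm.
  by rewrite !armE => -[].
- move=> l m Ll Lm lm; have := spectrum_orth_arm Ll Lm lm.
  by rewrite !armE => -[_ /eqP]; rewrite -opprD oppr_eq0 => /eqP.
- by move=> s xi F; apply: (spectrum_bessel _ bcmfun_test1 L2dot_test1 Re_L2dot_test1).
- by move=> s xi F; apply: (spectrum_bessel _ bcmfun_test2 L2dot_test2 Re_L2dot_test2).
- by move=> s xi e; apply: (spectrum_parseval _ bcmfun_test1 L2dot_test1 Re_L2dot_test1).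
- by move=> s xi e; apply: (spectrum_parseval _ bcmfun_test2 L2dot_test2 Re_L2dot_test2).
- exact: bessel_int_translates.
Qed.

End Spectrum.

(** For c = -1 the offset of the centres is t1 + t2 + 1, which explains the excluded value -1. *)
Lemma spectral_necessary (t1 t2 : R) : spectral_measure (rho t1 t2) ->
  (t1 + t2 \is a Num.int /\ t1 + t2 <> -1) \/
  (t1 - t2 \is a Num.int /\ t1 - t2 <> 0).
Proof.
move=> [L /spectral_offset[c [/eqP]]]; rewrite sqrf_eq1 => /orP[]/eqP-> ci c0.
  have E : t1 + 2^-1 - (t2 + 2^-1) * 1 = t1 - t2 by ring.
  by right; rewrite -E; split => //; exact/eqP.
have E : t1 + 2^-1 - (t2 + 2^-1) * -1 = t1 + t2 + 1 by field.
rewrite E in ci c0; left; split; last by move=> e; rewrite e addNr eqxx in c0.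
by rewrite -(addrK 1 (t1 + t2)) rpredB// rpred1.
Qed.

End Necessity.

(** * Measurable complex functions *)

Section ComplexMeasurable.
Local Open Scope complex_scope.
Context d (T : measurableType d) (R : realType).
Implicit Types (f g : T -> R[i]) (c : R[i]).

Definition cmeasurable f :=
  measurable_fun setT (fun x => complex.Re (f x)) /\
  measurable_fun setT (fun x => complex.Im (f x)).

Lemma measurable_nsq f : cmeasurable f ->
  measurable_fun setT (fun x => (nsq (f x))%:E).
Proof.
move=> [mr mi]; apply/measurable_EFinP.
by apply: measurable_funD; exact: measurable_funX.
Qed.

Lemma cmeasurableD f g : cmeasurable f -> cmeasurable g ->
  cmeasurable (fun x => f x + g x).
Proof.
move=> [fr fi] [gr gi]; split.
  by under eq_fun do rewrite ReD; exact: measurable_funD.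
by under eq_fun do rewrite ImD; exact: measurable_funD.
Qed.

Lemma cmeasurableM f g : cmeasurable f -> cmeasurable g ->
  cmeasurable (fun x => f x * g x).
Proof.
move=> [fr fi] [gr gi]; split.
  under eq_fun do rewrite ReM.
  by apply: measurable_funB; exact: measurable_funM.
under eq_fun do rewrite ImM.
by apply: measurable_funD; exact: measurable_funM.
Qed.

Lemma cmeasurable_cst c : cmeasurable (fun=> c).
Proof. by split; exact: measurable_cst. Qed.

Lemma cmeasurableN f : cmeasurable f -> cmeasurable (fun x => - f x).
Proof.
move=> mf; have -> : (fun x => - f x) = (fun x => -1 * f x).
  by apply/funext => x; rewrite mulN1r.
by apply: cmeasurableM => //; exact: cmeasurable_cst.
Qed.

Lemma cmeasurableB f g : cmeasurable f -> cmeasurable g ->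
  cmeasurable (fun x => f x - g x).
Proof. by move=> mf mg; apply: cmeasurableD => //; exact: cmeasurableN. Qed.

End ComplexMeasurable.

(** * Density of trigonometric polynomials *)

Section TrigonometricDensity.
Local Open Scope complex_scope.
Context (R : realType) (t : R).
Local Notation mu := (@lebesgue_measure R).
Local Notation cmeasurable := (@cmeasurable _ (measurableTypeR R) R).
Local Notation D := (`]t, (t + 1)%R[%classic : set R).
Implicit Types (f g h : R -> R[i]) (c : R[i]).

Lemma cmeasurable_cis (k : R) : cmeasurable (fun x => cis (k * x)).
Proof. by split; [exact: measurable_cos_lin|exact: measurable_sin_lin]. Qed.

Definition trig h := exists s : seq (R[i] * int),
  h = fun x => \sum_(q <- s) q.1 * cis (2 * pi * q.2%:~R * x).

Lemma cisD (x y : R) : cis x * cis y = cis (x + y).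
Proof. by apply: complex_eqP; rewrite ?(ReM, ImM)/= ?sinD ?cosD; ring. Qed.

Lemma cis0 : cis 0 = 1 :> R[i].
Proof. by rewrite /cis cos0 sin0. Qed.

Lemma trigD f g : trig f -> trig g -> trig (fun x => f x + g x).
Proof.
by move=> [s ->] [s' ->]; exists (s ++ s'); apply/funext => x; rewrite big_cat.
Qed.

Lemma trigM f g : trig f -> trig g -> trig (fun x => f x * g x).
Proof.
move=> [s ->] [s' ->].
exists [seq (p.1 * q.1, (p.2 + q.2)%R) | p <- s, q <- s'].
apply/funext => x; rewrite big_allpairs_dep/= mulr_suml; apply: eq_bigr => p _.
rewrite mulr_sumr; apply: eq_bigr => q _; rewrite mulrACA cisD.
by congr (_ * cis _); rewrite intrD; ring.
Qed.

Lemma trig_cst c : trig (fun=> c).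
Proof.
exists [:: (c, 0)]; apply/funext => x.
by rewrite big_seq1/= mulr0 mul0r cis0 mulr1.
Qed.

Lemma trigX f n : trig f -> trig (fun x => f x ^+ n).
Proof.
move=> tf; elim: n => [|n IH]; first by under eq_fun do rewrite expr0; exact: trig_cst.
by under eq_fun do rewrite exprS; exact: trigM.
Qed.

Lemma trig_cos (a : R) : trig (fun x => (cos (2 * pi * (x - a)))%:C).
Proof.
exists [:: (2^-1 * cis (- (2 * pi * a)), 1); (2^-1 * cis (2 * pi * a), -1)].
apply/funext => x; rewrite big_cons big_seq1/= mulr1z mulrN1z.
rewrite -!(mulrA (2^-1 : R[i])) !cisD.
have -> : - (2 * pi * a) + 2 * pi * 1 * x = 2 * pi * (x - a) by ring.
have -> : 2 * pi * a + 2 * pi * -1 * x = - (2 * pi * (x - a)) by ring.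
rewrite -mulrDr; apply: (mulfI (_ : 2 != 0 :> R[i])); first by rewrite pnatr_eq0.
rewrite mulrA divff ?pnatr_eq0// mul1r mulr_natl mulr2n.
by apply: complex_eqP; rewrite ?(ReD, ImD)/= ?sinN ?cosN; ring.
Qed.

Lemma cmeasurable_trig f : trig f -> cmeasurable f.
Proof.
move=> [s ->]; elim: s => [|q s IH].
  by under eq_fun do rewrite big_nil; exact: cmeasurable_cst.
under eq_fun do rewrite big_cons.
apply: cmeasurableD => //; apply: cmeasurableM; first exact: cmeasurable_cst.
exact: cmeasurable_cis.
Qed.

(** The period is open because at the endpoint t the arc that replaces a ray in [approximable_ray]
    gives the wrong value. *)
Definition sqnorm f : \bar R := (\int[mu]_(x in D) (nsq (f x))%:E)%E.

Lemma measurable_period : measurable D. Proof. exact: measurable_itv. Qed.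

Lemma nsqM c c' : nsq (c * c') = nsq c * nsq c' :> R.
Proof. by rewrite /nsq ReM ImM; ring. Qed.

(** A triangle inequality at the level of squares; its factor 2 is why errors below are split into
    quarters. *)
Lemma nsqD_le c c' : nsq (c + c') <= 2 * nsq c + 2 * nsq c' :> R.
Proof.
rewrite /nsq ReD ImD; have := sqr_ge0 (complex.Re c - complex.Re c').
have := sqr_ge0 (complex.Im c - complex.Im c'); nra.
Qed.

Lemma sqnormD f g : cmeasurable f -> cmeasurable g ->
  (sqnorm (fun x => f x + g x)%R <= 2%:E * sqnorm f + 2%:E * sqnorm g)%E.
Proof.
move=> mf mg.
have m1 := measurable_funS measurableT (@subsetT _ D) (measurable_nsq mf).
have m2 := measurable_funS measurableT (@subsetT _ D) (measurable_nsq mg).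
rewrite -!ge0_integralZl//; try exact: measurable_period; try by move=> x _; rewrite lee_fin nsq_ge0.
rewrite -ge0_integralD//; try exact: measurable_period;
  try (by move=> x _; rewrite mule_ge0// lee_fin nsq_ge0);
  try exact: measurable_funeM.
apply: ge0_le_integral => //.
- by move=> x _; rewrite lee_fin nsq_ge0.
- apply: (measurable_funS measurableT) => //.
  by apply: measurable_nsq; exact: cmeasurableD.
- by apply: emeasurable_funD; exact: measurable_funeM.
- by move=> x _; rewrite -!EFinM -EFinD lee_fin nsqD_le.
Qed.

Definition approximable f := cmeasurable f /\
  forall e : R, 0 < e -> exists p, trig p /\ (sqnorm (fun x => f x - p x)%R < e%:E)%E.

Lemma approximable_trig f : trig f -> approximable f.
Proof.
move=> tf; split=> [|e e0]; first exact: cmeasurable_trig.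
exists f; split => //; rewrite /sqnorm integral0_eq ?lte_fin// => x _.
by rewrite subrr /nsq/= expr0n addr0.
Qed.

Lemma approximable_of_close f : cmeasurable f ->
  (forall e : R, 0 < e -> exists g, approximable g /\
    (sqnorm (fun x => f x - g x)%R < e%:E)%E) -> approximable f.
Proof.
move=> mf h; split => // e e0; have e4 : 0 < e / 4 by rewrite divr_gt0.
have [g [[mg hg] fg]] := h _ e4; have [p [tp gp]] := hg _ e4.
exists p; split => //; have mp := cmeasurable_trig tp.
have -> : (fun x => f x - p x) = (fun x => (f x - g x) + (g x - p x)).
  by apply/funext => x; rewrite addrA subrK.
apply: le_lt_trans (sqnormD (cmeasurableB mf mg) (cmeasurableB mg mp)) _.
rewrite (_ : e%:E = 2%:E * (e / 4)%:E + 2%:E * (e / 4)%:E)%E.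
  by apply: lteD; rewrite lte_pmul2l.
by rewrite -!EFinM -EFinD; congr EFin; field.
Qed.

Lemma approximableD f g : approximable f -> approximable g ->
  approximable (fun x => f x + g x).
Proof.
move=> [mf hf] [mg hg]; split=> [|e e0]; first exact: cmeasurableD.
have e4 : 0 < e / 4 by rewrite divr_gt0.
have [p [tp fp]] := hf _ e4; have [q [tq gq]] := hg _ e4.
exists (fun x => p x + q x); split; first exact: trigD.
have -> : (fun x => f x + g x - (p x + q x)) =
          (fun x => (f x - p x) + (g x - q x)).
  by apply/funext => x; ring.
have mp := cmeasurable_trig tp; have mq := cmeasurable_trig tq.
apply: le_lt_trans (sqnormD (cmeasurableB mf mp) (cmeasurableB mg mq)) _.
rewrite (_ : e%:E = 2%:E * (e / 4)%:E + 2%:E * (e / 4)%:E)%E.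
  by apply: lteD; rewrite lte_pmul2l.
by rewrite -!EFinM -EFinD; congr EFin; field.
Qed.

Lemma approximableZ c f : approximable f -> approximable (fun x => c * f x).
Proof.
move=> [mf hf]; split=> [|e e0].
  by apply: cmeasurableM => //; exact: cmeasurable_cst.
have c0 : 0 < nsq c + 1 by rewrite ltr_wpDl// nsq_ge0.
have [p [tp fp]] := hf (e / (nsq c + 1)) (divr_gt0 e0 c0).
exists (fun x => c * p x); split; first by apply: trigM => //; exact: trig_cst.
have mfp := cmeasurableB mf (cmeasurable_trig tp).
rewrite /sqnorm; under eq_integral do rewrite -mulrBr nsqM EFinM.
have mm := measurable_funS measurableT (@subsetT _ D) (measurable_nsq mfp).
rewrite ge0_integralZl//; try (by move=> x _; rewrite lee_fin nsq_ge0);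
  try (by rewrite lee_fin nsq_ge0).
have fin : sqnorm (fun x => f x - p x) \is a fin_num.
  rewrite ge0_fin_numE; first by rewrite (lt_trans fp)// ltry.
  by apply: integral_ge0 => x _; rewrite lee_fin nsq_ge0.
move: fp; rewrite -/(sqnorm _) -(fineK fin) -EFinM !lte_fin ltr_pdivlMr//.
apply: le_lt_trans; rewrite mulrC ler_wpM2l ?lerDl//.
by apply: fine_ge0; apply: integral_ge0 => x _; rewrite lee_fin nsq_ge0.
Qed.

Lemma approximable_lim f (g : nat -> R -> R[i]) (G : R -> R) :
  cmeasurable f -> (forall n, approximable (g n)) ->
  mu.-integrable D (EFin \o G) ->
  (forall n x, D x -> nsq (f x - g n x) <= G x) ->
  (forall x, D x -> nsq (f x - g n x) @[n --> \oo] --> (0 : R)) ->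
  approximable f.
Proof.
move=> mf ag iG fgG cv; apply: approximable_of_close => // e e0.
have : (fun n => sqnorm (fun x => f x - g n x)) @ \oo -->
    (\int[mu]_(x in D) (0 : R)%:E)%E.
  apply: (@dominated_cvg _ _ _ mu D measurable_period _ _ (EFin \o G)) => //.
  - move=> n; apply: (measurable_funS measurableT) => //.
    by apply: measurable_nsq; apply: cmeasurableB => //; exact: (ag n).1.
  - by move=> x Dx; apply: cvg_EFin; [exact: nearW|exact: cv].
  - by move=> n x Dx; rewrite /= ger0_norm ?nsq_ge0// lee_fin fgG.
rewrite integral0 => cv0.
have /fine_cvgP[fin /cvgr_lt/(_ e e0) lt] := cv0.
have [n [/= fn ltn]] := filter_ex (filterI fin lt).
by exists (g n); split => //; rewrite -(fineK fn) lte_fin.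
Qed.

Lemma bernoulli_ineq (x : R) n : -1 <= x -> 1 + x *+ n <= (1 + x) ^+ n.
Proof.
move=> x1; elim: n => [|n IH]; first by rewrite mulr0n addr0 expr0.
rewrite exprS; apply: (@le_trans _ _ ((1 + x) * (1 + x *+ n))); last first.
  by apply: ler_wpM2l => //; rewrite -lerBlDl sub0r.
rewrite -[x *+ n]mulr_natr mulrSr -[x *+ n]mulr_natr.
have := sqr_ge0 x; have := ler0n R n; move: (n%:R) => y y0 xx; nra.
Qed.

Lemma cvg_natr_expr (r : R) : 0 <= r < 1 -> n%:R * r ^+ n @[n --> \oo] --> (0 : R).
Proof.
(* By the inequality of means r <= s ^ 2. One factor s ^ n absorbs n by Bernoulli, the other tends
   to 0. *)
move=> /andP[r0 r1]; pose s := (1 + r) / 2.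
have s0 : 0 < s by rewrite divr_gt0// ltr_pwDl.
have s1 : s < 1 by rewrite /s; lra.
have rs : r <= s ^+ 2 by rewrite /s; have := sqr_ge0 (1 - r); nra.
pose h := s^-1 - 1; have h0 : 0 < h by rewrite subr_gt0 invf_gt1.
have hE : 1 + h = s^-1 by rewrite /h addrC subrK.
have bound n : 0 <= n%:R * r ^+ n <= h^-1 * s ^+ n.
  rewrite mulr_ge0 ?exprn_ge0//=.
  apply: (@le_trans _ _ (n%:R * (s ^+ n * s ^+ n))).
    apply: ler_wpM2l => //; have ss0 : 0 <= s * s by rewrite mulr_ge0// ltW.
    by rewrite -exprMn lerXn2r.
  rewrite mulrA; apply: ler_wpM2r; first by rewrite exprn_ge0// ltW.
  rewrite -[h^-1]mul1r ler_pdivlMr//.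
  have : 1 + h *+ n <= (1 + h) ^+ n by apply: bernoulli_ineq; lra.
  rewrite hE exprVn -[h *+ n]mulr_natr => b.
  have sn : 0 < s ^+ n by rewrite exprn_gt0.
  have nh : n%:R * h <= s ^- n by apply: le_trans b; rewrite mulrC lerDr.
  have := ler_wpM2r (ltW sn) nh.
  by rewrite mulVf ?gt_eqF// ?mul1r mulrAC.
apply: (@squeeze_cvgr _ _ _ _ (cst 0) (fun n => h^-1 * s ^+ n)).
- by apply: nearW => n; exact: bound.
- exact: cvg_cst.
- rewrite -[X in _ --> X](mulr0 h^-1); apply: cvgMr.
  by apply: cvg_expr; rewrite ger0_norm// ltW.
Qed.

(* The polynomials of the elementary proof of the Stone-Weierstrass theorem;
   the factor [n] forces the limit 0 at the threshold itself. *)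
Definition step n (q : R) : R := (1 - q ^+ n) ^+ (n * 2 ^ n).

Lemma step_itv n (q : R) : 0 <= q <= 1 -> 0 <= step n q <= 1.
Proof.
move=> /andP[q0 q1]; have h : 0 <= 1 - q ^+ n <= 1.
  by rewrite subr_ge0 exprn_ile1//= gerBl exprn_ge0.
by case/andP: h => h0 h1; rewrite exprn_ge0//= exprn_ile1.
Qed.

(** Below 1/2, Bernoulli gives the lower bound 1 - n (2 q) ^ n. From 1/2 on, (1 - y) (1 + y) <= 1
    with y = q ^ n bounds the value by 1 / (1 + n (2 q) ^ n), at most 1 / (n + 1). *)
Lemma step_cvg (q : R) : 0 <= q <= 1 ->
  (fun n => step n q) @ \oo --> ((q < 1 / 2)%R%:R : R).
Proof.
move=> q01; have /andP[q0 q1] := q01; have [q2|q2] := ltP q (1 / 2).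
  apply: (@squeeze_cvgr _ _ _ _ (fun n => 1 - n%:R * (2 * q) ^+ n) (cst 1)).
  - apply: nearW => n; have /andP[_ ->] := step_itv n q01; rewrite andbT.
    have : 1 + (- q ^+ n) *+ (n * 2 ^ n) <= step n q.
      by apply: bernoulli_ineq; rewrite lerN2 exprn_ile1.
    apply: le_trans; rewrite lerD2l mulNrn lerN2 -[_ *+ (n * _)]mulr_natr natrM natrX exprMn.
    by rewrite le_eqVlt; apply/orP; left; apply/eqP; ring.
  - rewrite -[X in _ --> X]subr0; apply: cvgB; first exact: cvg_cst.
    by apply: cvg_natr_expr; lra.
  - exact: cvg_cst.
apply: (@squeeze_cvgr _ _ _ _ (cst 0) harmonic).
- apply: nearW => n; have /andP[-> _] := step_itv n q01 => /=.
  have y0 : 0 <= q ^+ n <= 1 by rewrite exprn_ge0//= exprn_ile1.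
  have y1 : 1 + (q ^+ n) *+ (n * 2 ^ n) <= (1 + q ^+ n) ^+ (n * 2 ^ n).
    by apply: bernoulli_ineq; lra.
  have y2 : n%:R + 1 <= 1 + (q ^+ n) *+ (n * 2 ^ n).
    rewrite addrC lerD2l -[_ *+ (n * _)]mulr_natr natrM natrX mulrCA ler_peMr//.
    by rewrite -exprMn exprn_ege1//; lra.
  rewrite /harmonic/= -natr1 -[leRHS]mul1r ler_pdivlMr ?ltr_wpDl//.
  apply: (@le_trans _ _ (step n q * (1 + q ^+ n) ^+ (n * 2 ^ n))).
    apply: ler_wpM2l; last exact: (le_trans y2).
    by have /andP[] := step_itv n q01.
  rewrite /step -exprMn exprn_ile1//; move: (q ^+ n) y0 => y /andP[y0' y1']; nra.
- exact: cvg_cst.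
- exact: cvg_harmonic.
Qed.

Lemma nsq_realB (x y : R) : nsq (x%:C - y%:C) = (x - y) ^+ 2.
Proof. by rewrite /nsq/= subr0 expr0n addr0. Qed.

Lemma cmeasurable_real (u : R -> R) : measurable_fun setT u ->
  cmeasurable (fun x => (u x)%:C).
Proof. by move=> mu; split => //=; exact: measurable_cst. Qed.

Lemma integrable_cst (r : R) : mu.-integrable D (EFin \o fun=> r).
Proof.
apply: measurable_bounded_integrable => //.
- by rewrite /= lebesgue_measure_itv/=; case: ifPn => _; rewrite -?EFinB ltry.
- exists `|r|; split; first exact: num_real.
  by move=> y ry x _; exact: ltW.
Qed.

Lemma approximable_lim1 (u : R -> R) (g : nat -> R -> R) :
  measurable_fun setT u -> (forall x, 0 <= u x <= 1) ->
  (forall n x, 0 <= g n x <= 1) ->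
  (forall n, approximable (fun x => (g n x)%:C)) ->
  (forall x, g n x @[n --> \oo] --> u x) ->
  approximable (fun x => (u x)%:C).
Proof.
move=> mu_ u01 g01 ag gu.
apply: (@approximable_lim _ (fun n x => (g n x)%:C) (fun=> 1)) => //.
- exact: integrable_cst.
- move=> n x _; rewrite nsq_realB -real_normK ?num_real// expr_le1// ler_norml.
  by have := u01 x; have := g01 n x; lra.
- move=> x _; under eq_fun do rewrite nsq_realB.
  rewrite (_ : 0 = (u x - u x) * (u x - u x)); last by rewrite subrr mul0r.
  by apply: cvgM; apply: cvgB => //; exact: cvg_cst.
Qed.

(** The affine function q of the cosine has values in [0, 1] and lies below 1/2 exactly on the arc,
    and [step n] of it is again a trigonometric polynomial. *)
Lemma approximable_arc (a w : R) : -1 <= w <= 1 ->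
  approximable (fun x => ((w < cos (2 * pi * (x - a)))%R%:R)%:C).
Proof.
move=> w1; pose q (x : R) := (w - cos (2 * pi * (x - a))) / 4 + 1 / 2.
have q01 x : 0 <= q x <= 1.
  have := cos_geN1 (2 * pi * (x - a)); have := cos_le1 (2 * pi * (x - a)).
  by rewrite /q; lra.
have qw x : (w < cos (2 * pi * (x - a))) = (q x < 1 / 2).
  by rewrite /q; apply/idP/idP; lra.
have mcos : measurable_fun setT (fun x : R => cos (2 * pi * (x - a))).
  by have [] := cmeasurable_trig (trig_cos a).
have tq : trig (fun x => (q x)%:C).
  have -> : (fun x => (q x)%:C) = (fun x => (w / 4 + 1 / 2)%:C +
      (- 4^-1)%:C * (cos (2 * pi * (x - a)))%:C).
    apply/funext => x; rewrite -rmorphM -rmorphD; congr (_%:C).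
    by rewrite /q; field.
  apply: trigD; first exact: trig_cst.
  by apply: trigM; [exact: trig_cst|exact: trig_cos].
apply: (@approximable_lim1 _ (fun n x => step n (q x))).
- apply: (@measurableT_comp _ _ _ _ _ _ (fun b : bool => b%:R : R)) => //.
  by apply: measurable_fun_ltr => //; exact: measurable_cst.
- by move=> x; rewrite ler0n lern1 leq_b1.
- by move=> n x; exact: step_itv.
- move=> n; apply: approximable_trig.
  have -> : (fun x => (step n (q x))%:C) =
      (fun x => (1%:C + (-1)%:C * (q x)%:C ^+ n) ^+ (n * 2 ^ n)).
    apply/funext => x; rewrite -rmorphXn -rmorphM -rmorphD -rmorphXn mulN1r.
    by [].
  apply: trigX; apply: trigD; first exact: trig_cst.
  by apply: trigM; [exact: trig_cst|exact: trigX].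
- by move=> x; rewrite qw; exact: step_cvg.
Qed.

(** * From arcs to square integrable functions *)

Lemma approximable_eq f g : cmeasurable g -> {in D, f =1 g} ->
  approximable f -> approximable g.
Proof.
move=> mg fg [_ hf]; split => // e e0; have [p [tp fp]] := hf e e0.
exists p; split => //; apply: le_lt_trans fp; rewrite le_eqVlt; apply/orP; left.
by apply/eqP; apply: eq_integral => x xD; rewrite fg.
Qed.

Lemma indic01 (A : set R) x : 0 <= (\1_A x : R) <= 1.
Proof. by rewrite indicE ler0n lern1 leq_b1. Qed.

Lemma approximable_ray (a : R) :
  approximable (fun x => (\1_(`]-oo, a[%classic : set R) x)%:C).
Proof.
have mray : measurable (`]-oo, a[%classic : set R) by exact: measurable_itv.
have mi : cmeasurable (fun x => (\1_(`]-oo, a[%classic : set R) x)%:C).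
  by apply: cmeasurable_real; exact: measurable_indic.
have inray x : (\1_(`]-oo, a[%classic : set R) x)%:C = (x < a)%R%:R%:C :> R[i].
  by rewrite indicE; congr ((nat_of_bool _)%:R%:C); apply/idP/idP; rewrite inE/= in_itv.
have [at_|ta] := leP a t.
  apply: (approximable_eq mi _ (approximable_trig (trig_cst 0))) => x.
  rewrite inE/= in_itv/= => /andP[tx _].
  by rewrite inray ltNge (ltW (le_lt_trans at_ tx)).
have [ta1|at1] := leP (t + 1) a.
  apply: (approximable_eq mi _ (approximable_trig (trig_cst 1))) => x.
  rewrite inE/= in_itv/= => /andP[_ xt].
  by rewrite inray (lt_le_trans xt ta1).
(* Within the period the ray is the arc with centre c and half-width w. *)
pose c := (t + a) / 2; pose w := (a - t) / 2.
have pi0 := @pi_gt0 R.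
apply: (approximable_eq mi _ (@approximable_arc c (cos (2 * pi * w)) _)).
  move=> x; rewrite inE/= in_itv/= => /andP[tx xt]; rewrite inray; congr ((nat_of_bool _)%:R%:C).
  have w0 : 0 < w by rewrite divr_gt0// subr_gt0.
  have w2 : w < 1 / 2 by rewrite /w; lra.
  have ax : (x < a) = (`|x - c| < w).
    by rewrite ltr_norml /c /w; apply/idP/idP; lra.
  rewrite ax; have xc : x - c < 1 - w by rewrite /c /w; lra.
  have cx : - w < x - c by rewrite /c /w; lra.
  have piw : 0 <= 2 * pi * w <= pi by apply/andP; split; nra.
  have [h|h] := leP `|x - c| (1 / 2).
    have -> : cos (2 * pi * (x - c)) = cos (2 * pi * `|x - c|).
      by rewrite -(cos_norm (2 * pi * (x - c))) normrM gtr0_norm ?mulr_gt0.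
    rewrite ltr_cos ?in_itv//=; first by rewrite ltr_pM2l ?mulr_gt0.
    have := normr_ge0 (x - c) => h0.
    by apply/andP; split; [rewrite mulr_ge0// mulr_ge0// ltW|nra].
  (* Beyond half a period, periodicity and evenness replace x - c by 1 - (x - c), which is still
     larger than w. *)
  have xcp : 1 / 2 < x - c.
    by move: h; rewrite ltr_normr => /orP[//|]; lra.
  have -> : (`|x - c| < w) = false.
    by apply/negbTE; rewrite -leNgt ler_normr; apply/orP; left; lra.
  apply/negbTE; rewrite -leNgt.
  have -> : cos (2 * pi * (x - c)) = cos (2 * pi * (1 - (x - c))).
    rewrite -[RHS]cosN -[RHS]cosD2pi; congr cos.
    by rewrite -mulr_natl; ring.
  rewrite leNgt ltr_cos ?in_itv//=; first by rewrite -leNgt ler_pM2l ?mulr_gt0//; lra.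
  by apply/andP; split; nra.
by rewrite cos_geN1 cos_le1.
Qed.

Lemma approximable_sum (I : Type) (s : seq I) (F : I -> R -> R[i]) :
  (forall i, approximable (F i)) -> approximable (fun x => \sum_(i <- s) F i x).
Proof.
move=> aF; elim: s => [|i s IH].
  by under eq_fun do rewrite big_nil; apply: approximable_trig; exact: trig_cst.
by under eq_fun do rewrite big_cons; exact: approximableD.
Qed.

(** Rays are a pi-system generating the Borel sets, and approximable indicators form a
    lambda-system: a countable disjoint union is a limit of finite ones, dominated by 1. *)
Lemma approximable_indic (A : set R) : measurable A ->
  approximable (fun x => (\1_A x)%:C).
Proof.
move=> mA.
have sA : <<s @RGenInftyO.G R >> A.
  exact: (eq_ind _ (fun M : set (set R) => M A) mA _ (@RGenInftyO.measurableE R)).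
apply: (@dynkin_induction _ (measurableTypeR R) (@RGenInftyO.G R)
  (fun A : set R => approximable (fun x => (\1_A x)%:C))) sA.
- exact: RGenInftyO.measurableE.
- move=> _ _ [x ->] [y ->]; exists (Num.min x y).
  by apply/seteqP; split => z; rewrite /= !in_itv/= lt_min => /andP.
- under eq_fun do rewrite indicT.
  by apply: approximable_trig; exact: (trig_cst 1%:C).
- by move=> _ [x ->]; exact: approximable_ray.
- move=> S mS aS.
  have -> : (fun x => (\1_(~` S) x)%:C) =
      (fun x => 1 + (-1) * (\1_S x)%:C) :> (R -> R[i]).
    apply/funext => x; rewrite !indicE in_setC mulN1r.
    by case: (x \in S); rewrite /= ?subrr ?subr0.
  by apply: approximableD; [by apply: approximable_trig; exact: trig_cst|exact: approximableZ].
- move=> F mF tF aF.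
  have sumE n x : \1_(\bigcup_(k in `I_n) F k) x = \sum_(k < n) \1_(F k) x :> R.
    rewrite indicE; case: (boolP (x \in _)); last first.
      rewrite notin_setE => nx; rewrite big1// => k _.
      by rewrite indicE memNset// => Fkx; apply: nx; exists k => //=.
    rewrite inE => -[k /= kn Fkx]; rewrite (bigD1 (Ordinal kn))//= big1 ?addr0.
      by rewrite indicE mem_set.
    move=> j jk; rewrite indicE memNset// => Fjx.
    have /trivIsetP/(_ j k I I) := tF.
    have jk' : (j : nat) != k by apply: contra jk => /eqP jk; apply/eqP/val_inj.
    by move=> /(_ jk') /seteqP[/(_ x) + _]; apply.
  apply: (@approximable_lim1 _ (fun n x => \1_(\bigcup_(k in `I_n) F k) x)).
  + by apply: measurable_indic; exact: bigcupT_measurable.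
  + exact: indic01.
  + by move=> n; exact: indic01.
  + move=> n; under eq_fun do rewrite sumE rmorph_sum.
    by apply: (@approximable_sum 'I_n _ (fun k x => (\1_(F k) x)%:C)) => k; exact: aF.
  + move=> x; apply: cvg_near_cst; rewrite indicE; case: (boolP (x \in _)).
      rewrite inE => -[k _ Fkx]; exists k.+1 => // n /= kn.
      by rewrite indicE mem_set//; exists k.
    rewrite notin_setE => nx; apply: nearW => n; rewrite indicE memNset//.
    by move=> [k _ Fkx]; apply: nx; exists k.
Qed.

Import HBNNSimple.

(** Simple functions increase to u, and the squared error is dominated by u ^ 2. *)
Lemma approximable_nonneg (u : R -> R) : measurable_fun setT u ->
  (forall x, 0 <= u x) -> mu.-integrable D (EFin \o (fun x => u x ^+ 2)) ->
  approximable (fun x => (u x)%:C).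
Proof.
move=> mu_ u0 iu; have mE : measurable_fun setT (EFin \o u).
  exact/measurable_EFinP.
pose g := nnsfun_approx measurableT mE.
have gu x : EFin \o g ^~ x @ \oo --> (u x)%:E.
  by apply: cvg_nnsfun_approx => // y _; rewrite lee_fin.
have gur x : (fun n => g n x) @ \oo --> u x.
  by have /fine_cvgP[_] := gu x; apply.
have gle n x : g n x <= u x.
  rewrite -(cvg_lim _ (gur x))//; apply: nondecreasing_cvgn_le.
    by move=> k l kl; have /lefP := nd_nnsfun_approx measurableT mE kl.
  by apply/cvg_ex; exists (u x).
apply: (@approximable_lim _ (fun n x => (g n x)%:C) (fun x => u x ^+ 2)) => //.
- move=> n.
  under eq_fun do rewrite fimfunE fsbig_finite// rmorph_sum.
  apply: approximable_sum => r.
  under eq_fun do rewrite rmorphM.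
  by apply: approximableZ; exact: approximable_indic.
- move=> n x _; rewrite nsq_realB.
  have := gle n x; have := u0 x; have : 0 <= g n x by []; nra.
- move=> x _; under eq_fun do rewrite nsq_realB.
  rewrite (_ : 0 = (u x - u x) * (u x - u x)); last by rewrite subrr mul0r.
  by apply: cvgM; apply: cvgB => //; exact: cvg_cst.
Qed.

Lemma trig_dense f : cmeasurable f -> (sqnorm f < +oo)%E -> approximable f.
Proof.
move=> mf finf; have [mr mi] := mf.
have intu (u : R -> R) : measurable_fun setT u ->
    (forall x, u x ^+ 2 <= nsq (f x)) ->
    mu.-integrable D (EFin \o (fun x => u x ^+ 2)).
  move=> mu_ uf; apply/integrableP; split.
    apply/measurable_EFinP; apply: (measurable_funS measurableT) => //.
    exact: measurable_funX.
  apply: le_lt_trans finf; apply: ge0_le_integral => //.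
  - do 2 apply: measurableT_comp => //.
    apply: (measurable_funS measurableT) => //; exact: measurable_funX.
  - by apply: (measurable_funS measurableT) => //; exact: measurable_nsq.
  - by move=> x _; rewrite /= ger0_norm ?sqr_ge0// lee_fin.
have sgn (u : R -> R) : measurable_fun setT u ->
    (forall x, u x ^+ 2 <= nsq (f x)) -> approximable (fun x => (u x)%:C).
  move=> mu_ uf.
  have -> : (fun x => (u x)%:C) = (fun x => (Num.max (u x) 0)%:C +
      (-1) * (Num.max (- u x) 0)%:C) :> (R -> R[i]).
    apply/funext => x; rewrite mulN1r -rmorphB; congr (_%:C).
    by have [h|h] := leP 0 (u x); [rewrite (max_r (_ : - _ <= 0)) ?subr0//; lra|
      rewrite max_l ?sub0r ?opprK//; lra].
  have mx (v : R -> R) : measurable_fun setT v ->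
      (forall x, v x ^+ 2 <= nsq (f x)) ->
      approximable (fun x => (Num.max (v x) 0)%:C).
    move=> mv vf.
    have mm : measurable_fun setT (fun x => Num.max (v x) 0).
      by apply: measurable_maxr => //; exact: measurable_cst.
    apply: approximable_nonneg => //; first by move=> x; rewrite le_max lexx orbT.
    apply: intu => // x; apply: le_trans (vf x).
    by have [h|h] := leP 0 (v x); rewrite ?expr0n/= ?sqr_ge0.
  apply: approximableD; first exact: mx.
  apply: approximableZ; apply: mx; first exact: measurableT_comp.
  by move=> x; rewrite sqrrN.
have -> : f = (fun x => (complex.Re (f x))%:C + 'i * (complex.Im (f x))%:C).
  by apply/funext => x; case: (f x) => p q; simpc.
apply: approximableD; first by apply: sgn => // x; rewrite lerDl sqr_ge0.
by apply: approximableZ; apply: sgn => // x; rewrite lerDr sqr_ge0.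
Qed.

End TrigonometricDensity.

(** * Sufficiency *)

Section Sufficiency.
Local Open Scope complex_scope.
Context (R : realType) (t1 t2 sg : R) (n : int).
Local Notation mu := (@lebesgue_measure R).
Local Notation plane := (measurableTypeR R * measurableTypeR R)%type.
Hypothesis sg1 : sg ^+ 2 = 1.
Hypothesis n0 : n != 0.
Hypothesis offset : t1 + 2^-1 = n%:~R + sg * (t2 + 2^-1).

Let nR0 : n%:~R != 0 :> R. Proof. by rewrite intr_eq0. Qed.

Let sgE : sg = 1 \/ sg = -1.
Proof. by move/eqP: sg1; rewrite sqrf_eq1 => /orP[]/eqP; [left|right]. Qed.

Definition fold_arm (y : measurableTypeR R) : measurableTypeR R :=
  n%:~R + sg * y.

Lemma measurable_fold_arm : measurable_fun setT fold_arm.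
Proof.
apply: measurable_funD; first exact: measurable_cst.
exact: mulrl_measurable.
Qed.

(** Both kinds of brackets occur because the reflection sg = -1 exchanges the open and closed
    ends. *)
Lemma fold_arm_itv (a b : R) (b0 b1 : bool) :
  mu (fold_arm @^-1` [set` Interval (BSide b0 a) (BSide b1 b)]) =
  mu [set` Interval (BSide b0 a) (BSide b1 b)].
Proof.
have [s1|s1] := sgE.
  have -> : fold_arm @^-1` [set` Interval (BSide b0 a) (BSide b1 b)] =
      [set` Interval (BSide b0 (a - n%:~R)) (BSide b1 (b - n%:~R))].
    apply/seteqP; split=> y; rewrite /= !in_itv/= /fold_arm s1 mul1r;
      by case: b0; case: b1 => /=; move=> /andP[h1 h2]; apply/andP; split; lra.
  rewrite !lebesgue_measure_itv/= !lte_fin ltrD2r; case: ifPn => // _.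
  by rewrite -!EFinB; congr EFin; ring.
have -> : fold_arm @^-1` [set` Interval (BSide b0 a) (BSide b1 b)] =
    [set` Interval (BSide (~~ b1) (n%:~R - b)) (BSide (~~ b0) (n%:~R - a))].
  apply/seteqP; split=> y; rewrite /= !in_itv/= /fold_arm s1 mulN1r;
    by case: b0; case: b1 => /=; move=> /andP[h1 h2]; apply/andP; split; lra.
rewrite !lebesgue_measure_itv/= !lte_fin ltrD2l ltrN2; case: ifPn => // _.
by rewrite -!EFinB; congr EFin; ring.
Qed.

Lemma lebesgue_fold_arm (A : set (measurableTypeR R)) : measurable A ->
  mu A = pushforward mu fold_arm A.
Proof.
pose mfold := isMeasurableFun.Build _ _ _ _ _ measurable_fold_arm.
pose fold : {mfun measurableTypeR R >-> measurableTypeR R} := HB.pack fold_arm mfold.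
apply: (lebesgue_measure_unique (mu := pushforward mu fold)) => X.
move=> /ocitvP[->|[[a b] /= ab ->]]; first by rewrite !measure0.
by rewrite /pushforward fold_arm_itv.
Qed.

Lemma integral_fold_arm (g : R -> \bar R) : measurable_fun setT g ->
  (forall x, 0 <= g x)%E ->
  (\int[lebesgue_segment t1 (t1 + 1)]_x g x =
   \int[lebesgue_segment t2 (t2 + 1)]_y g (fold_arm y))%E.
Proof.
move=> mg g0; have mgf : measurable_fun setT (g \o fold_arm).
  exact: (measurableT_comp mg measurable_fold_arm).
rewrite !integral_segment//.
pose mfold := isMeasurableFun.Build _ _ _ _ _ measurable_fold_arm.
pose fold : {mfun measurableTypeR R >-> measurableTypeR R} := HB.pack fold_arm mfold.
rewrite (eq_measure_integral (pushforward mu fold)); last first.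
  by move=> A mA _; exact: lebesgue_fold_arm.
rewrite ge0_integral_pushforward//; last exact: measurable_funS mg.
congr (integral mu _ _); have := offset.
by have [s1|s1] := sgE; rewrite s1 => e; apply/seteqP; split=> y;
  rewrite /= !in_itv/= /fold_arm s1 => /andP[h1 h2]; apply/andP; split; lra.
Qed.

(** * Orthogonality of the explicit spectrum *)

Definition freq (q : int * bool) : R := q.1%:~R + q.2%:R / (2 * n%:~R).

Definition line_spectrum : set (R * R) :=
  range (fun q : int * bool => (freq q, sg * freq q)).

Lemma countable_line_spectrum : countable line_spectrum.
Proof. by apply: card_le_trans (card_image_le _ _) (countableP _). Qed.

Lemma sinc_sg (d : R) : sinc (sg * d) = sinc d.
Proof. by have [->|->] := sgE; rewrite ?mul1r// mulN1r sincN. Qed.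

Lemma cos_half_int (d : R) (k : int) :
  d * n%:~R = k%:~R + 2^-1 \/ d * n%:~R = k%:~R - 2^-1 ->
  cos (2 * pi * d * n%:~R) = -1 /\ sin (2 * pi * d * n%:~R) = 0.
Proof.
move=> h; have [e|e] : 2 * pi * d * n%:~R = 2 * pi * k%:~R + pi \/
    2 * pi * d * n%:~R = 2 * pi * k%:~R - pi.
- by case: h => h; [left|right]; rewrite -mulrA h; field.
- by rewrite e cosDpi sinDpi cos_2pi_int sin_2pi_int oppr0.
- by rewrite e cosB sinB cos_2pi_int sin_2pi_int cospi sinpi; split; ring.
Qed.

(** By [offset] the two arm integrals differ by a phase factor of argument 2 pi n d. An integral d
    kills [sinc]; otherwise n d lies in 1/2 + Z and the factor is -1. *)
Lemma line_spectrum_orth (l m : R * R) : line_spectrum l -> line_spectrum m ->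
  l != m -> L2dot (rho t1 t2) (exponential l) (exponential m) = 0.
Proof.
move=> [p _ <-] [q _ <-] pq; rewrite L2dot_exponential/= -mulrBr.
set d := freq p - freq q.
have d0 : d != 0.
  by apply: contra pq; rewrite subr_eq0 => /eqP ->.
suff : arm t1 1 d + arm t2 1 (sg * d) = 0 by move=> ->; rewrite mulr0.
rewrite /arm !mul1r sinc_sg.
have sgd x : 2 * pi * (sg * d) * x = 2 * pi * d * (sg * x) by ring.
rewrite sgd offset mulrDr.
have [di|dn] := boolP (d \is a Num.int).
  rewrite sinc_int//; apply: complex_eqP; rewrite ?(ReD, ImD)/=; ring.
have [k hk] : exists k : int,
    d * n%:~R = k%:~R + 2^-1 \/ d * n%:~R = k%:~R - 2^-1.
  exists ((p.1 - q.1) * n).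
  have : d = (p.1 - q.1)%:~R + (p.2%:R - q.2%:R) / (2 * n%:~R).
    by rewrite /d /freq intrB; ring.
  case: (p.2); case: (q.2) => /=.
  - by rewrite subrr mul0r addr0 => e; rewrite e intr_int in dn.
  - by rewrite subr0 => ->; left; rewrite intrM; field.
  - by rewrite sub0r => ->; right; rewrite intrM; field.
  - by rewrite subrr mul0r addr0 => e; rewrite e intr_int in dn.
have [c s] := cos_half_int hk.
by apply: complex_eqP; rewrite ?(ReD, ImD)/= ?cosD ?sinD c s; ring.
Qed.

(** Coefficients belong to frequencies, not to positions in the list; [uniq] ensures that a term
    added at a frequency already present counts once. *)
Definition in_span (h : plane -> R[i]) := exists (s : seq (R * R)) (c : R * R -> R[i]),
  [/\ uniq s, [set` s] `<=` line_spectrum &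
      h = fun x => \sum_(l <- s) c l * exponential l x].

Lemma in_spanD1 h c l : line_spectrum l -> in_span h ->
  in_span (fun x => c * exponential l x + h x).
Proof.
move=> Ll [s [a [us sL ->]]].
(* The guard discards a possibly nonzero value of [a] at l when l is not in s. *)
pose a' m := (if m == l then c else 0) + (if m \in s then a m else 0).
have aE x : \sum_(m <- s) a m * exponential m x =
    \sum_(m <- s) (if m \in s then a m else 0) * exponential m x.
  by rewrite big_seq [RHS]big_seq; apply: eq_bigr => m ->.
have [ls|ls] := boolP (l \in s).
  exists s, a'; split => //; apply/funext => x; rewrite /a'.
  under [RHS]eq_bigr do rewrite mulrDl.
  rewrite big_split/= -aE; congr (_ + _).
  rewrite (bigD1_seq l)//= eqxx big1 ?addr0// => m ml.
  by rewrite (negbTE ml) mul0r.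
exists (l :: s), a'; split; first by rewrite /= ls.
  by move=> m /=; rewrite inE => /orP[/eqP ->//|]; exact: sL.
apply/funext => x; rewrite big_cons /a' eqxx (negbTE ls) addr0; congr (_ + _).
rewrite aE [LHS]big_seq [RHS]big_seq; apply: eq_bigr => m ms.
by have [ml|_] := eqVneq m l; rewrite ?add0r//; rewrite -ml ms in ls.
Qed.

Lemma in_span_sum (I : Type) (s : seq I) (F : I -> R[i]) (lam : I -> R * R) h :
  (forall i, line_spectrum (lam i)) -> in_span h ->
  in_span (fun x => \sum_(i <- s) F i * exponential (lam i) x + h x).
Proof.
move=> Llam hh; elim: s => [|i s IH].
  by under eq_fun do rewrite big_nil add0r.
under eq_fun do rewrite big_cons -addrA.
exact: in_spanD1.
Qed.

Lemma in_span0 : in_span (fun=> 0).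
Proof.
by exists [::], (fun=> 0); split => //; apply/funext => x; rewrite big_nil.
Qed.

(** Relabels the integers so that the restriction to the vertical arm is cis (2 pi k y) for both
    signs of [sg]. *)
Definition neg (k : int) : int := if sg == 1 then - k else k.

Lemma negE (k : int) : sg * (neg k)%:~R = - k%:~R.
Proof.
rewrite /neg; have [->|->] := sgE; first by rewrite eqxx mul1r mulrNz.
by rewrite eq_sym -subr_eq0 opprK (_ : 1 + 1 = 2%:R)// pnatr_eq0 mulN1r.
Qed.

Lemma cis_int (k : int) : cis (2 * pi * k%:~R) = 1 :> R[i].
Proof. by rewrite /cis cos_2pi_int sin_2pi_int. Qed.

Definition modulation (y : R) : R[i] := cis (- (2 * pi * (sg / (2 * n%:~R)) * y)).

Definition lam (b : bool) (k : int) : R * R :=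
  (freq (neg k, b), sg * freq (neg k, b)).

Lemma lam_spectrum b k : line_spectrum (lam b k).
Proof. by exists (neg k, b). Qed.

Lemma exponential_lam_snd (b : bool) (k : int) (y : R) :
  exponential (lam b k) (0, y) =
  (if b then modulation y else 1) * cis (2 * pi * k%:~R * y).
Proof.
rewrite exponential_snd /lam /freq /= (mulrDr sg) negE; case: b => /=.
  by rewrite /modulation cisD; congr cis; ring.
by rewrite mul0r mulr0 addr0 mul1r; congr cis; ring.
Qed.

(** Folding contributes the factor cis (- 2 pi n freq), equal to 1 at integers and to -1 on the
    translate by 1 / (2 n). *)
Lemma exponential_lam_fst (b : bool) (k : int) (y : R) :
  exponential (lam b k) (fold_arm y, 0) =
  (if b then - modulation y else 1) * cis (2 * pi * k%:~R * y).
Proof.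
have E : exponential (lam b k) (fold_arm y, 0) =
    cis (- (2 * pi * freq (neg k, b) * n%:~R)) * exponential (lam b k) (0, y).
  rewrite exponential_snd exponential_fst cisD; congr cis.
  by rewrite /lam/= /fold_arm; ring.
rewrite E exponential_lam_snd; case: b {E} => /=.
  rewrite mulrA; congr (_ * _); rewrite -[RHS]mulN1r; congr (_ * _).
  rewrite /freq/= (_ : - _ = 2 * pi * (- (neg k * n))%:~R + - pi); last first.
    by rewrite mulrNz intrM; field.
  rewrite -cisD cis_int mul1r; apply: complex_eqP; rewrite /= ?cosN ?sinN.
    by rewrite cospi.
  by rewrite sinpi.
rewrite !mul1r /freq/= mul0r addr0 (_ : - _ = 2 * pi * (- (neg k * n))%:~R).
  by rewrite cis_int mul1r.
by rewrite mulrNz intrM; ring.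
Qed.

(** * Completeness of the explicit spectrum *)

Lemma nsq_parallelogram (x y : R[i]) :
  nsq (x + y) + nsq (x - y) = 2 * nsq x + 2 * nsq y.
Proof. by rewrite /nsq !ReImE; ring. Qed.

Lemma nsq_cis (x : R) : nsq (cis x) = 1.
Proof. by rewrite /nsq/= cos2Dsin2. Qed.

Lemma integral_rho_fold (h : plane -> R) : measurable_fun setT h ->
  (forall x, 0 <= h x) ->
  (\int[rho t1 t2]_x (h x)%:E = (2^-1)%:E *
    \int[lebesgue_segment t2 (t2 + 1)]_y (h (fold_arm y, 0%R) + h (0%R, y))%:E)%E.
Proof.
move=> mh h0; have mhE : measurable_fun setT (fun x => (h x)%:E).
  exact/measurable_EFinP.
rewrite integral_rho_ge0//; congr (_ * _)%E.
have m1 : measurable_fun setT (fun x : measurableTypeR R => (h (x, 0))%:E).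
  by apply: (measurableT_comp mhE); exact: pair2_measurable.
have m2 : measurable_fun setT (fun x : measurableTypeR R => (h (0, x))%:E).
  by apply: (measurableT_comp mhE); exact: pair1_measurable.
rewrite integral_fold_arm//; last by move=> x; rewrite lee_fin.
rewrite -ge0_integralD//.
- by move=> x _; rewrite lee_fin.
- exact: (measurableT_comp m1 measurable_fold_arm).
- by move=> x _; rewrite lee_fin.
Qed.

Lemma sqnorm_segment (g : R -> R[i]) : cmeasurable (g : measurableTypeR R -> R[i]) ->
  (\int[lebesgue_segment t2 (t2 + 1)]_y (nsq (g y))%:E = sqnorm t2 g)%E.
Proof.
move=> mg; have m := measurable_nsq mg; rewrite integral_segment// /sqnorm.
by apply: integral_itv_bndoo; exact: measurable_funS m.
Qed.

Lemma line_spectrum_dense (f : plane -> R[i]) : L2 (rho t1 t2) f ->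
  forall eps : R, 0 < eps -> exists (s : seq (R * R)) (c : R * R -> R[i]),
    [set` s] `<=` line_spectrum /\
    (L2norm (rho t1 t2) (fun x => f x - \sum_(i <- s) c i * exponential i x)%R
      < eps%:E)%E.
Proof.
move=> [mr mi /L2norm_lty finf] eps eps0.
have mf : cmeasurable f by [].
have mnf : measurable_fun setT (fun x => nsq (f x)).
  by apply/measurable_EFinP; exact: measurable_nsq.
pose F1 (y : measurableTypeR R) := f (fold_arm y, 0).
pose F2 (y : measurableTypeR R) := f (0, y).
have mp1 : measurable_fun setT (fun y : measurableTypeR R => (fold_arm y, 0) : plane).
  exact: (measurableT_comp (pair2_measurable _) measurable_fold_arm).
have mF1 : cmeasurable F1.
  by split; [exact: (measurableT_comp mr mp1)|exact: (measurableT_comp mi mp1)].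
have mF2 : cmeasurable F2.
  by split; [apply: (measurableT_comp mr)|apply: (measurableT_comp mi)];
    exact: pair1_measurable.
have finF : (\int[lebesgue_segment t2 (t2 + 1)]_y (nsq (F1 y) + nsq (F2 y))%:E < +oo)%E.
  move: finf; rewrite integral_rho_fold//; last by move=> x; exact: nsq_ge0.
  set I := (\int[lebesgue_segment _ _]_y _)%E => h; rewrite ltey; apply/eqP => Iy.
  by move: h; rewrite -/I Iy gt0_muley ?ltxx// lte_fin invr_gt0.
(* [G 1] is the even part under exchange of the arms and [G (-1)] the odd part. [H] below is the odd
   part with its modulation removed, so that integral frequencies approximate it. *)
pose G (s : R) (y : measurableTypeR R) : R[i] := (2^-1)%:C * (F2 y + s%:C * F1 y).
have mG s : cmeasurable (G s).
  apply: cmeasurableM; first exact: cmeasurable_cst.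
  apply: cmeasurableD => //; apply: cmeasurableM => //; exact: cmeasurable_cst.
have mFF : measurable_fun setT
    (fun y : measurableTypeR R => (nsq (F1 y) + nsq (F2 y))%:E).
  by apply/measurable_EFinP; apply: measurable_funD;
    apply/measurable_EFinP; exact: measurable_nsq.
have finG s : s ^+ 2 = 1 -> (sqnorm t2 (G s) < +oo)%E.
  move=> s1; rewrite -sqnorm_segment//; apply: le_lt_trans finF.
  apply: ge0_le_integral => //.
  - by move=> y _; rewrite lee_fin nsq_ge0.
  - exact: measurable_nsq.
  - move=> y _; rewrite lee_fin /G nsqM.
    have := nsqD_le (F2 y) (s%:C * F1 y); rewrite nsqM.
    have -> : nsq s%:C = 1 by rewrite /nsq/= expr0n addr0.
    have -> : nsq (2^-1)%:C = 4^-1 :> R by rewrite /nsq/=; field.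
    have := nsq_ge0 (F1 y); have := nsq_ge0 (F2 y); lra.
pose H (y : measurableTypeR R) : R[i] := (modulation y)^* * G (-1) y.
have HE : H = fun y => cis (2 * pi * (sg / (2 * n%:~R)) * y) * G (-1) y.
  apply/funext => y; rewrite /H /modulation; congr (_ * _).
  by rewrite -[LHS]mul1r -cis0 cisB; congr cis; ring.
have mH : cmeasurable H.
  by rewrite HE; apply: cmeasurableM => //; exact: cmeasurable_cis.
have finH : (sqnorm t2 H < +oo)%E.
  rewrite /sqnorm HE; under eq_integral do rewrite nsqM nsq_cis mul1r.
  by apply: finG; rewrite sqrrN expr1n.
have modE y : modulation y * H y = G (-1) y.
  rewrite /H mulrA /modulation cisB subrr cis0 mul1r//.
have e2 : 0 < eps ^+ 2 / 2 by rewrite divr_gt0// exprn_gt0.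
have [_ /(_ _ e2)[_ [[sp ->] hp]]] := trig_dense (mG 1) (finG 1 (expr1n _ _)).
have [_ /(_ _ e2)[_ [[sq ->] hq]]] := trig_dense mH finH.
pose P (y : measurableTypeR R) : R[i] :=
  \sum_(q <- sp) q.1 * cis (2 * pi * q.2%:~R * y).
pose Q (y : measurableTypeR R) : R[i] :=
  \sum_(q <- sq) q.1 * cis (2 * pi * q.2%:~R * y).
have [s [c [us sL E]]] := @in_span_sum _ sp (fun q => q.1) (lam false \o snd) _
  (fun q => lam_spectrum false q.2)
  (@in_span_sum _ sq (fun q => q.1) (lam true \o snd) _
    (fun q => lam_spectrum true q.2) in_span0).
exists s, c; split => //; apply/L2norm_lt => //.
have Ex x : \sum_(i <- s) c i * exponential i x =
    \sum_(q <- sp) q.1 * exponential (lam false q.2) x +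
    (\sum_(q <- sq) q.1 * exponential (lam true q.2) x + 0).
  by have := congr1 (fun h => h x) E => /= <-.
have E2 y : f (0, y) - \sum_(i <- s) c i * exponential i (0, y) =
    (G 1 y - P y) + modulation y * (H y - Q y).
  have -> : \sum_(i <- s) c i * exponential i (0, y) = P y + modulation y * Q y.
    rewrite Ex addr0 mulr_sumr; congr (_ + _); apply: eq_bigr => q _ /=.
      by rewrite exponential_lam_snd mul1r.
    by rewrite exponential_lam_snd mulrCA.
  rewrite mulrBr modE -/(F2 y) /G.
  have {1}-> : F2 y = (2^-1)%:C * (F2 y + 1%:C * F1 y) +
      (2^-1)%:C * (F2 y + (-1)%:C * F1 y).
    by apply: complex_eqP; rewrite !ReImE/=; field.
  ring.
have E1 y : f (fold_arm y, 0) - \sum_(i <- s) c i * exponential i (fold_arm y, 0) =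
    (G 1 y - P y) - modulation y * (H y - Q y).
  have -> : \sum_(i <- s) c i * exponential i (fold_arm y, 0) =
      P y - modulation y * Q y.
    rewrite Ex addr0 mulr_sumr -sumrN; congr (_ + _); apply: eq_bigr => q _ /=.
      by rewrite exponential_lam_fst mul1r.
    by rewrite exponential_lam_fst mulrCA mulNr.
  rewrite mulrBr modE -/(F1 y) /G.
  have {1}-> : F1 y = (2^-1)%:C * (F2 y + 1%:C * F1 y) -
      (2^-1)%:C * (F2 y + (-1)%:C * F1 y).
    by apply: complex_eqP; rewrite !ReImE/=; field.
  ring.
have mh : measurable_fun setT
    (fun x : plane => nsq (f x - \sum_(i <- s) c i * exponential i x)).
  apply/measurable_EFinP; apply: measurable_nsq; apply: cmeasurableB => //.
  have [[h1 _] [h2 _]] : bounded_cmfun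
      (fun x : plane => \sum_(i <- s) c i * exponential i x).
    apply: bcmfun_sum => i; apply: bcmfunM; first exact: bcmfun_cst.
    exact: bcmfun_exponential.
  by split.
rewrite integral_rho_fold//; last by move=> x; exact: nsq_ge0.
have mP : cmeasurable P by apply: cmeasurable_trig; exists sp.
have mQ : cmeasurable Q by apply: cmeasurable_trig; exists sq.
have mA := measurable_nsq (cmeasurableB (mG 1) mP).
have mB := measurable_nsq (cmeasurableB mH mQ).
(* The errors on the two arms are A + m B and A - m B with |m| = 1; the factor 2 from the
   parallelogram law cancels the weight 1/2. *)
under eq_integral.
  move=> y _; rewrite E1 E2 addrC nsq_parallelogram nsqM nsq_cis mul1r -mulrDr.
  rewrite EFinM (EFinD (nsq _)); over.
rewrite ge0_integralZl//.
- rewrite ge0_integralD//; [|by move=> y _; rewrite lee_fin nsq_ge0..].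
  rewrite muleA -EFinM mulVf ?pnatr_eq0// mul1e.
  rewrite !sqnorm_segment; [|exact: cmeasurableB..].
  rewrite (_ : (eps ^+ 2)%:E = (eps ^+ 2 / 2)%:E + (eps ^+ 2 / 2)%:E)%E.
    exact: lteD.
  by rewrite -EFinD; congr EFin; field.
- exact: emeasurable_funD.
- by move=> y _; rewrite adde_ge0// lee_fin nsq_ge0.
Qed.

Lemma line_spectrumP : spectral_measure (rho t1 t2).
Proof.
exists line_spectrum; split; first exact: countable_line_spectrum.
split; [|exact: line_spectrum_orth|exact: line_spectrum_dense].
move=> l _; have hl := @bcmfun_exponential R l.
split; first exact: (bcmfun_L2 (rho t1 t2) hl).
apply/eqP => e0; have := L2norm_sqr (rho t1 t2) (exponential l).
have -> : (\int[rho t1 t2]_x (nsq (exponential l x))%:E = 1)%E.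
  have := integral_nsq (rho t1 t2) hl; rewrite exponential_normed; exact.
by rewrite e0 poweR0r ?pnatr_eq0// => /eqP; rewrite eq_sym onee_eq0.
Qed.

End Sufficiency.

Theorem theorem1p7 (R : realType) (t1 t2 : R) :
  spectral_measure (rho t1 t2) <->
  (t1 + t2 \is a Num.int /\ t1 + t2 <> -1) \/
  (t1 - t2 \is a Num.int /\ t1 - t2 <> 0).
Proof.
split; first exact: spectral_necessary.
case=> -[/intrP[k kE] k0].
  (* The centres t1 + 1/2 and -(t2 + 1/2) differ by t1 + t2 + 1, hence k + 1. *)
  apply: (@line_spectrumP R t1 t2 (-1) (k + 1)).
  - by rewrite sqrrN expr1n.
  - apply/eqP => k1; apply: k0; rewrite kE.
    by rewrite -[k](addrK 1) k1 sub0r mulrN1z.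
  - by rewrite intrD -kE; field.
apply: (@line_spectrumP R t1 t2 1 k).
- by rewrite expr1n.
- by apply/eqP => k1; apply: k0; rewrite kE k1.
- by rewrite -kE; field.
Qed.
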